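(* Suppose the group $G$ has a sequence of normal subgroups $G\supset G_1\supset G_2\supset\cdots$ with $\bigcap_{i\in\mathbb{N}}G_i=\{1\}$ and such that $G/G_i\in\mathcal{D}$ for every $i\in\mathbb{N}$. Let $B\in M(d\times d,\overline{\mathbb{Q}}G)$. Let $p_i\colon G\to G/G_i$ denote the natural epimorphism, and let $B[i]\in M(d\times d,\overline{\mathbb{Q}}[G/G_i])$ be the image of $B$ under the ring homomorphism induced by $p_i$. Then $$\dim_G(\ker(B))=\lim_{i\to\infty}\dim_{G/G_i}(\ker(B[i])).$$
   Context: $\overline{\mathbb{Q}}$ is the field of algebraic numbers in $\mathbb{C}$. For a discrete group $G$, $l^2(G)=\{f\colon G\to\mathbb{C}\mid \sum_{g\in G}|f(g)|^2<\infty\}$. A matrix $A\in M(d\times d,\mathbb{C}G)$ acts by left convolution as a bounded operator $A\colon l^2(G)^d\to l^2(G)^d$, which commutes with the right $G$-action. For a bounded operator $T$ on $l^2(G)^d$ commuting with the right $G$-action put $\mathrm{tr}_G(T)=\sum_{i=1}^d\langle Te_i,e_i\rangle$, where $e_i\in l^2(G)^d$ has the trivial element $1\in G\subset l^2(G)$ in the $i$-th position and zeros elsewhere. Put $\dim_G(\ker A)=\mathrm{tr}_G(\mathrm{pr}_{\ker A})$, where $\mathrm{pr}_{\ker A}$ is the orthogonal projection onto $\ker A\subset l^2(G)^d$. The class of elementary amenable groups is the smallest class of groups containing all cyclic and all finite groups and closed under group extensions and directed unions. $\mathcal{D}$ is the smallest non-empty class of groups such that: (i) if $G$ is torsion-free,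 $A$ is elementary amenable, and there is an epimorphism $p\colon G\to A$ such that $p^{-1}(E)\in\mathcal{D}$ for every finite subgroup $E$ of $A$, then $G\in\mathcal{D}$; (ii) $\mathcal{D}$ is closed under taking subgroups; (iii) if $(G_i)$ is a directed system of groups with all $G_i\in\mathcal{D}$ and $G$ is its (direct or inverse) limit, then $G\in\mathcal{D}$. Here ''directed system'' means that the index set $I$ is partially ordered, any two $i,j\in I$ admit $k\in I$ with $i<k$, $j<k$, and there are compatible homomorphisms $G_i\to G_j$ for $i<j$ (direct limit) or $G_j\to G_i$ for $i<j$ (inverse limit). *)

(* Defs.v *)
From HB Require Import structures.
From mathcomp Require Import all_boot all_order all_algebra finmap.
From mathcomp Require Import all_classical all_reals all_analysis.
From mathcomp Require summability.
From mathcomp Require Import generic_quotient complex.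

Set Implicit Arguments.
Unset Strict Implicit.
Unset Printing Implicit Defensive.

Import Order.TTheory GRing.Theory Num.Theory.
Import numFieldNormedType.Exports.

Local Open Scope classical_set_scope.
Local Open Scope ring_scope.
Local Open Scope complex_scope.
Local Open Scope quotient_scope.

(* Arbitrary (possibly infinite) groups are the [groupType]s of boot/monoid, and
   a subgroup of G is a [groupClosed G]. *)

Notation ghom G H := (UMagmaMorphism.type G H).

Definition subgroup_type (G : groupType) (S : groupClosed G) : Type :=
  {x : G | x \in S}.

HB.instance Definition _ (G : groupType) (S : groupClosed G) :=
  SubChoice.on (subgroup_type S).

Fact groupClosed_group_closed (G : groupType) (S : groupClosed G) :
  group_closed S.
Proof. by split; [exact: gpred1 | exact: gpredF]. Qed.

HB.instance Definition _ (G : groupType) (S : groupClosed G) :=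
  SubChoice_isSubGroup.Build G _ (subgroup_type S)
    (groupClosed_group_closed S).

Section Preimage.
Variables (G A : groupType) (p : ghom G A) (E : groupClosed A).

Definition gpreim : {pred G} := [pred x | p x \in E].

Fact gpreimM : mulg_closed gpreim.
Proof. by move=> x y; rewrite !inE gmulfM; exact: gpredM. Qed.

Fact gpreim1 : 1%g \in gpreim.
Proof. by rewrite inE gmulf1 gpred1. Qed.

Fact gpreimV : invg_closed gpreim.
Proof. by move=> x; rewrite !inE gmulfV gpredV. Qed.

HB.instance Definition _ := isMulClosed.Build G gpreim gpreimM.
HB.instance Definition _ := isMul1Closed.Build G gpreim gpreim1.
HB.instance Definition _ := isInvClosed.Build G gpreim gpreimV.

End Preimage.

Record normal_subgroup (G : groupType) := NormalSubgroup {
  nsub :> groupClosed G;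
  nsubJ : forall x y : G, x \in nsub -> (x ^ y)%g \in nsub }.


Section Quotient.
Variables (G : groupType) (N : normal_subgroup G).

Definition coset_rel : rel G := fun x y => (x^-1 * y)%g \in (N : groupClosed G).

Fact coset_rel_refl : reflexive coset_rel.
Proof. by move=> x; rewrite /coset_rel mulVg gpred1. Qed.

Fact coset_rel_sym : symmetric coset_rel.
Proof. by move=> x y; rewrite /coset_rel -[in RHS]gpredV invgM invgK. Qed.

Fact coset_rel_trans : transitive coset_rel.
Proof.
move=> y x z; rewrite /coset_rel => xy yz.
by have := gpredM _ _ xy yz; rewrite -mulgA (mulgA y) mulgV mul1g.
Qed.

Canonical coset_equiv :=
  EquivRel coset_rel coset_rel_refl coset_rel_sym coset_rel_trans.

Definition quotient_group : Type := {eq_quot coset_equiv}.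

HB.instance Definition _ := Choice.on quotient_group.
HB.instance Definition _ := EqQuotient.on quotient_group.

Local Notation Q := quotient_group.

Definition quot_mul (a b : Q) : Q := \pi_Q (repr a * repr b)%g.
Definition quot_inv (a : Q) : Q := \pi_Q (repr a)^-1%g.
Definition quot_one : Q := \pi_Q 1%g.

Fact pi_coset (x y : G) :
  reflect (\pi_Q x = \pi_Q y) ((x^-1 * y)%g \in (N : groupClosed G)).
Proof. exact: (@eqquotP _ coset_equiv _ x y). Qed.

Fact pi_quot_mul (x y : G) : quot_mul (\pi_Q x) (\pi_Q y) = \pi_Q (x * y)%g.
Proof.
apply/esym/pi_coset.
case: piP => x' /pi_coset xx'; case: piP => y' /pi_coset yy'.
have := gpredM _ _ (nsubJ y xx') yy'.
by rewrite conjgE invgM !mulgA mulgK.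
Qed.

Fact pi_quot_inv (x : G) : quot_inv (\pi_Q x) = \pi_Q x^-1%g.
Proof.
apply/esym/pi_coset; case: piP => x' /pi_coset xx'.
have := nsubJ x^-1%g xx'.
by rewrite conjgE invgK !mulgA mulgV mul1g -gpredV invgM !invgK.
Qed.

Fact quot_mulA : associative quot_mul.
Proof.
move=> a b c; rewrite -[a]reprK -[b]reprK -[c]reprK.
rewrite (pi_quot_mul (repr a) (repr b)) (pi_quot_mul (repr b) (repr c)).
by rewrite !pi_quot_mul mulgA.
Qed.

Fact quot_mul1g : left_id quot_one quot_mul.
Proof. by move=> a; rewrite -[a]reprK pi_quot_mul mul1g. Qed.

Fact quot_mulg1 : right_id quot_one quot_mul.
Proof. by move=> a; rewrite -[a]reprK pi_quot_mul mulg1. Qed.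

Fact quot_mulVg : left_inverse quot_one quot_inv quot_mul.
Proof. by move=> a; rewrite -[a]reprK pi_quot_inv pi_quot_mul mulVg. Qed.

Fact quot_mulgV : right_inverse quot_one quot_inv quot_mul.
Proof. by move=> a; rewrite -[a]reprK pi_quot_inv pi_quot_mul mulgV. Qed.

HB.instance Definition _ := isGroup.Build quotient_group
  quot_mulA quot_mul1g quot_mulg1 quot_mulVg quot_mulgV.

Definition quot_proj (x : G) : quotient_group := \pi_Q x.

Fact quot_projM : monoid.monoid_morphism quot_proj.
Proof. by split=> // x y; rewrite /quot_proj -pi_quot_mul. Qed.

HB.instance Definition _ :=
  isUMagmaMorphism.Build G quotient_group quot_proj quot_projM.

End Quotient.

Definition epimorphism (G H : groupType) (p : ghom G H) :=
  forall y, exists x, p x = y.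

Definition torsion_free (G : groupType) :=
  forall (x : G) (n : nat), (x ^+ n.+1)%g = 1%g -> x = 1%g.

Definition cyclic_group (G : groupType) :=
  exists x : G, forall y : G, exists n : nat, y = (x ^+ n)%g \/ y = (x ^- n)%g.

Definition finite_group (G : groupType) := finite_set [set: G].

Definition group_extension (N G Q : groupType) (i : ghom N G) (p : ghom G Q) :=
  [/\ injective i, epimorphism p &
      forall x, p x = 1%g <-> exists n, i n = x].

Definition directed_union (G : groupType) (I : Type) (H : I -> groupClosed G) :=
  (forall i j, exists k, {subset H i <= H k} /\ {subset H j <= H k}) /\
  (forall x, exists i, x \in H i).

Record ea_closed (C : groupType -> Prop) : Prop := {
  ea_cyclic : forall G, cyclic_group G -> C G;
  ea_finite : forall G, finite_group G -> C G;
  ea_extension : forall (N G Q : groupType) (i : ghom N G) (p : ghom G Q),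
    group_extension i p -> C N -> C Q -> C G;
  ea_union : forall (G : groupType) (I : Type) (H : I -> groupClosed G),
    directed_union H -> (forall i, C (subgroup_type (H i))) -> C G }.

Definition elementary_amenable (G : groupType) : Prop :=
  forall C : groupType -> Prop, ea_closed C -> C G.

Section Limits.
Variables (disp : Order.disp_t) (I : porderType disp) (S : I -> groupType).

Definition directed := forall i j : I, exists2 k, (i < k)%O & (j < k)%O.

Section Direct.
Variable f : forall i j : I, (i < j)%O -> ghom (S i) (S j).

Definition direct_system :=
  forall (i j k : I) (ij : (i < j)%O) (jk : (j < k)%O) (ik : (i < k)%O) x,
    f jk (f ij x) = f ik x.

Definition cocone (H : groupType) (u : forall i, ghom (S i) H) :=
  forall (i j : I) (ij : (i < j)%O) x, u j (f ij x) = u i x.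

Definition is_direct_limit (L : groupType) (u : forall i, ghom (S i) L) :=
  cocone u /\
  forall (H : groupType) (v : forall i, ghom (S i) H), cocone v ->
    exists h : ghom L H, (forall i x, h (u i x) = v i x) /\
      forall h' : ghom L H, (forall i x, h' (u i x) = v i x) -> h' =1 h.
End Direct.

Section Inverse.
Variable f : forall i j : I, (i < j)%O -> ghom (S j) (S i).

Definition inverse_system :=
  forall (i j k : I) (ij : (i < j)%O) (jk : (j < k)%O) (ik : (i < k)%O) x,
    f ij (f jk x) = f ik x.

Definition cone (H : groupType) (u : forall i, ghom H (S i)) :=
  forall (i j : I) (ij : (i < j)%O) x, f ij (u j x) = u i x.

Definition is_inverse_limit (L : groupType) (u : forall i, ghom L (S i)) :=
  cone u /\
  forall (H : groupType) (v : forall i, ghom H (S i)), cone v ->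
    exists h : ghom H L, (forall i x, u i (h x) = v i x) /\
      forall h' : ghom H L, (forall i x, u i (h' x) = v i x) -> h' =1 h.
End Inverse.

End Limits.

(* Subgroups are given by injective homomorphisms and limits by their universal
   property, so a class with these closure properties is closed under
   isomorphism. *)
Record D_closed (C : groupType -> Prop) : Prop := {
  D_epi : forall (G A : groupType) (p : ghom G A),
    torsion_free G -> elementary_amenable A -> epimorphism p ->
    (forall E : groupClosed A, finite_set [set a : A | a \in E] ->
       C (subgroup_type (gpreim p E))) ->
    C G;
  D_subgroup : forall (H G : groupType) (i : ghom H G),
    injective i -> C G -> C H;
  D_direct_limit : forall (disp : Order.disp_t) (I : porderType disp)
      (S : I -> groupType)
      (f : forall i j : I, (i < j)%O -> ghom (S i) (S j))
      (L : groupType) (u : forall i, ghom (S i) L),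
    directed I -> direct_system f -> is_direct_limit f u ->
    (forall i, C (S i)) -> C L;
  D_inverse_limit : forall (disp : Order.disp_t) (I : porderType disp)
      (S : I -> groupType)
      (f : forall i j : I, (i < j)%O -> ghom (S j) (S i))
      (L : groupType) (u : forall i, ghom L (S i)),
    directed I -> inverse_system f -> is_inverse_limit f u ->
    (forall i, C (S i)) -> C L }.

Definition class_D (G : groupType) : Prop :=
  forall C : groupType -> Prop, (exists H, C H) -> D_closed C -> C G.

Section L2.
Variables (R : realType) (G : groupType).
Local Notation C := R[i].

(* Only the additive and convolution-module structure of CG is needed; an
   element is the finitely supported function of its coefficients. *)
Definition group_ring := {fsfun G -> C with 0}.

Definition conv (a : group_ring) (f : G -> C) (g : G) : C :=
  \sum_(h <- finsupp a) a h * f (h^-1 * g)%g.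

Definition l2 : set (G -> C) :=
  [set f | (\esum_(g in [set: G])
              (ComplexField.Normc.normc (f g) ^+ 2)%:E < +oo)%E].

(* [summability.sum] is the unordered sum, i.e. the limit of the partial sums
   along the finite subsets of G; it converges when f and h are in l2. *)
Definition l2_inner (f h : G -> C) : C :=
  summability.sum (fun g => f g * (h g)^* : C^o).

Variable d : nat.
Local Notation V := ('I_d -> G -> C).

Definition l2n : set V := [set x | forall i, l2 (x i)].

Definition l2n_inner (x y : V) : C := \sum_i l2_inner (x i) (y i).

Definition mxact (A : 'M[group_ring]_d) (x : V) : V :=
  fun i g => \sum_j conv (A i j) (x j) g.

Definition l2_ker (A : 'M[group_ring]_d) : set V :=
  [set x | l2n x /\ mxact A x = (fun _ _ => 0)].

Definition orth_proj (K : set V) (x : V) : V :=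
  xget (fun _ _ => 0)
    [set y | K y /\
       forall z, K z -> l2n_inner (fun i g => x i g - y i g) z = 0].

Definition basis_vec (i : 'I_d) : V :=
  fun j g => if (j == i) && (g == 1%g) then 1 else 0.

Definition trG (T : V -> V) : C :=
  \sum_i l2n_inner (T (basis_vec i)) (basis_vec i).

Definition dim_ker (A : 'M[group_ring]_d) : C := trG (orth_proj (l2_ker A)).

End L2.

(* The ring homomorphism CG -> CH induced by p, extending p linearly. *)
Definition group_ring_map (R : realType) (G H : groupType) (p : ghom G H)
    (a : group_ring R G) : group_ring R H :=
  [fsfun y in (p @` finsupp a)%fset =>
     \sum_(x <- finsupp a | p x == y) a x | 0].

Definition algebraic_number (R : realType) (z : R[i]) :=
  algebraicOver (ratr : rat -> R[i]) z.

(* Main.v *)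
From HB Require Import structures.
Require Import Defs.
From mathcomp Require Import all_boot all_order all_algebra finmap.
From mathcomp Require Import all_classical all_reals all_analysis.
From mathcomp Require Import complex.
From mathcomp Require Import spectral mxpoly separable.
From mathcomp Require summability.
From mathcomp Require Import zify ring lra.
Import Order.TTheory GRing.Theory Num.Theory.
Import numFieldNormedType.Exports.

Set Implicit Arguments.
Unset Strict Implicit.
Unset Printing Implicit Defensive.

Local Open Scope ring_scope.

(** Let [T = 1 - B^* B / K], with [K] so large that [T] is a self-adjoint operator
    between 0 and 1. It is the identity exactly on the kernel of [B], so the
    traces of the powers [T^n] decrease to the dimension of the kernel
    ([rdim_le_damping_tr], [damping_tr_tends]). Each of these traces depends on
    finitely many elements of [G] and is therefore eventually the same for [B]
    and for [B[i]]. This gives at once that the limes superior of the dimensions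
    for [B[i]] is at most the dimension for [B] ([rdim_upper]).

    The reverse inequality needs the traces to converge at a rate that does not
    depend on [i]. If [B] has integer entries and is self-adjoint, it is provided
    by a lower bound for the determinants of the [B[i]], in the sense of Fuglede
    and Kadison. Expanding the logarithm, such a bound says that the sum over [n]
    of [(tr T^n - dim) / n] is at most a constant depending on [K] and the size of
    the matrix alone, and the divergence of the harmonic series leaves no room
    for a dimension that is too small infinitely often ([rdim_lower_herm]).

    The bound ([det_bound]) is a family of inequalities, each between finitely
    many moments of a matrix and a constant. For the group of one element it says
    that the product of the nonzero eigenvalues of an integer matrix, being a
    nonzero integer, is at least 1 in modulus ([trivial_det_bound]). Since each
    inequality involves finitely many group elements, the bound is inherited by
    subgroups, inverse limits, direct limits and directed unions
    ([det_bound_residual], [direct_limit_det_bound], [det_bound_exhaustion]).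
    It passes from the kernel of an epimorphism to its source if the quotient
    satisfies the Foelner condition: the moments are approximated by those of
    matrices over the kernel, indexed by a finite set of cosets that is almost
    invariant ([folner_extension]). Together these cover the whole class of
    groups ([class_D_det_bound]).

    Algebraic entries are reduced to integers. Replacing an algebraic number by its
    companion matrix amounts, up to similarity, to forming the block sum of
    the matrices obtained from its conjugates, and similar matrices have kernels
    of the same dimension ([similar_rdim]). A matrix with rational entries
    becomes integral after scaling and self-adjoint after forming the block sum
    with its adjoint. As the upper estimate holds for every block, the
    lower estimate for a block sum implies the one for each block
    ([rdim_lower_block], [rdim_lower_rat], [rdim_lower_span]).

    Matrices over group rings are kept as formal sums of elementary terms, which
    makes the finitely many group elements involved explicit and the passage to
    a quotient group a map on terms; the kernel dimension depends only on the
    operator that the sum defines ([dim_kerE], [dim_ker_map]). *)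

(** * Formal matrices over a group ring *)

(** A matrix over the group ring of [G], with rows and columns in [J], is kept
    as a formal sum of elementary terms [c * E_ij * g]. Terms are never
    collected, so a group homomorphism acts on the group components alone and
    the moduli of the coefficients do not change under it. *)
Definition gterm (K J G : Type) : Type := (K * (J * J) * G)%type.
Definition gmx (K J G : Type) : Type := seq (gterm K J G).

Definition tcoef K J G (e : gterm K J G) : K := e.1.1.
Definition trow K J G (e : gterm K J G) : J := e.1.2.1.
Definition tcol K J G (e : gterm K J G) : J := e.1.2.2.
Definition telt K J G (e : gterm K J G) : G := e.2.

(** The adjoint of [a] when [s] is the conjugation of the coefficients: complex
    conjugation, or the identity for integers. *)
Definition gm_star K J (G : groupType) (s : K -> K) (a : gmx K J G) : gmx K J G :=
  [seq (s (tcoef e), (tcol e, trow e), (telt e)^-1%g) | e <- a].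

Section GroupMatrices.
Variables (K : comPzRingType) (J : finType) (G : groupType).
Implicit Types (a b : gmx K J G) (e : gterm K J G) (x : J -> G -> K).

Definition tmul e f : gterm K J G :=
  (tcoef e * tcoef f, (trow e, tcol f), (telt e * telt f)%g).

Definition gm_mul a b : gmx K J G :=
  [seq tmul e f | e <- a, f <- [seq f <- b | tcol e == trow f]].

Definition gm_one : gmx K J G := [seq (1, (j, j), 1%g) | j <- enum J].

Fixpoint gm_pow a n : gmx K J G :=
  if n is n'.+1 then gm_mul a (gm_pow a n') else gm_one.

Definition gm_scale (c : K) a : gmx K J G :=
  [seq (c * tcoef e, (trow e, tcol e), telt e) | e <- a].

Definition gm_tr a : K :=
  \sum_(e <- a | (trow e == tcol e) && (telt e == 1%g)) tcoef e.

Definition gm_act a x : J -> G -> K := fun i g =>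
  \sum_(e <- a | trow e == i) tcoef e * x (tcol e) ((telt e)^-1 * g)%g.

Definition gm_delta (j : J) : J -> G -> K := fun i g =>
  ((i == j) && (g == 1%g))%:R.

Lemma big_gm_mul (T : nmodType) a b (F : gterm K J G -> T) :
  \sum_(x <- gm_mul a b) F x =
  \sum_(e <- a) \sum_(f <- b | tcol e == trow f) F (tmul e f).
Proof.
rewrite /gm_mul big_allpairs_dep /=; apply: eq_bigr => e _.
by rewrite big_filter.
Qed.

Lemma gm_act_mul a b x : gm_act (gm_mul a b) x = gm_act a (gm_act b x).
Proof.
apply/funext => i; apply/funext => g.
rewrite /gm_act big_mkcond big_gm_mul /= [RHS]big_mkcond; apply: eq_bigr => e _.
rewrite /tmul /= /trow /= -/(trow e); case: ifP => _; last by rewrite big1.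
rewrite mulr_sumr; apply: eq_big => [f|f _]; first by rewrite eq_sym.
by rewrite /tcoef /tcol /telt /= mulrA invgM !mulgA.
Qed.

Lemma gm_act_cat a b x : gm_act (a ++ b) x = fun i g => gm_act a x i g + gm_act b x i g.
Proof. by apply/funext => i; apply/funext => g; rewrite /gm_act big_cat. Qed.

Lemma big_gm_one (T : nmodType) (F : gterm K J G -> T) :
  \sum_(x <- gm_one) F x = \sum_j F (1, (j, j), 1%g).
Proof. by rewrite /gm_one big_map big_enum. Qed.

Lemma gm_act_one x : gm_act gm_one x = x.
Proof.
apply/funext => i; apply/funext => g; rewrite /gm_act big_mkcond big_gm_one.
rewrite -big_mkcond /= (big_pred1 i) => [|j]; last by rewrite /trow.
by rewrite /tcoef /tcol /telt /= mul1r invg1 mul1g.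
Qed.

Lemma gm_act_scale c a x :
  gm_act (gm_scale c a) x = fun i g => c * gm_act a x i g.
Proof.
apply/funext => i; apply/funext => g.
rewrite /gm_act /gm_scale big_map mulr_sumr; apply: eq_bigr => e _.
by rewrite /tcoef /= mulrA.
Qed.

Lemma gm_act_pow a n x : gm_act (gm_pow a n) x = iter n (gm_act a) x.
Proof. by elim: n => [|n IHn] /=; rewrite ?gm_act_one // gm_act_mul IHn. Qed.

Lemma gm_actZ a c x :
  gm_act a (fun i g => c * x i g) = fun i g => c * gm_act a x i g.
Proof.
apply/funext => i; apply/funext => g; rewrite /gm_act mulr_sumr.
by apply: eq_bigr => e _; rewrite mulrCA.
Qed.

Lemma gm_act_sum (I : Type) (r : seq I) a (x : I -> J -> G -> K) :
  gm_act a (fun i g => \sum_(k <- r) x k i g) =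
  fun i g => \sum_(k <- r) gm_act a (x k) i g.
Proof.
apply/funext => i; apply/funext => g; rewrite /gm_act exchange_big /=.
by apply: eq_bigr => e _; rewrite mulr_sumr.
Qed.

Lemma gm_trE a : gm_tr a = \sum_j gm_act a (gm_delta j) j 1%g.
Proof.
rewrite /gm_act (exchange_big_dep xpredT) //= /gm_tr big_mkcond /=.
apply: eq_bigr => e _; rewrite (big_pred1 (trow e)) => [|j]; last by rewrite eq_sym.
rewrite /gm_delta mulg1 (eq_sym (tcol e)) invg_eq1.
by case: ifP; rewrite (mulr1,mulr0).
Qed.

Lemma gm_tr_mul a b : gm_tr (gm_mul a b) =
  \sum_(e <- a) \sum_(f <- b)
    (if [&& tcol e == trow f, trow e == tcol f & telt e == (telt f)^-1%g]
     then tcoef e * tcoef f else 0).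
Proof.
rewrite /gm_tr big_mkcond big_gm_mul; apply: eq_bigr => e _.
rewrite big_mkcond; apply: eq_bigr => f _.
by rewrite /tmul /trow /tcol /telt /tcoef /= mulg_eq1; case: ifP.
Qed.

Lemma gm_tr_mulC a b : gm_tr (gm_mul a b) = gm_tr (gm_mul b a).
Proof.
rewrite !gm_tr_mul [RHS]exchange_big /=; apply: eq_bigr => e _.
apply: eq_bigr => f _; rewrite andbCA mulrC -eqg_invLR.
by rewrite (eq_sym (trow e)) (eq_sym (tcol e)) (eq_sym _ (telt f)).
Qed.

Lemma perm_gm_mul a a' b b' :
  perm_eq a a' -> perm_eq b b' -> perm_eq (gm_mul a b) (gm_mul a' b').
Proof.
move=> aa' bb'; apply: (@perm_trans _ (gm_mul a b')).
  apply/permP => P; rewrite -!sum1_count [LHS]big_mkcond [RHS]big_mkcond !big_gm_mul.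
  by apply: eq_bigr => e _; apply: perm_big.
apply/permP => P; rewrite -!sum1_count [LHS]big_mkcond [RHS]big_mkcond !big_gm_mul.
exact: perm_big.
Qed.

Lemma perm_gm_pow a a' n : perm_eq a a' -> perm_eq (gm_pow a n) (gm_pow a' n).
Proof. by move=> aa'; elim: n => //= n; apply: perm_gm_mul. Qed.

Lemma perm_gm_tr a a' : perm_eq a a' -> gm_tr a = gm_tr a'.
Proof. exact: perm_big. Qed.

Definition gm_row_norm (R : numDomainType) (f : K -> R) a i : R :=
  \sum_(e <- a | trow e == i) `|f (tcoef e)|.

End GroupMatrices.

Arguments gm_one {K J G}.

Definition gm_map K J (G H : Type) (p : G -> H) (a : gmx K J G) : gmx K J H :=
  [seq (e.1, p (telt e)) | e <- a].

Definition gm_coefs K L J G (f : K -> L) (a : gmx K J G) : gmx L J G :=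
  [seq (f (tcoef e), e.1.2, telt e) | e <- a].

Section Morphisms.
Variables (K : comPzRingType) (J : finType).

Lemma gm_map_cat (G H : groupType) (p : G -> H) (a b : gmx K J G) :
  gm_map p (a ++ b) = gm_map p a ++ gm_map p b.
Proof. exact: map_cat. Qed.

Lemma gm_map_comp (G H L : groupType) (p : G -> H) (q : H -> L) (a : gmx K J G) :
  gm_map q (gm_map p a) = gm_map (q \o p) a.
Proof. by rewrite /gm_map -map_comp. Qed.

Variables (G H : groupType) (p : ghom G H).
Implicit Types a b : gmx K J G.

Lemma gm_map_one : gm_map p (gm_one : gmx K J G) = gm_one.
Proof.
by rewrite /gm_map /gm_one -map_comp; apply: eq_map => j; rewrite /telt /= gmulf1.
Qed.

Lemma gm_map_mul a b : gm_map p (gm_mul a b) = gm_mul (gm_map p a) (gm_map p b).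
Proof.
rewrite /gm_mul /gm_map map_flatten -!map_comp; congr flatten.
apply: eq_map => e; rewrite /= filter_map -!map_comp; apply: eq_map => f.
by rewrite /tmul /telt /= gmulfM.
Qed.

Lemma gm_map_pow a n : gm_map p (gm_pow a n) = gm_pow (gm_map p a) n.
Proof. by elim: n => [|n IHn]; rewrite (gm_map_one, gm_map_mul) //= IHn. Qed.

Lemma gm_map_star s a : gm_map p (gm_star s a) = gm_star s (gm_map p a).
Proof.
by rewrite /gm_map /gm_star -!map_comp; apply: eq_map => e; rewrite /= /telt /= gmulfV.
Qed.

Lemma gm_row_norm_map (R : numDomainType) (f : K -> R) a i :
  gm_row_norm f (gm_map p a) i = gm_row_norm f a i.
Proof. by rewrite /gm_row_norm big_map. Qed.

End Morphisms.

Lemma gm_map_id K J (G : groupType) (a : gmx K J G) : gm_map idfun a = a.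
Proof. by rewrite /gm_map -[RHS]map_id; apply: eq_map => -[]. Qed.

(** The trace only sees which group elements are trivial, so two homomorphisms
    with the same kernel on the finitely many elements involved agree on it. *)
Lemma gm_tr_map2 (K : comPzRingType) (J : finType) (G H L : groupType)
    (p : ghom G H) (q : ghom G L) (a : gmx K J G) :
  (forall e, e \in a -> p (telt e) = 1%g <-> q (telt e) = 1%g) ->
  gm_tr (gm_map p a) = gm_tr (gm_map q a).
Proof.
move=> pq; rewrite /gm_tr /gm_map !big_map big_seq_cond [RHS]big_seq_cond.
apply: eq_bigl => e; case: (boolP (e \in a)) => //= /pq pqe; congr (_ && _).
by apply/eqP/eqP => /pqe.
Qed.

Section Coefficients.
Variables (K L : comPzRingType) (f : {rmorphism K -> L}) (J : finType).
Variable G : groupType.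
Implicit Types a b : gmx K J G.

Lemma gm_coefs_mul a b :
  gm_coefs f (gm_mul a b) = gm_mul (gm_coefs f a) (gm_coefs f b).
Proof.
rewrite /gm_mul /gm_coefs map_flatten -!map_comp; congr flatten.
apply: eq_map => e; rewrite /= filter_map -!map_comp; apply: eq_map => g.
by rewrite /tmul /tcoef /= rmorphM.
Qed.

Lemma gm_coefs_one : gm_coefs f (gm_one : gmx K J G) = gm_one.
Proof.
by rewrite /gm_coefs /gm_one -map_comp; apply: eq_map => j; rewrite /tcoef /= rmorph1.
Qed.

Lemma gm_coefs_pow a n : gm_coefs f (gm_pow a n) = gm_pow (gm_coefs f a) n.
Proof. by elim: n => [|n IHn]; rewrite (gm_coefs_one, gm_coefs_mul) //= IHn. Qed.

Lemma gm_coefs_cat a b : gm_coefs f (a ++ b) = gm_coefs f a ++ gm_coefs f b.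
Proof. exact: map_cat. Qed.

Lemma gm_tr_coefs a : gm_tr (gm_coefs f a) = f (gm_tr a).
Proof. by rewrite /gm_tr big_map rmorph_sum. Qed.

End Coefficients.

(** * The determinant bound *)

Section DetBound.
Variable R : realType.

(** Self-adjoint integer matrices are produced in the form [V + V^*], so that
    [V] is unconstrained and can be transported along any operation on terms. *)
Definition gm_herm (J : finType) (G : groupType) (V : gmx int J G) : gmx int J G :=
  V ++ gm_star idfun V.

(** The trace of the operator [q U]. *)
Definition gm_trp (J : finType) (G : groupType) (U : gmx int J G)
    (q : {poly R}) : R :=
  \sum_(k < size q) q`_k * (gm_tr (gm_pow U k))%:~R.

(** The polynomial [1 - X^2 / K], mapping a spectrum within [-sqrt K, sqrt K]
    into the unit interval and only [0] to [1]. *)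
Definition contraction (K : R) : {poly R} := 1 - K^-1 *: 'X^2.

(** As [\sum_(n >= 1) t^n / n = - ln (1 - t)], applying the trace to this
    polynomial of [U] and letting first [N], then [M] tend to infinity gives
    minus the integral of [ln (x^2 / K)] over the nonzero part of the spectrum
    of [U]. *)
Definition log_poly (K : R) (M N : nat) : {poly R} :=
  \sum_(1 <= n < M.+1) n%:R^-1 *: (contraction K ^+ n - contraction K ^+ N).

(** A lower bound for all the Fuglede-Kadison determinants of self-adjoint
    integer matrices over [G], phrased through finitely many moments at a
    time, which is what makes it stable under limits of groups. *)
Definition det_bound (G : groupType) : Prop :=
  forall (J : finType) (V : gmx int J G) (k : R) (M N : nat),
    1 <= k -> (forall i, gm_row_norm intr (gm_herm V) i <= k) ->
    gm_trp (gm_herm V) (log_poly (k ^+ 2) M N) <= #|J|%:R * ln (k ^+ 2).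

(** Each instance of the determinant bound involves finitely many moments and
    the row norms of one matrix; it suffices that these data occur over some
    group, depending on the instance, for which the bound is known. *)
Definition locally_det_bound (G : groupType) : Prop :=
  forall (J : finType) (V : gmx int J G) (d : nat),
    exists H : groupType, det_bound H /\ exists W : gmx int J H,
      (forall i, gm_row_norm (intr : int -> R) (gm_herm W) i =
                 gm_row_norm intr (gm_herm V) i) /\
      (forall n, (n < d)%N ->
         gm_tr (gm_pow (gm_herm W) n) = gm_tr (gm_pow (gm_herm V) n)).

Lemma locally_det_boundP (G : groupType) :
  locally_det_bound G -> det_bound G.
Proof.
move=> locG J V k M N k1 Vk.
have [H [dH [W [WV trWV]]]] := locG J V (size (log_poly (k ^+ 2) M N)).
have -> : gm_trp (gm_herm V) (log_poly (k ^+ 2) M N) =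
          gm_trp (gm_herm W) (log_poly (k ^+ 2) M N).
  by apply: eq_bigr => n _; rewrite trWV.
by apply: dH => // i; rewrite WV.
Qed.

Lemma gm_map_herm (J : finType) (G H : groupType) (p : ghom G H) (V : gmx int J G) :
  gm_map p (gm_herm V) = gm_herm (gm_map p V).
Proof. by rewrite /gm_herm gm_map_cat gm_map_star. Qed.

(** [s] collects the group elements in the powers of [gm_herm V] below order
    [d]: which of them become trivial is all that these moments depend on. *)
Lemma herm_moments_map (J : finType) (G : groupType) (V : gmx int J G) d :
  exists s : seq G, forall (H L : groupType) (p : ghom G H) (q : ghom G L),
    (forall g, g \in s -> p g = 1%g <-> q g = 1%g) ->
    (forall i, gm_row_norm (intr : int -> R) (gm_herm (gm_map p V)) i =
               gm_row_norm intr (gm_herm (gm_map q V)) i) /\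
    (forall n, (n < d)%N -> gm_tr (gm_pow (gm_herm (gm_map p V)) n) =
                            gm_tr (gm_pow (gm_herm (gm_map q V)) n)).
Proof.
exists [seq telt e | e <- flatten [seq gm_pow (gm_herm V) n | n <- iota 0 d]].
move=> H L p q pq; split=> [i|n nd]; first by rewrite -!gm_map_herm !gm_row_norm_map.
rewrite -!gm_map_herm -!gm_map_pow; apply: gm_tr_map2 => e en; apply: pq.
apply/map_f/flattenP; exists (gm_pow (gm_herm V) n) => //.
by apply/map_f; rewrite mem_iota.
Qed.

End DetBound.

(** * Groups of one element *)

Lemma is_derive_log_series (R : realType) (M : nat) (x : R) : x < 1 ->
  is_derive x 1 (fun y : R => ln (1 - y) + \sum_(n < M) n.+1%:R^-1 * y ^+ n.+1)
    (- (1 - x)^-1 + \sum_(n < M) x ^+ n).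
Proof.
move=> x1; elim: M => [|M IHM].
  rewrite (_ : (fun y => _) = (@ln R) \o (cst 1 - id)); last first.
    by apply/funext => y; rewrite big_ord0 addr0.
  rewrite big_ord0 addr0.
  have d1 : is_derive ((cst 1 - id) x) 1 (@ln R) (1 - x)^-1.
    by apply: is_derive1_ln; rewrite subr_gt0.
  have d2 : is_derive x 1 (cst 1 - id : R -> R) (0 - 1) by exact: is_deriveB.
  have := is_derive1_comp d1 d2; rewrite sub0r mulrN1; exact.
rewrite (_ : (fun y => _) = (fun y : R => ln (1 - y) + \sum_(n < M) n.+1%:R^-1 * y ^+ n.+1)
   + M.+1%:R^-1 \*: (id ^+ M.+1 : R -> R)); last first.
  by apply/funext => y; rewrite big_ord_recr /= addrA [in RHS]fctE /= exprfctE.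
rewrite big_ord_recr /= addrA; apply: is_deriveD.
have := is_deriveZ M.+1%:R^-1 (is_deriveX M.+1 (is_derive_id x 1)).
rewrite /GRing.scale /= mulr1 -mulr_natl mulrA mulVf ?mul1r ?pnatr_eq0 //.
Qed.

(** The difference of the two sides is 0 at 0 and has derivative
    [- t ^+ M / (1 - t)]. *)
Lemma log_series_le (R : realType) (M : nat) (t : R) : 0 <= t -> t < 1 ->
  \sum_(n < M) n.+1%:R^-1 * t ^+ n.+1 <= - ln (1 - t).
Proof.
move=> t0 t1; set f := fun y : R => ln (1 - y) + \sum_(n < M) n.+1%:R^-1 * y ^+ n.+1.
have df (x : R) : x < 1 -> is_derive x 1 f (- (1 - x)^-1 + \sum_(n < M) x ^+ n).
  exact: is_derive_log_series.
have f0 : f 0 = 0.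
  by rewrite /f subr0 ln1 add0r big1 // => n _; rewrite expr0n mulr0.
suff : f t <= f 0 by rewrite f0 /f; lra.
have := @ler0_derive1_le_cc R f 0 t; apply.
- by move=> x; rewrite in_itv /= => /andP[_ xt]; have [] := df x (lt_trans xt t1).
- move=> x; rewrite in_itv /= => /andP[x0 xt]; have x1 := lt_trans xt t1.
  have [_] := df x x1; rewrite derive1E => ->.
  have xn : 0 < 1 - x by lra.
  rewrite addrC subr_le0 -[leRHS]mul1r ler_pdivlMr // mulrC -opprB mulNr -subrX1 opprB.
  by rewrite lerBlDr lerDl exprn_ge0 // ltW.
- apply: derivable_within_continuous => x; rewrite in_itv /= => /andP[_ xt].
  by have [] := df x (le_lt_trans xt t1).
- by rewrite in_itv /= lexx t0.
- by rewrite in_itv /= lexx t0.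
- by [].
Qed.

(** The spectral data of a symmetric integer matrix. The product of the nonzero
    eigenvalues is up to sign the lowest nonzero coefficient of the
    characteristic polynomial, hence a nonzero integer. *)
Lemma int_symmetric_eigenvalues (R : realType) (n : nat) (M : 'M[int]_n) (k : R) :
  M^T = M -> (forall i, \sum_j `|(M i j)%:~R| <= k) ->
  exists l : 'I_n -> R,
    [/\ forall m, (\tr (M ^+ m))%:~R = \sum_i l i ^+ m,
        forall i, `|l i| <= k &
        1 <= \prod_(i | l i != 0) `|l i|].
Proof.
move=> symM rowM; pose A : 'M[R[i]]_n := map_mx intr M.
have symA : A \is hermsymmx.
  apply: realsym_hermsym; last by apply/mxOverP => i j; rewrite mxE realz.
  by apply/is_hermitianmxP; rewrite expr0 scale1r map_mx_id // /A map_trmx symM.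
have /orthomx_spectralP := hermitian_normalmx symA.
have := hermitian_spectral_diag_real symA.
set P := spectralmx A; set d := spectral_diag A => /mxOverP dreal AE.
have Pu : P \in unitmx by apply: spectral_unit.
pose l i := complex.Re (d 0 i); have lE i : d 0 i = (l i)%:C%C.
  by rewrite RRe_real.
have lC : injective (real_complex R) by exact: complexI.
have normcR (x : R) : ComplexField.Normc.normc x%:C%C = `|x|.
  by rewrite /= expr0n addr0 sqrtr_sqr.
exists l; split.
- move=> m; apply: lC; rewrite rmorph_int [RHS]rmorph_sum.
  have -> : (\tr (M ^+ m))%:~R = \tr (A ^+ m) by rewrite -trace_map_mx rmorphXn.
  have -> : A ^+ m = invmx P *m (diag_mx d) ^+ m *m P.
    elim: m => [|m IHm]; first by rewrite !expr0 mulmx1 mulVmx.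
    rewrite !exprS IHm -!mulmxE {1}AE !mulmxA.
    by rewrite mulmxK // !mulmxA.
  rewrite mxtrace_mulC mulmxA mulmxV // mul1mx.
  have -> : (diag_mx d) ^+ m = diag_mx (\row_i d 0 i ^+ m).
    elim: m => [|m IHm]; first by rewrite expr0 -[1]/(1%:M); apply/matrixP => i j; rewrite !mxE.
    rewrite exprS IHm -mulmxE mulmx_diag; congr diag_mx.
    by apply/rowP => i; rewrite !mxE exprS.
  by rewrite mxtrace_diag; apply: eq_bigr => i _; rewrite mxE lE rmorphXn.
(* Gershgorin's estimate, at the largest coordinate of an eigenvector. *)
- move=> i; have Pi0 : exists j, invmx P j i != 0.
    apply/existsP; rewrite -negb_forall; apply/negP => /forallP Pi.
    have : (P *m invmx P) i i = 0 by rewrite mxE big1 // => j _; rewrite (eqP (Pi j)) mulr0.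
    by rewrite mulmxV // mxE eqxx => /eqP; rewrite oner_eq0.
  pose q j := ComplexField.Normc.normc (invmx P j i).
  have q0 j : 0 <= q j by rewrite /q; case: (invmx P j i) => a b; rewrite sqrtr_ge0.
  have [j0 _] := Pi0.
  have [j _ jmax] := @Order.TotalTheory.arg_maxP _ _ _ j0 xpredT q isT.
  have qj : 0 < q j.
    have [j1 Pj1] := Pi0; apply: lt_le_trans (jmax j1 isT).
    rewrite lt_neqAle q0 andbT eq_sym; apply: contra_neq Pj1.
    exact: ComplexField.Normc.eq0_normc.
  rewrite -(ler_pM2r qj) -normcR -lE -ComplexField.Normc.normcM mulrC.
  have -> : invmx P j i * d 0 i = \sum_m A j m * invmx P m i.
    have /matrixP/(_ j i) : A *m invmx P = invmx P *m diag_mx d.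
      by rewrite {1}AE mulmxK.
    by rewrite mul_mx_diag !mxE.
  apply: (@le_trans _ _ (\sum_m `|(M j m)%:~R| * q m)).
    elim/big_ind2: _ => [|x a y b xa yb|m _].
    - by rewrite ComplexField.Normc.normc0.
    - by apply: le_trans (le_normcD _ _) _; apply: lerD.
    - rewrite ComplexField.Normc.normcM mxE.
      by rewrite -(rmorph_int (real_complex R)) normcR.
  apply: (@le_trans _ _ (\sum_m `|(M j m)%:~R| * q j)).
    by apply: ler_sum => m _; rewrite ler_wpM2l //; apply: jmax.
  by rewrite -mulr_suml ler_wpM2r.
- have charA : char_poly A = \prod_i ('X - (d 0 i)%:P).
  have -> : char_poly A = char_poly (diag_mx d).
    rewrite /char_poly; transitivity (\det (map_mx polyC (invmx P) *m
        char_poly_mx (diag_mx d) *m map_mx polyC P)).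
      congr (\det _); rewrite /char_poly_mx mulmxBr mulmxBl -!map_mxM -AE.
      by rewrite scalar_mxC -mulmxA -map_mxM mulVmx // map_mx1 mulmx1.
    rewrite !det_mulmx mulrC mulrA -det_mulmx -map_mxM mulmxV // map_mx1.
    by rewrite det1 mul1r.
  rewrite char_poly_trig ?diag_mx_is_trig //.
  by apply: eq_bigr => i _; rewrite !mxE eqxx.
pose m := #|[pred i | l i == 0]|.
have coefA : (char_poly A)`_m = \prod_(i | l i != 0) - d 0 i.
  rewrite charA (bigID [pred i | l i == 0]) /=.
  rewrite (eq_bigr (fun=> 'X)) => [|i /eqP li]; last by rewrite lE li polyC0 subr0.
  rewrite prodr_const mulrC coefMXn /m ltnn subnn.
  rewrite -horner_coef0 horner_prod; apply: eq_bigr => i _.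
  by rewrite !hornerE.
have /(congr1 (@ComplexField.Normc.normc R)) : ((char_poly M)`_m)%:~R = (char_poly A)`_m.
  by rewrite -map_char_poly coef_map.
rewrite -(rmorph_int (real_complex R)) normcR coefA.
have -> : ComplexField.Normc.normc (\prod_(i | l i != 0) - d 0 i) =
    \prod_(i | l i != 0) `|l i|.
  elim/big_ind2: _ => [|x a y b <- <-|i _].
  - exact: ComplexField.Normc.normc1.
  - exact: ComplexField.Normc.normcM.
  - by rewrite normcN lE normcR.
move=> <-; rewrite -intr_norm -[1]/(1%:~R) ler_int -gtz0_ge1 normr_gt0.
apply/eqP => coef0; move: coefA; rewrite -map_char_poly coef_map coef0 /=.
move/esym/eqP/prodf_eq0 => [i li].
by rewrite oppr_eq0 lE => /eqP/lC l0; rewrite l0 eqxx in li.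
Qed.

(** Over a one-element group a matrix is an ordinary integer matrix. Each
    nonzero eigenvalue [x] contributes at most [ln (K / x^2)] to the trace of
    [log_poly K M N], and the zero ones contribute nothing. *)
Lemma trivial_det_bound (R : realType) (G : groupType) :
  (forall g : G, g = 1%g) -> det_bound R G.
Proof.
move=> G1 J V k M N k1 Vk; set U := gm_herm V; set K := k ^+ 2.
pose mx (a : gmx int J G) : 'M[int]_#|J| := \matrix_(i, j)
  \sum_(e <- a | (trow e == enum_val i) && (tcol e == enum_val j)) tcoef e.
have sum_enum (T : nmodType) (F : J -> T) : \sum_(i < #|J|) F (enum_val i) = \sum_j F j.
  by rewrite [RHS](reindex_onto enum_val enum_rank) => [|i _]; rewrite ?enum_rankK //;
     apply: eq_bigl => i; rewrite enum_valK eqxx.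
have mxX n : mx (gm_pow U n) = mx U ^+ n.
  elim: n => [|n IHn].
    apply/matrixP => i j; rewrite expr0 !mxE big_mkcond big_gm_one.
    rewrite (bigD1 (enum_val i)) //= big1 ?addr0 => [|l li]; last first.
      by rewrite /trow /= (negPf li).
    by rewrite /trow /tcol /tcoef /= eqxx (inj_eq enum_val_inj); case: eqP.
  rewrite exprS -IHn -mulmxE; apply/matrixP => i j; rewrite !mxE /=.
  under [RHS]eq_bigr => l _ do rewrite !mxE big_distrlr /=.
  rewrite (sum_enum _ (fun l => \sum_(e <- U | (trow e == enum_val i) && (tcol e == l))
    \sum_(f <- gm_pow U n | (trow f == l) && (tcol f == enum_val j)) tcoef e * tcoef f)).
  rewrite big_mkcond big_gm_mul.
  rewrite [RHS](exchange_big_dep (fun e => trow e == enum_val i)) /=; last first.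
    by move=> l e _ /andP[].
  rewrite [RHS]big_mkcond; apply: eq_bigr => e _.
  rewrite /trow /= -/(trow e) -/(tcol e); case: eqP => [ei|_]; last by rewrite big1.
  rewrite (big_pred1 (tcol e)) => [|l]; last by rewrite eq_sym.
  by rewrite -big_mkcondr; apply: eq_bigl => f; rewrite eq_sym.
have trU n : gm_tr (gm_pow U n) = \tr (mx U ^+ n).
  rewrite -mxX /mxtrace /gm_tr; under [RHS]eq_bigr do rewrite mxE.
  rewrite (sum_enum _ (fun l => \sum_(e <- gm_pow U n | (trow e == l) && (tcol e == l)) tcoef e)).
  rewrite (exchange_big_dep xpredT) //= big_mkcond; apply: eq_bigr => e _.
  rewrite (G1 (telt e)) eqxx andbT; case: eqP => [ee|ee].
    by rewrite (big_pred1 (trow e)) // => l; rewrite ee andbb eq_sym.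
  by rewrite big_pred0 // => l; apply/andP => -[/eqP el /eqP el']; case: ee; rewrite el.
have symU : (mx U)^T = mx U.
  apply/matrixP => i j; rewrite !mxE.
  rewrite /U /gm_herm !big_cat /= addrC /gm_star !big_map.
  by congr (_ + _); apply: eq_bigl => e; rewrite /trow /tcol /= andbC.
have rowU i : \sum_j `|(mx U i j)%:~R| <= k :> R.
  apply: le_trans (Vk (enum_val i)); rewrite /gm_row_norm -/U.
  apply: (@le_trans _ _ (\sum_(j < #|J|)
     \sum_(e <- U | (trow e == enum_val i) && (tcol e == enum_val j)) `|(tcoef e)%:~R|)).
    by apply: ler_sum => j _; rewrite mxE rmorph_sum; apply: ler_norm_sum.
  rewrite (sum_enum _ (fun l => \sum_(e <- U | (trow e == enum_val i) && (tcol e == l)) `|(tcoef e)%:~R|)).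
  rewrite (exchange_big_dep (fun e => trow e == enum_val i)) /=; last by move=> l e _ /andP[].
  apply: ler_sum => e ei; rewrite (big_pred1 (tcol e)) // => l.
  by rewrite ei eq_sym.
have [l [trl lk prodl]] := int_symmetric_eigenvalues symU rowU.
have K1 : 1 <= K by rewrite exprn_ege1.
have K0 : 0 < K by apply: lt_le_trans K1.
have -> : gm_trp U (log_poly K M N) = \sum_i (log_poly K M N).[l i].
  under [RHS]eq_bigr => i _ do rewrite horner_coef.
  rewrite exchange_big; apply: eq_bigr => n _.
  by rewrite trU trl mulr_sumr.
have contrE x : (contraction K).[x] = 1 - x ^+ 2 / K.
  by rewrite /contraction hornerD hornerN hornerZ hornerXn hornerC mulrC.
have le_l i : (log_poly K M N).[l i] <= if l i == 0 then 0 else ln K - ln (`|l i| ^+ 2).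
  rewrite /log_poly horner_sum.
  under eq_bigr => n _ do rewrite hornerZ hornerD hornerN !horner_exp contrE.
  case: eqP => [->|/eqP li].
    rewrite expr0n mul0r subr0 big1 // => n _.
    by rewrite !expr1n subrr mulr0.
  have l0 : 0 < `|l i| by rewrite normr_gt0.
  have l2 : `|l i| ^+ 2 = l i ^+ 2 by rewrite real_normK ?num_real.
  set t := 1 - _.
  have t0 : 0 <= t.
    by rewrite /t subr_ge0 ler_pdivrMr // mul1r -l2 lerXn2r ?nnegrE // (le_trans ler01).
  have t1 : t < 1.
    by rewrite /t ltrBlDr ltrDl divr_gt0 // -l2 exprn_gt0.
  apply: (@le_trans _ _ (\sum_(n < M) n.+1%:R^-1 * t ^+ n.+1)).
    rewrite big_add1 /= big_mkord; apply: ler_sum => n _; rewrite ler_wpM2l //.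
    by rewrite lerBlDr lerDl exprn_ge0.
  apply: le_trans (log_series_le _ t0 t1) _.
  rewrite /t opprB addrCA subrr addr0 -l2 ln_div ?posrE ?exprn_gt0 //; lra.
apply: le_trans (ler_sum _ (fun i _ => le_l i)) _.
rewrite (eq_bigr (fun i => if l i != 0 then ln K - ln (`|l i| ^+ 2) else 0)); last first.
  by move=> i _; case: eqP.
rewrite -big_mkcond big_split /= sumrN.
have -> : \sum_(i | l i != 0) ln (`|l i| ^+ 2) = ln ((\prod_(i | l i != 0) `|l i|) ^+ 2).
  rewrite -prodrXl; apply/esym.
  suff [] : ln (\prod_(i | l i != 0) `|l i| ^+ 2) = \sum_(i | l i != 0) ln (`|l i| ^+ 2)
      /\ 0 < \prod_(i | l i != 0) `|l i| ^+ 2 by [].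
  apply: (big_rec2 (fun x y => ln x = y /\ 0 < x)); first by rewrite ln1.
  move=> i x y li [<- x0]; have l2 : 0 < `|l i| ^+ 2 by rewrite exprn_gt0 // normr_gt0.
  by rewrite lnM ?posrE // mulr_gt0.
apply: (@le_trans _ _ (\sum_(i | l i != 0) ln K)).
  by rewrite gerBl ln_ge0 // exprn_ege1.
rewrite sumr_const -[leLHS]mulr_natl ler_wpM2r ?ln_ge0 // ler_nat.
by rewrite -[X in (_ <= X)%N]card_ord max_card.
Qed.

(** * Subgroups and limits of groups *)

(** The moments involved in one instance of the bound are those of the image
    under a homomorphism that is faithful on the finite set [s] of relevant
    group elements. *)
Lemma det_bound_residual (R : realType) (G : groupType) :
  (forall s : seq G, exists (H : groupType) (p : ghom G H),
     det_bound R H /\ forall g, g \in s -> p g = 1%g -> g = 1%g) ->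
  det_bound R G.
Proof.
move=> resG; apply: locally_det_boundP => J V d.
have [s sV] := herm_moments_map R V d; have [H [p [dH ps]]] := resG s.
exists H; split=> //; exists (gm_map p V); rewrite -[in gm_herm V](gm_map_id V).
apply: (sV _ _ p idfun) => g gs; split=> [/(ps g gs)//|/= ->].
exact: gmulf1.
Qed.

Lemma subgroup_det_bound (R : realType) (H G : groupType) (i : ghom H G) :
  injective i -> det_bound R G -> det_bound R H.
Proof.
move=> inj_i dG; apply: det_bound_residual => s; exists G, i; split=> // g _ ig.
by apply: inj_i; rewrite ig gmulf1.
Qed.

Section PropSubgroup.
Variables (G : groupType) (P : G -> Prop).
Hypotheses (P1 : P 1%g) (PM : forall x y, P x -> P y -> P (x * y)%g).
Hypothesis PV : forall x, P x -> P x^-1%g.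

(** The closure hypotheses are arguments of the predicate, so that its closure
    instances can be found from the predicate alone. *)
Definition prop_pred of P 1%g & (forall x y, P x -> P y -> P (x * y)%g)
  & (forall x, P x -> P x^-1%g) : {pred G} := [pred x | `[< P x >]].
Local Notation S := (prop_pred P1 PM PV).

Fact prop_predM : mulg_closed S.
Proof. by move=> x y; rewrite !inE; apply: PM. Qed.
Fact prop_pred1 : 1%g \in S.
Proof. by rewrite inE. Qed.
Fact prop_predV : invg_closed S.
Proof. by move=> x; rewrite !inE; apply: PV. Qed.
HB.instance Definition _ := isMulClosed.Build G S prop_predM.
HB.instance Definition _ := isMul1Closed.Build G S prop_pred1.
HB.instance Definition _ := isInvClosed.Build G S prop_predV.

Lemma prop_subgroup : exists H : groupClosed G, forall x, x \in H <-> P x.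
Proof. by exists (GroupClosed.clone G S _) => x; rewrite inE. Qed.
End PropSubgroup.

Lemma trivial_subgroup (G : groupType) :
  exists H : groupClosed G, forall x, x \in H <-> x = 1%g.
Proof.
apply: prop_subgroup => [//|x y -> ->|x ->]; first by rewrite mulg1.
by rewrite invg1.
Qed.

Definition sub_incl (G : groupType) (S : groupClosed G) :
  ghom (subgroup_type S) G := val.

Lemma corestrict (H G : groupType) (p : ghom H G) (S : groupClosed G) :
  (forall x, p x \in S) ->
  exists q : ghom H (subgroup_type S), forall x, val (q x) = p x.
Proof.
move=> pS; pose q x : subgroup_type S := Sub (p x) (pS x).
have qM : monoid.monoid_morphism q.
  by split=> [|x y]; apply: val_inj; rewrite /= ?gmulf1 ?gmulfM.
pose m := isUMagmaMorphism.Build H (subgroup_type S) q qM.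
pose Q : ghom H (subgroup_type S) := HB.pack q m.
by exists Q.
Qed.

Lemma inverse_limit_separated (disp : Order.disp_t) (I : porderType disp)
    (S : I -> groupType) (f : forall i j : I, (i < j)%O -> ghom (S j) (S i))
    (L : groupType) (u : forall i, ghom L (S i)) :
  is_inverse_limit f u -> forall x, (forall i, u i x = 1%g) -> x = 1%g.
Proof.
move=> [cu univ] x ux.
have [||| K KP] := @prop_subgroup L (fun x => forall i, u i x = 1%g).
- by move=> i; rewrite gmulf1.
- by move=> y z uy uz i; rewrite gmulfM uy uz mulg1.
- by move=> y uy i; rewrite gmulfV uy invg1.
pose v i : ghom (subgroup_type K) (S i) := one_fun (S i).
have [|h [_ huniq]] := univ (subgroup_type K) v.
  by move=> i j ij y; rewrite /= gmulf1.
pose e : ghom (subgroup_type K) L := one_fun L.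
have xK : x \in K by apply/KP.
have /(_ (Sub x xK)) := huniq (sub_incl K) (fun i y => (KP _).1 (valP y) i).
rewrite -(huniq e) //= => i y.
by rewrite /= gmulf1.
Qed.

Lemma inverse_limit_det_bound (R : realType) (disp : Order.disp_t)
    (I : porderType disp) (S : I -> groupType)
    (f : forall i j : I, (i < j)%O -> ghom (S j) (S i))
    (L : groupType) (u : forall i, ghom L (S i)) :
  directed I -> is_inverse_limit f u -> (forall i, det_bound R (S i)) ->
  det_bound R L.
Proof.
move=> dirI limL dS; have sepL := inverse_limit_separated limL.
have [[i0 _]|noI] := pselect (exists i : I, True); last first.
  by apply: trivial_det_bound => g; apply: sepL => i; case: noI; exists i.
apply: det_bound_residual => s.
suff [i ui] : exists i, forall g, g \in s -> u i g = 1%g -> g = 1%g.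
  by exists (S i), (u i).
elim: s => [|g s [i ui]]; first by exists i0.
have [k [ik kg]] : exists k, (i < k)%O /\ (u k g = 1%g -> g = 1%g).
  have [g1|/eqP g1] := pselect (g = 1%g); first by have [k ik _] := dirI i i; exists k.
  have /existsNP[j ujg] : ~ forall j, u j g = 1%g by move/sepL; apply/eqP.
  have [k ik jk] := dirI i j; exists k; split=> // ukg.
  by case: ujg; rewrite -(limL.1 j k jk) ukg gmulf1.
exists k => h; rewrite inE => /predU1P[->//|hs ukh]; apply: ui => //.
by rewrite -(limL.1 i k ik) ukh gmulf1.
Qed.

Lemma ker_quot_proj (G : groupType) (N : normal_subgroup G) (x : G) :
  quot_proj N x = 1%g <-> x \in (N : groupClosed G).
Proof.
have : (1^-1 * x)%g = x by rewrite invg1 mul1g.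
move=> {2}<-; split=> [x1|/pi_coset x1]; last exact: esym x1.
by apply/pi_coset; apply: esym x1.
Qed.

(** The product of a family of groups modulo agreement on a tail of the
    directed index set. Unlike a direct limit it has a pointwise group law,
    and the members of a direct system map to it compatibly; an element becomes
    trivial there only if it does so at a later stage of the system. *)
Section ReducedProduct.
Variables (disp : Order.disp_t) (I : porderType disp) (S : I -> groupType).

Definition group_product : Type := forall k, S k.
HB.instance Definition _ := gen_eqMixin group_product.
HB.instance Definition _ := gen_choiceMixin group_product.

Definition gp_mul (x y : group_product) : group_product := fun k => (x k * y k)%g.
Definition gp_inv (x : group_product) : group_product := fun k => (x k)^-1%g.
Definition gp_one : group_product := fun k => 1%g.

Fact gp_mulA : associative gp_mul.
Proof. by move=> x y z; apply: functional_extensionality_dep => k; apply: mulgA. Qed.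
Fact gp_mul1g : left_id gp_one gp_mul.
Proof. by move=> x; apply: functional_extensionality_dep => k; apply: mul1g. Qed.
Fact gp_mulg1 : right_id gp_one gp_mul.
Proof. by move=> x; apply: functional_extensionality_dep => k; apply: mulg1. Qed.
Fact gp_mulVg : left_inverse gp_one gp_inv gp_mul.
Proof. by move=> x; apply: functional_extensionality_dep => k; apply: mulVg. Qed.
Fact gp_mulgV : right_inverse gp_one gp_inv gp_mul.
Proof. by move=> x; apply: functional_extensionality_dep => k; apply: mulgV. Qed.

HB.instance Definition _ := isGroup.Build group_product
  gp_mulA gp_mul1g gp_mulg1 gp_mulVg gp_mulgV.

Hypotheses (i0 : I) (dirI : directed I).

Lemma tail_trivial_subgroup : exists N : normal_subgroup group_product,
  forall x : group_product,
    x \in (N : groupClosed _) <-> exists i, forall k, (i < k)%O -> x k = 1%g.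
Proof.
have [|||N NP] := @prop_subgroup group_product
    (fun x => exists i, forall k, (i < k)%O -> x k = 1%g).
- by exists i0.
- move=> x y [i xi] [j yj]; have [l il jl] := dirI i j; exists l => k lk.
  by rewrite /monoid.mul /= /gp_mul xi ?yj ?mulg1 //; apply: lt_trans lk.
- move=> x [i xi]; exists i => k ik.
  by rewrite /monoid.inv /= /gp_inv xi ?invg1.
have NJ (x y : group_product) : x \in N -> (x ^ y)%g \in N.
  move=> /NP[i xi]; apply/NP; exists i => k ik.
  by rewrite conjgE /monoid.mul /= /gp_mul xi // mul1g; apply: mulVg.
by exists (NormalSubgroup NJ) => x; apply: NP.
Qed.

Variable f : forall i j : I, (i < j)%O -> ghom (S i) (S j).
Hypothesis fP : direct_system f.

Lemma direct_system_reduced : exists (H : groupType) (v : forall i, ghom (S i) H),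
  cocone f v /\
  forall i x, v i x = 1%g -> exists k (ik : (i < k)%O), f ik x = 1%g.
Proof.
have [N NP] := tail_trivial_subgroup.
pose w i (x : S i) : group_product := fun k =>
  if pselect (i < k)%O is left ik then f ik x else 1%g.
have wE i x k (ik : (i < k)%O) : w i x k = f ik x.
  rewrite /w; case: pselect => // ik'; congr (f _ x); exact: bool_irrelevance.
have wM i : monoid.monoid_morphism (w i).
  split=> [|x y]; apply: functional_extensionality_dep => k.
    by rewrite /w; case: pselect => // ?; rewrite gmulf1.
  by rewrite /w [RHS]/monoid.mul /= /gp_mul; case: pselect => ?; rewrite ?gmulfM ?mulg1.
pose m i := isUMagmaMorphism.Build (S i) group_product (w i) (wM i).
pose W i : ghom (S i) group_product := HB.pack (w i) (m i).
pose pr : ghom group_product (quotient_group N) := quot_proj N.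
exists (quotient_group N), (fun i => pr \o W i); split; last first.
  move=> i x /= /ker_quot_proj/NP[j wj]; have [k jk ik] := dirI j i.
  by exists k, ik; rewrite -wE wj.
move=> i j ij x; apply/divg1_eq; rewrite /= -(gmulfF pr); apply/ker_quot_proj/NP.
exists j => k jk; rewrite /monoid.mul /= /gp_mul /monoid.inv /= /gp_inv.
by rewrite (wE _ _ _ jk) (wE _ _ _ (lt_trans ij jk)) (fP ij jk (lt_trans ij jk)) mulgV.
Qed.

End ReducedProduct.

Lemma direct_limit_kernel (disp : Order.disp_t) (I : porderType disp)
    (S : I -> groupType) (f : forall i j : I, (i < j)%O -> ghom (S i) (S j))
    (L : groupType) (u : forall i, ghom (S i) L) :
  directed I -> direct_system f -> is_direct_limit f u ->
  forall i x, u i x = 1%g -> exists k (ik : (i < k)%O), f i k ik x = 1%g.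
Proof.
move=> dirI fP [cu univ] i x ux.
have [H [v [cv vP]]] := direct_system_reduced i dirI fP.
by have [h [hu _]] := univ H v cv; apply: vP; rewrite -hu ux gmulf1.
Qed.

(** The images form a subgroup through which the universal cocone factors, and
    the identity of the limit is the only endomorphism compatible with it. *)
Lemma direct_limit_surjective (disp : Order.disp_t) (I : porderType disp)
    (S : I -> groupType) (f : forall i j : I, (i < j)%O -> ghom (S i) (S j))
    (L : groupType) (u : forall i, ghom (S i) L) (i0 : I) :
  directed I -> is_direct_limit f u -> forall y, exists i x, u i x = y.
Proof.
move=> dirI [cu univ] y.
have [|||U UP] := @prop_subgroup L (fun y => exists i x, u i x = y).
- by exists i0, 1%g; rewrite gmulf1.
- move=> _ _ [i [x <-]] [j [z <-]]; have [k ik jk] := dirI i j.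
  by exists k, (f i k ik x * f j k jk z)%g; rewrite gmulfM !cu.
- by move=> _ [i [x <-]]; exists i, x^-1%g; rewrite gmulfV.
have uU i x : u i x \in U by apply/UP; exists i, x.
pose v i := proj1_sig (cid (corestrict (uU i))).
have vE i x : val (v i x) = u i x by rewrite /v; case: cid.
have [|h [hu _]] := univ (subgroup_type U) v.
  by move=> i j ij x; apply: val_inj; rewrite !vE cu.
have [h0 [_ h0P]] := univ L u cu.
pose hh : ghom L L := sub_incl U \o h.
have hy : val (h y) = y.
  rewrite -[RHS]/((idfun : ghom L L) y) (h0P idfun) // -(h0P hh) // => i x.
  by rewrite /hh /= hu; apply: vE.
by apply/UP; rewrite -hy; apply: valP.
Qed.

Lemma direct_limit_det_bound (R : realType) (disp : Order.disp_t)
    (I : porderType disp) (S : I -> groupType)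
    (f : forall i j : I, (i < j)%O -> ghom (S i) (S j))
    (L : groupType) (u : forall i, ghom (S i) L) :
  directed I -> direct_system f -> is_direct_limit f u ->
  (forall i, det_bound R (S i)) -> det_bound R L.
Proof.
move=> dirI fP limL dS; have kerL := direct_limit_kernel dirI fP limL.
have [cu univ] := limL.
have [[i0 _]|noI] := pselect (exists i : I, True); last first.
  have [h0 [_ h0P]] := univ L u cu.
  apply: trivial_det_bound => g.
  pose e : ghom L L := one_fun L.
  rewrite -[LHS]/((idfun : ghom L L) g) (h0P idfun) // -(h0P e) //.
  by move=> i; case: noI; exists i.
have surL := direct_limit_surjective i0 dirI limL.
apply: locally_det_boundP => J V d.
have [i [W WV]] : exists i (W : gmx int J (S i)), gm_map (u i) W = V.
  elim: V => [|[cij g] V [i [W WV]]]; first by exists i0, [::].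
  have [j [x xg]] := surL g; have [k ik jk] := dirI i j.
  exists k, ((cij, f j k jk x) :: gm_map (f i k ik) W).
  rewrite [LHS]/gm_map /= -/(gm_map _ _) /telt /= cu xg -WV gm_map_comp.
  by congr (_ :: _); apply: eq_map => e; rewrite /= cu.
have [s sW] := herm_moments_map R W d.
have [k [ik fk]] : exists k (ik : (i < k)%O), forall g, g \in s ->
    u i g = 1%g -> f i k ik g = 1%g.
  elim: s {sW} => [|g s [k [ik fk]]]; first by have [k ik _] := dirI i i; exists k, ik.
  have [l [kl lg]] : exists l (kl : (k < l)%O),
      u i g = 1%g -> f i l (lt_trans ik kl) g = 1%g.
    have [ug|ug] := pselect (u i g = 1%g); last first.
      by have [l kl _] := dirI k k; exists l, kl.
    have := kerL k (f i k ik g); rewrite cu => /(_ ug)[l [kl flg]].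
    by exists l, kl => _; rewrite -(fP _ _ _ ik kl) flg.
  exists l, (lt_trans ik kl) => h; rewrite inE => /predU1P[->//|hs /(fk h hs) fh].
  by rewrite -(fP _ _ _ ik kl) fh gmulf1.
exists (S k); split=> //; exists (gm_map (f i k ik) W); rewrite -WV; apply: sW => g gs.
by split=> [fg|/(fk g gs)//]; rewrite -(cu i k ik) fg gmulf1.
Qed.

(** * Extensions by amenable groups *)

(** The Foelner condition, which characterizes amenability; the proportion of
    elements of [F] moved out of [F] is bounded by [1 / m]. *)
Definition folner (Q : groupType) : Prop :=
  forall (S : seq Q) (m : nat), exists F : {fset Q},
    (0 < #|{: F}|)%N /\
    (m * #|[pred q : F | has (fun h => (h * val q)%g \notin F) S]| <= #|{: F}|)%N.

Section Compression.
Variables (G Q : groupType) (p : ghom G Q) (s : Q -> G).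
Hypothesis sK : forall q, p (s q) = q.
Variables (K : groupClosed G) (KP : forall x, x \in K <-> p x = 1%g).
Variables (J : finType) (F : {fset Q}).
Implicit Types (a : gmx int J G) (e : gterm int J G) (q : F).

(** In the coordinates provided by the section [s], the group element [g]
    carries the coset over [q] to the one over [p g * q], and acts between
    them as this element of the kernel. *)
Definition coset_elt (q' : Q) (g : G) (q : Q) : subgroup_type K :=
  insubd (1%g : subgroup_type K) ((s q')^-1 * g * s q)%g.

Lemma coset_eltE (q' q : Q) g : q' = (p g * q)%g ->
  val (coset_elt q' g q) = ((s q')^-1 * g * s q)%g.
Proof.
move=> ->; rewrite insubdK //; apply/KP.
by rewrite !gmulfM gmulfV !sK -mulgA mulVg.
Qed.

Definition compress_term e q' q : gterm int (J * F)%type (subgroup_type K) :=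
  (tcoef e, ((trow e, q'), (tcol e, q)), coset_elt (val q') (telt e) (val q)).

(** The part of [a] acting between the cosets over [F], as a matrix over the
    kernel of [p]. *)
Definition compress a : gmx int (J * F)%type (subgroup_type K) :=
  [seq compress_term e qq.1 qq.2 | e <- a,
     qq <- [seq qq <- enum {: F * F} | val qq.1 == (p (telt e) * val qq.2)%g]].

Lemma big_compress (T : nmodType) a (Phi : _ -> T) :
  \sum_(x <- compress a) Phi x =
  \sum_(e <- a) \sum_(q : F) \sum_(q' : F | val q' == (p (telt e) * val q)%g)
     Phi (compress_term e q' q).
Proof.
rewrite /compress big_allpairs_dep; apply: eq_bigr => e _.
rewrite big_filter big_enum_cond /= (exchange_big_dep xpredT) //= pair_big_dep.
by apply: eq_big => -[].
Qed.

(** Products of terms of [a] all of whose right factors keep the coset over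
    [q] inside [F]. *)
Fixpoint cut_pow a q n : gmx int J G :=
  if n is n'.+1 then
    [seq x <- gm_mul a (cut_pow a q n') | (p (telt x) * val q)%g \in F]
  else gm_one.

Lemma cut_pow_in a q n e : e \in cut_pow a q n -> (p (telt e) * val q)%g \in F.
Proof.
case: n => [/mapP[j _ ->]|n] /=; last by rewrite mem_filter => /andP[].
by rewrite /telt /= gmulf1 mul1g; apply: valP.
Qed.

Lemma big_pow_compress a n (T : nmodType) (Phi : _ -> T) :
  \sum_(x <- gm_pow (compress a) n) Phi x =
  \sum_(q : F) \sum_(e <- cut_pow a q n)
    \sum_(q' : F | val q' == (p (telt e) * val q)%g) Phi (compress_term e q' q).
Proof.
elim: n Phi => [|n IHn] Phi /=.
  transitivity (\sum_(j : J) \sum_(q : F) Phi (1, ((j, q), (j, q)), 1%g)).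
    by rewrite big_gm_one pair_big; apply: eq_bigr => -[].
  rewrite exchange_big; apply: eq_bigr => q _; rewrite big_gm_one.
  apply: eq_bigr => j _; rewrite (big_pred1 q) => [|q']; last first.
    by rewrite /telt /= gmulf1 mul1g.
  congr (Phi (_, _, _)); apply: val_inj.
  by rewrite coset_eltE /telt /= ?gmulf1 ?mul1g // mulg1 mulVg.
rewrite big_gm_mul big_compress.
transitivity (\sum_(e <- a) \sum_(q2 : F)
   \sum_(q1 : F | val q1 == (p (telt e) * val q2)%g)
   \sum_(q : F) \sum_(f <- cut_pow a q n)
    \sum_(q' : F | val q' == (p (telt f) * val q)%g)
    if (tcol e == trow f) && (q2 == q')
    then Phi (tmul (compress_term e q1 q2) (compress_term f q' q)) else 0).
  apply: eq_bigr => e _; apply: eq_bigr => q2 _; apply: eq_bigr => q1 _.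
  by rewrite big_mkcond IHn.
transitivity (\sum_(q : F) \sum_(e <- a) \sum_(f <- cut_pow a q n)
   \sum_(q2 : F) \sum_(q1 : F | val q1 == (p (telt e) * val q2)%g)
    \sum_(q' : F | val q' == (p (telt f) * val q)%g)
    if (tcol e == trow f) && (q2 == q')
    then Phi (tmul (compress_term e q1 q2) (compress_term f q' q)) else 0).
  rewrite [RHS]exchange_big; apply: eq_bigr => e _.
  under eq_bigr => q2 _ do rewrite exchange_big.
  rewrite exchange_big; apply: eq_bigr => q _.
  under eq_bigr => q2 _ do rewrite exchange_big.
  by rewrite exchange_big.
apply: eq_bigr => q _.
rewrite [RHS]big_filter [RHS]big_mkcond big_gm_mul; apply: eq_bigr => e _.
rewrite [RHS]big_mkcond big_seq_cond [RHS]big_seq_cond; apply: eq_bigr => f.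
rewrite andbT => /cut_pow_in fq.
have [ef|_] /= := eqVneq (tcol e) (trow f); last first.
  by rewrite big1 // => q2 _; rewrite big1 // => q1 _; rewrite big1.
rewrite (bigD1 [` fq]%fset) //= [X in _ + X]big1 ?addr0 => [|q2 q2n]; last first.
  rewrite big1 // => q1 _; rewrite big1 // => q' /eqP qq'; case: eqP => // q2q'.
  by case/eqP: q2n; apply: val_inj; rewrite q2q' -[RHS]qq'.
rewrite /tmul [in RHS]/telt /= gmulfM -mulgA.
rewrite [RHS](_ : _ = \sum_(q' : F | val q' == (p (telt e) * (p (telt f) * val q))%g)
  Phi (compress_term (tmul e f) q' q)); last first.
  case: ifPn => // nF; rewrite big_pred0 // => q'; apply/eqP => E.
  by case/negP: nF; rewrite -E; apply: valP.
apply: eq_bigr => q1 /eqP q1E.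
rewrite (big_pred1 [` fq]%fset) => [|q']; last by rewrite /= -val_eqE.
rewrite eqxx /=; congr (Phi (_, _, _)); apply: val_inj.
rewrite gmulfM [RHS]coset_eltE; last by rewrite /telt /= gmulfM -mulgA.
rewrite [X in (X * _)%g]coset_eltE // [X in (_ * X)%g]coset_eltE //.
by rewrite -!mulgA mulVKg.
Qed.

Lemma gm_tr_compress a n :
  gm_tr (gm_pow (compress a) n) = \sum_(q : F) gm_tr (cut_pow a q n).
Proof.
rewrite {1}/gm_tr big_mkcond big_pow_compress; apply: eq_bigr => q _.
rewrite /gm_tr [RHS]big_mkcond big_seq_cond [RHS]big_seq_cond.
apply: eq_bigr => e; rewrite andbT => /cut_pow_in eq.
rewrite (big_pred1 [` eq]%fset) => [|q']; last by rewrite /= -val_eqE.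
rewrite /compress_term /trow /tcol /tcoef /= xpair_eqE -val_eqE /=.
rewrite -andbA; congr (if _ && _ then _ else _); apply/andP/eqP => [[/eqP pq /eqP]|e1].
  move/(congr1 val); rewrite coset_eltE ?pq // gmulf1.
  by rewrite -mulgA => /mulg1_eq; rewrite invgK -[LHS]mul1g => /mulIg.
rewrite e1 gmulf1 mul1g eqxx; split=> //; apply/eqP/val_inj.
by rewrite coset_eltE ?gmulf1 ?mul1g // mulg1 mulVg.
Qed.

Lemma perm_compress_star a :
  perm_eq (gm_star idfun (compress a)) (compress (gm_star idfun a)).
Proof.
apply/permP => P; rewrite -!sum1_count [LHS]big_mkcond [RHS]big_mkcond /=.
rewrite {1}/gm_star big_map !big_compress big_map; apply: eq_bigr => e _.
rewrite (exchange_big_dep xpredT) //=; apply: eq_bigr => q _.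
apply: eq_big => [q'|q' /eqP qE].
  by rewrite /telt /= gmulfV; apply/eqP/eqP => ->; rewrite (mulKg, mulVKg).
congr (if P (_, _, _) then _ else _); apply: val_inj; rewrite gmulfV.
rewrite [X in (X^-1)%g]coset_eltE // [RHS]coset_eltE /telt /= ?gmulfV ?qE ?mulKg //.
by rewrite !invgM invgK mulgA.
Qed.

Lemma perm_compress_herm a :
  perm_eq (gm_herm (compress a)) (compress (gm_herm a)).
Proof.
rewrite /gm_herm /compress allpairs_cat -/(compress _) -/(compress _).
by rewrite perm_cat2l; apply: perm_compress_star.
Qed.

Lemma row_norm_compress (R : numDomainType) a i :
  gm_row_norm (intr : int -> R) (compress a) i <= gm_row_norm intr a i.1.
Proof.
rewrite /gm_row_norm big_mkcond big_compress [leRHS]big_mkcond.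
apply: ler_sum => e _; have [ei|ei] := eqVneq (trow e) i.1; last first.
  rewrite big1 // => q _; rewrite big1 // => q' _; case: ifP => // /eqP E.
  by case/eqP: ei; rewrite -E.
have [q2 /eqP q2E|noq] := pickP (fun q : F => val i.2 == (p (telt e) * val q)%g).
  rewrite (bigD1 q2) //= [X in _ + X]big1 ?addr0 => [|q q2q].
    rewrite (big_pred1 i.2) => [|q']; last by rewrite /= -q2E -val_eqE.
    by rewrite {1}/tcoef /=; case: ifP.
  rewrite big1 // => q' /eqP q'E; case: ifP => // /eqP E.
  case/eqP: q2q; apply: val_inj; apply: (@mulgI _ (p (telt e))).
  by rewrite -[LHS]q'E -[RHS]q2E -E.
rewrite big1 // => q _; rewrite big1 // => q' /eqP q'E; case: ifP => // /eqP E.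
by have /eqP := noq q; case; rewrite -[RHS]q'E -E.
Qed.

Lemma cut_pow_good a q n :
  (forall m e, (m <= n)%N -> e \in gm_pow a m -> (p (telt e) * val q)%g \in F) ->
  cut_pow a q n = gm_pow a n.
Proof.
elim: n => //= n IHn good; rewrite IHn => [|m e mn]; last by apply: good; rewrite leqW.
by rewrite (@eq_in_filter _ _ predT) ?filter_predT // => e /(good n.+1 e (leqnn _)) ->.
Qed.

Definition gm_norm1 a : nat := \sum_(e <- a) `|tcoef e|%N.

Lemma cut_pow_le a q n (Psi : gterm int J G -> nat) :
  (\sum_(e <- cut_pow a q n) Psi e <= \sum_(e <- gm_pow a n) Psi e)%N.
Proof.
elim: n Psi => //= n IHn Psi; rewrite big_filter.
apply: (@leq_trans (\sum_(x <- gm_mul a (cut_pow a q n)) Psi x)).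
  by rewrite big_mkcond; apply: leq_sum => x _; case: ifP.
rewrite !big_gm_mul; apply: leq_sum => e _.
by rewrite big_mkcond [X in (_ <= X)%N]big_mkcond; apply: IHn.
Qed.

Lemma gm_tr_le1 a : (`|gm_tr a| <= gm_norm1 a)%N.
Proof.
rewrite -lez_nat abszE (big_morph Posz PoszD (erefl _)).
apply: le_trans (ler_norm_sum _ _ _) _; rewrite big_mkcond.
by apply: ler_sum => e _; case: ifP; rewrite ?abszE.
Qed.

Lemma cut_pow_tr_le a q n : (`|gm_tr (cut_pow a q n)| <= gm_norm1 (gm_pow a n))%N.
Proof. exact: leq_trans (gm_tr_le1 _) (cut_pow_le a q n (fun e => `|tcoef e|%N)). Qed.

End Compression.

(** Compression to a large set [F] of cosets multiplies traces by about [#|F|]: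
    a closed walk starting in [F] is lost only if it leaves [F], which is rare
    by the choice of [F]. As the right-hand side of the bound is proportional
    to the number of rows, it passes from the kernel to the extension. *)
Theorem folner_extension (R : realType) (G Q : groupType) (p : ghom G Q) :
  epimorphism p -> folner Q ->
  (forall (H : groupType) (i : ghom H G), injective i ->
     (forall x, p (i x) = 1%g) -> det_bound R H) ->
  det_bound R G.
Proof.
move=> epi_p folQ dK J V k M N k1 Vk.
have [s sK] : {s : Q -> G | forall q, p (s q) = q}.
  by exists (fun q => proj1_sig (cid (epi_p q))) => q; case: cid.
have [|||K KP] := @prop_subgroup G (fun x => p x = 1%g).
- exact: gmulf1.
- by move=> x y px py; rewrite gmulfM px py mulg1.
- by move=> x px; rewrite gmulfV px invg1.
have dKK : det_bound R (subgroup_type K).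
  by apply: (dK _ (sub_incl K)) => [|x]; [exact: val_inj | exact/KP/valP].
set r := log_poly _ _ _; set U := gm_herm V; set c := (X in _ <= X).
(* [E] bounds the total error caused by one of the remaining cosets. *)
pose E : R := \sum_(n < size r) `|r`_n| * (2 * (gm_norm1 (gm_pow U n))%:R).
have E0 : 0 <= E by apply: sumr_ge0 => n _; rewrite mulr_ge0 // mulr_ge0.
suff TE m : gm_trp U r <= c + E / m.+1%:R.
  apply/ler_addgt0Pr => e e0; have [m Em] : exists m, E / m.+1%:R <= e.
    exists (Num.truncn (E / e)); rewrite ler_pdivrMr // mulrC -ler_pdivrMr //.
    by apply/ltW/truncnS_gt.
  by apply: le_trans (TE m) _; rewrite lerD2l.
(* A coset that all of [T] keeps inside [F] contributes the exact moments. *)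
pose T := [seq p (telt x) | x <- flatten [seq gm_pow U n | n <- iota 0 (size r)]].
have [F [F0 FT]] := folQ T m.+1; set bad := [pred q | _] in FT.
have := dKK (J * F)%type (compress p s K F V) k M N k1.
have rowF i : gm_row_norm (intr : int -> R) (gm_herm (compress p s K F V)) i <= k.
  rewrite /gm_row_norm (perm_big _ (perm_compress_herm sK KP F V)) /=.
  by apply: le_trans (Vk i.1); apply: row_norm_compress.
move=> /(_ rowF); rewrite -/r.
have -> : gm_trp (gm_herm (compress p s K F V)) r =
    \sum_(q : F) \sum_(n < size r) r`_n * (gm_tr (cut_pow p U q n))%:~R.
  rewrite exchange_big /=; apply: eq_bigr => n _.
  rewrite (perm_gm_tr (perm_gm_pow n (perm_compress_herm sK KP F V))).
  by rewrite (gm_tr_compress sK KP) rmorph_sum mulr_sumr.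
rewrite card_prod natrM mulrAC -/c => bound.
have F0' : 0 < (#|{: F}|)%:R :> R by rewrite ltr0n.
have TX (q : F) : gm_trp U r <= \sum_(n < size r) r`_n * (gm_tr (cut_pow p U q n))%:~R
                       + (if q \in bad then E else 0).
  case: ifPn => [_|/hasPn good]; last first.
    rewrite addr0 le_eqVlt; apply/orP; left; apply/eqP/eq_bigr => n _.
    rewrite cut_pow_good // => n' e n'n en'; rewrite -[_ \in _]negbK; apply: good.
    apply/map_f/flattenP; exists (gm_pow U n') => //; apply/map_f.
    by rewrite mem_iota /= add0n (leq_ltn_trans n'n).
  rewrite -big_split /=; apply: ler_sum => n _; rewrite addrC -lerBlDr -mulrBr.
  apply: le_trans (ler_norm _) _; rewrite normrM ler_wpM2l //.
  apply: le_trans (ler_normB _ _) _; rewrite mulr2n mulrDl mul1r.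
  by apply: lerD; rewrite -intr_norm -abszE -pmulrn ler_nat (gm_tr_le1, cut_pow_tr_le).
rewrite -(ler_pM2r F0'); apply: le_trans (_ : c * #|{: F}|%:R + #|bad|%:R * E <= _).
  have := ler_sum (index_enum _) (fun (q : F) (_ : xpredT q) => TX q).
  rewrite big_split /= sumr_const -big_mkcond sumr_const -[in leLHS]mulr_natr.
  by rewrite mulr_natl => /le_trans; apply; rewrite lerD2r.
rewrite mulrDl lerD2l mulrAC -mulrA mulrC ler_wpM2l // ler_pdivlMr //.
by rewrite mulrC -natrM ler_nat.
Qed.

Lemma finite_folner (Q : groupType) : finite_group Q -> folner Q.
Proof.
move=> finQ S m; have inF (x : Q) : x \in fset_set [set: Q]%classic.
  by rewrite in_fset_set // inE.
exists (fset_set [set: Q]%classic); split.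
  by apply/card_gt0P; exists [` inF 1%g]%fset.
rewrite eq_card0 ?muln0 // => q; rewrite !inE; apply/hasPn => h _.
by rewrite inF.
Qed.

(** In an infinite cyclic group, a long interval of powers of the generator is
    moved by bounded translations only near its two ends. *)
Lemma cyclic_folner (Q : groupType) : cyclic_group Q -> folner Q.
Proof.
move=> [x genx]; have [[n xn1]|/forallNP inf] := pselect (exists n, (x ^+ n.+1)%g = 1%g).
  apply: finite_folner.
  apply: (@sub_finite_set _ _ [set (x ^+ k)%g | k in `I_n.+1]%classic); last first.
    exact/finite_image/finite_II.
  have powx k : exists2 l, (l < n.+1)%N & (x ^+ l)%g = (x ^+ k)%g.
    exists (k %% n.+1)%N; first by rewrite ltn_mod.
    by rewrite [in RHS](divn_eq k n.+1) expgnDr mulnC expgnA xn1 expg1n mul1g.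
  move=> y _; have [k [->|->]] := genx y.
    by have [l ln <-] := powx k; exists l.
  have [l ln xl] := powx (n * k)%N; exists l => //=; rewrite xl.
  apply/esym/mulg1_eq; rewrite -expgnDr.
  by rewrite -mulSn expgnA xn1 expg1n.
have injx : injective (fun k => (x ^+ k)%g).
  suff H a b : ((x ^+ a)%g = (x ^+ (a + b))%g) -> b = 0%N.
    move=> a b xab; have [ab|/ltnW ba] := leqP a b.
      by have := H a (b - a)%N; rewrite subnKC // => /(_ xab); lia.
    by have := H b (a - b)%N; rewrite subnKC // => /(_ (esym xab)); lia.
  case: b => // b; rewrite expgnDr -[LHS]mulg1 => /mulgI/esym xb.
  by case: (inf b).
move=> S m; have [D SD] : exists D, forall h, h \in S ->
    exists2 z, (z <= D)%N & h = (x ^+ z)%g \/ h = (x ^- z)%g.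
  elim: S => [|h S [D SD]]; first by exists 0%N.
  have [z hz] := genx h; exists (maxn z D) => g; rewrite inE => /predU1P[->|/SD].
    by exists z => //; rewrite leq_maxl.
  by case=> w wD gw; exists w => //; rewrite leq_max wD orbT.
(* Only the first and the last [D] powers can leave the interval. *)
pose n := (m * (D + D) + D).+1; pose F : {fset Q} := [fset y in [seq (x ^+ k)%g | k <- iota 0 n]]%fset.
have inF k : ((x ^+ k)%g \in F) = (k < n)%N.
  rewrite in_fset -[LHS]/((x ^+ k)%g \in [seq (x ^+ l)%g | l <- iota 0 n]).
  apply/idP/idP => [/mapP[l]|kn]; last first.
    by apply/mapP; exists k; rewrite // mem_iota.
  by rewrite mem_iota /= add0n => ln /injx->.
have cF : #|{: F}| = n.
  by rewrite -cardfE card_fseq undup_id ?size_map ?size_iota // map_inj_uniq // iota_uniq.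
exists F; split; first by rewrite cF.
set bad := [pred q | _]; rewrite cF; apply: (@leq_trans (m * (D + D))%N); last by rewrite /n; lia.
rewrite leq_mul2l; apply/orP; right.
pose ends := [seq (x ^+ k)%g | k <- iota 0 D ++ iota (n - D) D].
have -> : (D + D = size ends)%N by rewrite size_map size_cat !size_iota.
rewrite cardE -(size_map val); apply: uniq_leq_size.
  by rewrite map_inj_uniq ?enum_uniq //; apply: val_inj.
move=> _ /mapP[q + ->]; rewrite mem_enum inE /= => /hasP[h /SD[z zD hz] hq].
have := valP q; rewrite {1}in_fset.
rewrite -[X in is_true X]/(val q \in [seq (x ^+ l)%g | l <- iota 0 n]) => /mapP[k].
rewrite mem_iota /= add0n => kn qk.
rewrite /= in qk *; rewrite qk; apply/map_f; rewrite mem_cat !mem_iota add0n.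
move: hq; rewrite [fsval q]qk; case: hz => ->.
  by rewrite -expgnDr inF /n in kn *; lia.
have [zk|kz] := leqP z k; last by move=> _; rewrite (leq_trans kz zD).
rewrite -{1}(subnKC zk) expgnDr mulKg inF; move: kn; rewrite /n; lia.
Qed.

(** A matrix has finitely many entries, hence is defined over one of the
    subgroups. *)
Lemma det_bound_exhaustion (R : realType) (G : groupType) :
  (forall s : seq G, exists K : groupClosed G,
     det_bound R (subgroup_type K) /\ {subset s <= K}) ->
  det_bound R G.
Proof.
move=> exG; apply: locally_det_boundP => J V d.
have [K [dK VK]] := exG [seq telt e | e <- V].
exists (subgroup_type K); split=> //.
pose W : gmx int J (subgroup_type K) :=
  [seq (e.1, insubd (1%g : subgroup_type K) (telt e)) | e <- V].
have WV : gm_map (sub_incl K) W = V.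
  rewrite /gm_map -map_comp -[RHS]map_id; apply/eq_in_map => e eV.
  rewrite /= /telt /= /sub_incl insubdK; first by case: e {eV}.
  by apply: VK; apply/map_f.
exists W; have [s sW] := herm_moments_map R W d.
have := sW _ _ idfun (sub_incl K); rewrite gm_map_id WV; apply=> g _.
split=> [g1|g1]; last by apply: val_inj; rewrite [LHS]g1.
by transitivity (sub_incl K 1%g); [congr (sub_incl K _) | exact: gmulf1].
Qed.

(** The determinant bound passes from the kernel of a map onto [A] to its
    source. Stated for all groups that inject into the kernel, it composes along
    extensions and directed unions without identifying isomorphic kernels. *)
Definition amenable_det_bound (R : realType) (A : groupType) : Prop :=
  forall (G : groupType) (p : ghom G A), epimorphism p ->
    (forall (H : groupType) (i : ghom H G), injective i ->
       (forall x, p (i x) = 1%g) -> det_bound R H) ->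
    det_bound R G.

Lemma amenable_extension_det_bound (R : realType) (N A Q : groupType)
    (i : ghom N A) (q : ghom A Q) :
  group_extension i q -> amenable_det_bound R N -> amenable_det_bound R Q ->
  amenable_det_bound R A.
Proof.
move=> [inj_i epi_q exact_iq] dN dQ G p epi_p dG.
apply: (dQ G (q \o p)) => [y|H j inj_j qpj].
  by have [a <-] := epi_q y; have [x <-] := epi_p a; exists x.
have [|||K KP] := @prop_subgroup G (fun x => q (p x) = 1%g).
- by rewrite !gmulf1.
- by move=> x y px py; rewrite !gmulfM px py mulg1.
- by move=> x px; rewrite !gmulfV px invg1.
have jK x : j x \in K by apply/KP/qpj.
have [j' j'E] := corestrict jK.
apply: (@subgroup_det_bound _ _ _ j') => [x y /(congr1 val)|].
  by rewrite !j'E => /inj_j.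
have lift (x : subgroup_type K) : exists n, i n = p (val x).
  by apply/exact_iq/KP/valP.
pose l x := proj1_sig (cid (lift x)).
have lE x : i (l x) = p (val x) by rewrite /l; case: cid.
have lM : monoid.monoid_morphism l.
  by split=> [|x y]; apply: inj_i; rewrite ?gmulf1 ?gmulfM !lE ?gmulf1 ?gmulfM.
pose m := isUMagmaMorphism.Build (subgroup_type K) N l lM.
pose L : ghom (subgroup_type K) N := HB.pack l m.
apply: (dN _ L) => [n|H' i' inj_i' Li'].
  have [x xn] := epi_p (i n).
  have xK : x \in K by apply/KP; rewrite xn; apply/exact_iq; exists n.
  by exists (Sub x xK); apply: inj_i; rewrite lE.
apply: (dG _ (sub_incl K \o i')) => [x y /val_inj/inj_i'//|x].
by rewrite /= -lE [l _]Li' gmulf1.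
Qed.

Lemma amenable_union_det_bound (R : realType) (A : groupType) (I : Type)
    (H : I -> groupClosed A) :
  directed_union H -> (forall i, amenable_det_bound R (subgroup_type (H i))) ->
  amenable_det_bound R A.
Proof.
move=> [dirH covH] dH G p epi_p dG; apply: det_bound_exhaustion => s.
have [i si] : exists i, forall x, x \in s -> p x \in H i.
  elim: s => [|x s [i si]]; first by have [i _] := covH 1%g; exists i.
  have [j xj] := covH (p x); have [k [ik jk]] := dirH i j; exists k => y.
  by rewrite inE => /predU1P[->|/si yi]; [exact: jk | exact: ik].
have [|||K KP] := @prop_subgroup G (fun x => p x \in H i).
- by rewrite gmulf1 gpred1.
- by move=> x y px py; rewrite gmulfM gpredM.
- by move=> x px; rewrite gmulfV gpredV.
exists K; split=> [|x xs]; last exact/KP/si.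
have pK (x : subgroup_type K) : (p \o sub_incl K) x \in H i by apply/KP/valP.
have [q qE] := corestrict pK.
apply: (dH i _ q) => [y|H' j inj_j qj].
  have [x xy] := epi_p (val y).
  have xK : x \in K by apply/KP; rewrite xy; apply: valP.
  by exists (Sub x xK); apply: val_inj; rewrite qE.
apply: (dG _ (sub_incl K \o j)) => [x y /val_inj/inj_j//|x].
by have /esym := qE (j x); rewrite qj.
Qed.

Lemma elementary_amenable_det_bound (R : realType) (A : groupType) :
  elementary_amenable A -> amenable_det_bound R A.
Proof.
apply; split=> [B /cyclic_folner folB|B /finite_folner folB||].
- by move=> G p epi_p; apply: folner_extension.
- by move=> G p epi_p; apply: folner_extension.
- exact: amenable_extension_det_bound.
- exact: amenable_union_det_bound.
Qed.

(** * The class of groups obtained from elementary amenable extensions *)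

(** For an extension by an elementary amenable group it suffices to know the
    bound for the kernel, the preimage of the trivial subgroup. *)
Theorem class_D_det_bound (R : realType) (G : groupType) :
  class_D G -> det_bound R G.
Proof.
apply=> [|]; last split=> [L A p _ /elementary_amenable_det_bound dA epi_p dK|||].
- have [K KP] := trivial_subgroup G; exists (subgroup_type K); apply: trivial_det_bound => x.
  by apply: val_inj; apply/KP/valP.
- have [E EP] := trivial_subgroup A.
  have dE : det_bound R (subgroup_type (gpreim p E)).
    apply: dK; apply: (@sub_finite_set _ _ [set 1%g]%classic) => // x.
    by rewrite /= => /EP.
  apply: (dA R L p epi_p) => H i inj_i pi.
  have iE x : i x \in gpreim p E by rewrite inE pi; apply/EP.
  have [j jE] := corestrict iE; apply: (@subgroup_det_bound _ _ _ j) dE => x y.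
  by move/(congr1 val); rewrite !jE => /inj_i.
- exact: subgroup_det_bound.
- by move=> disp I S f L u; apply: direct_limit_det_bound.
- by move=> disp I S f L u dirI _; apply: inverse_limit_det_bound.
Qed.

(** * Square-summable functions *)

Section UnorderedSums.
Variables (R : realType) (X : choiceType).
Local Notation C := R[i].
Local Notation normc := (@ComplexField.Normc.normc R).
Implicit Types (f h : X -> C).

(** Unconditional convergence. The error is measured by a real number because
    the order on the complex numbers is only partial. *)
Definition has_sum f (l : C) : Prop := forall e : R, 0 < e ->
  exists A : {fset X}, forall B : {fset X}, (A `<=` B)%fset ->
    normc (l - \sum_(x <- B) f x) <= e.

Lemma normc_ge0 (z : C) : 0 <= normc z.
Proof. by case: z => a b; apply: sqrtr_ge0. Qed.

Lemma normcB (y z : C) : normc (y - z) = normc (z - y).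
Proof. by rewrite -normcN opprB. Qed.

Lemma has_sum_unique f l l' : has_sum f l -> has_sum f l' -> l = l'.
Proof.
move=> fl fl'; apply/eqP; rewrite -subr_eq0; apply/eqP/ComplexField.Normc.eq0_normc.
apply/eqP; rewrite eq_le normc_ge0 andbT; apply/ler_addgt0Pr => e e0.
have e2 : 0 < e / 2 by rewrite divr_gt0.
have [A fA] := fl _ e2; have [B fB] := fl' _ e2.
have := fA _ (fsubsetUl A B); have := fB _ (fsubsetUr A B).
set s := \sum_(x <- _) _; rewrite normcB => h1 h2.
rewrite add0r (splitr e) -(subrKA s l) addrC; apply: le_trans (le_normcD _ _) _.
exact: lerD.
Qed.

Lemma has_sumE f l : has_sum f l -> summability.sum (f : X -> C^o) = l.
Proof.
move=> fl; have FF := @summability.totally_filter X.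
apply: (@cvg_lim C^o); first exact: norm_hausdorff.
apply/(@cvgrPdist_le _ C^o) => e e0.
have [r r0 er] : exists2 r, 0 < r & e = r%:C%C.
  exists (complex.Re e); first by move: e0; rewrite ltcE => /andP[_].
  by rewrite RRe_real // gtr0_real.
have [A fA] := fl r r0; exists A => // B /= /fA.
by rewrite er /summability.partial_sum big_seq_fsetE -lecR.
Qed.

Lemma has_sumD f h l m :
  has_sum f l -> has_sum h m -> has_sum (fun x => f x + h x) (l + m).
Proof.
move=> fl hm e e0; have e2 : 0 < e / 2 by rewrite divr_gt0.
have [A fA] := fl _ e2; have [B hB] := hm _ e2.
exists (A `|` B)%fset => D; rewrite fsubUset => /andP[/fA lD /hB mD].
rewrite big_split opprD addrACA (splitr e); apply: le_trans (le_normcD _ _) _.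
exact: lerD.
Qed.

Lemma has_sumZ f c l : has_sum f l -> has_sum (fun x => c * f x) (c * l).
Proof.
move=> fl e e0; have c1 : 0 < normc c + 1 by rewrite ltr_wpDl ?normc_ge0.
have [A fA] := fl _ (divr_gt0 e0 c1); exists A => B /fA lB.
rewrite -mulr_sumr -mulrBr ComplexField.Normc.normcM.
apply: (@le_trans _ _ ((normc c + 1) * normc (l - \sum_(x <- B) f x))).
  by rewrite ler_wpM2r ?normc_ge0 // lerDl.
by rewrite -ler_pdivlMl // mulrC.
Qed.

Lemma has_sum_conj f l : has_sum f l -> has_sum (fun x => conjc (f x)) (conjc l).
Proof.
have conjN z : normc (conjc z) = normc z by case: z => a b; rewrite /= sqrrN.
move=> fl e /fl[A fA]; exists A => B /fA.
by rewrite -(rmorph_sum (@conjc R)) -(rmorphB (@conjc R)) conjN.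
Qed.

Lemma has_sum0 : has_sum (fun=> 0) 0.
Proof.
by move=> e /ltW e0; exists fset0 => B _; rewrite big1 // subr0 ComplexField.Normc.normc0.
Qed.

Lemma has_sum_reindex f l (s s' : X -> X) :
  cancel s s' -> cancel s' s -> has_sum f l -> has_sum (f \o s) l.
Proof.
move=> sK s'K fl e /fl[A fA]; exists [fset s' x | x in A]%fset => B AB.
have injs : injective s by apply: can_inj sK.
have -> : \sum_(x <- B) (f \o s) x = \sum_(y <- [fset s x | x in B]%fset) f y.
  by rewrite (perm_big _ (enum_imfset _ _)) /=; [rewrite big_map | move=> x y _ _ /injs].
apply: fA; apply/fsubsetP => y yA; apply/imfsetP; exists (s' y); last by rewrite s'K.
by apply: (fsubsetP AB); apply/imfsetP; exists y.
Qed.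

Lemma has_sum_nneg (f : X -> R) (c : R) :
  (forall x, 0 <= f x) -> (forall A : {fset X}, \sum_(x <- A) f x <= c) ->
  exists l : R, [/\ has_sum (fun x => (f x)%:C%C) l%:C%C, l <= c &
    forall A : {fset X}, \sum_(x <- A) f x <= l].
Proof.
move=> f0 fc; pose S := [set \sum_(x <- A) f x | A in [set: {fset X}]]%classic.
have hS : has_sup S.
  split; first by exists (\sum_(x <- fset0) f x), fset0.
  by exists c => _ [A _ <-].
have leS (A : {fset X}) : \sum_(x <- A) f x <= sup S.
  by apply: sup_upper_bound => //; exists A.
exists (sup S); split=> //; last by apply: sup_le_ub; [exact: hS.1 | move=> _ [A _ <-]].
move=> e e0; have [_ [A _ <-] Ar] := sup_adherent e0 hS.
exists A => B /= AB; rewrite -(rmorph_sum (real_complex R)) -(rmorphB (real_complex R)) /=.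
rewrite expr0n addr0 sqrtr_sqr ger0_norm ?subr_ge0 // lerBlDr addrC -lerBlDr.
apply: le_trans (ltW Ar) _; rewrite [leRHS](big_fsetID _ (mem A)) /=.
rewrite (_ : [fset x in B | x \in A]%fset = A) ?lerDl ?sumr_ge0 //.
apply/fsetP => x; rewrite !inE /=; case: (boolP (x \in A)) => xA; rewrite (andbT, andbF) //.
exact: (fsubsetP AB).
Qed.

End UnorderedSums.

Section SquareSummable.
Variables (R : realType) (G : groupType).
Local Notation C := R[i].
Local Notation normc := (@ComplexField.Normc.normc R).
Implicit Types (f h : G -> C) (z : C).

Definition sqmod z : R := complex.Re z ^+ 2 + complex.Im z ^+ 2.

Lemma sqmod_ge0 z : 0 <= sqmod z.
Proof. by rewrite addr_ge0 // sqr_ge0. Qed.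

Lemma sqmodE z : normc z ^+ 2 = sqmod z.
Proof. by case: z => a b; rewrite /sqmod /= sqr_sqrtr // addr_ge0 // sqr_ge0. Qed.

Lemma sqmod_conj z : (sqmod z)%:C%C = z * conjc z.
Proof.
by case: z => a b; apply/eqP; rewrite /sqmod /=; simpc; rewrite eq_complex /=;
   apply/andP; split; apply/eqP; ring.
Qed.

Lemma sqmodM y z : sqmod (y * z) = sqmod y * sqmod z.
Proof. by rewrite -!sqmodE ComplexField.Normc.normcM exprMn. Qed.

Lemma sqmodN z : sqmod (- z) = sqmod z.
Proof. by case: z => a b; rewrite /sqmod /= !sqrrN. Qed.

Lemma sqmod_parallelogram y z :
  sqmod (y + z) + sqmod (y - z) = 2 * sqmod y + 2 * sqmod z.
Proof. by case: y z => [a b] [c e]; rewrite /sqmod /=; ring. Qed.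

Lemma sqmodD_le y z : sqmod (y + z) <= 2 * sqmod y + 2 * sqmod z.
Proof. by rewrite -sqmod_parallelogram lerDl sqmod_ge0. Qed.

Lemma sqmod_eq0 z : (sqmod z == 0) = (z == 0).
Proof.
case: z => a b; rewrite /sqmod /= paddr_eq0 ?sqr_ge0 // !sqrf_eq0.
by rewrite eq_complex.
Qed.

Lemma sqmod_polarization y z : y * conjc z =
  4^-1 * ((sqmod (y + z))%:C%C - (sqmod (y - z))%:C%C
  + 'i%C * ((sqmod (y + 'i%C * z))%:C%C - (sqmod (y - 'i%C * z))%:C%C)).
Proof.
apply: (@mulfI _ 4); first by rewrite pnatr_eq0.
pose cj : {rmorphism C -> C} := @conjc R; rewrite -![conjc _]/(cj _).
have ci : cj 'i%C = - 'i%C by apply/eqP; rewrite eq_complex /= oppr0 !eqxx.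
rewrite mulVKf ?pnatr_eq0 // !sqmod_conj -![conjc _]/(cj _).
rewrite !(rmorphB cj, rmorphD cj, rmorphM cj) ci.
have ii : ('i%C : C) * 'i%C = -1 by rewrite -expr2 sqr_i.
transitivity (2 * (y * cj z) + 2 * (cj y * z) +
  ('i%C * 'i%C) * (2 * (cj y * z) - 2 * (y * cj z))).
  by rewrite ii; ring.
by ring.
Qed.

Lemma l2P f : l2 f <->
  exists c : R, forall A : {fset G}, \sum_(g <- A) sqmod (f g) <= c.
Proof.
rewrite /l2 /=; split=> [fin|[c fc]].
  exists (fine (\esum_(g in [set: G]) (normc (f g) ^+ 2)%:E)%E) => A.
  rewrite -lee_fin fineK; last first.
    rewrite ge0_fin_numE //; apply: esum_ge0 => g _.
    by rewrite lee_fin sqr_ge0.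
  apply: esum_ge; exists [set` A]%classic; first by split=> //; exact: finite_fset.
  rewrite -fsbig_seq ?fset_uniq // sumEFin lee_fin.
  by apply: ler_sum => g _; rewrite sqmodE.
apply: (@le_lt_trans _ _ c%:E); last exact: ltry.
apply: ub_ereal_sup => _ [F [finF _] <-].
rewrite fsbig_finite //= sumEFin lee_fin; apply: le_trans (fc (fset_set F)).
by apply: ler_sum => g _; rewrite sqmodE.
Qed.

Lemma l2D f h : l2 f -> l2 h -> l2 (fun g => f g + h g).
Proof.
move=> /l2P[a fa] /l2P[b hb]; apply/l2P; exists (2 * a + 2 * b) => A.
apply: (@le_trans _ _ (\sum_(g <- A) (2 * sqmod (f g) + 2 * sqmod (h g)))).
  by apply: ler_sum => g _; apply: sqmodD_le.
by rewrite big_split -!mulr_sumr; apply: lerD; rewrite ler_wpM2l.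
Qed.

Lemma l2Z f c : l2 f -> l2 (fun g => c * f g).
Proof.
move=> /l2P[a fa]; apply/l2P; exists (sqmod c * a) => A.
under eq_bigr do rewrite sqmodM.
by rewrite -mulr_sumr ler_wpM2l ?sqmod_ge0.
Qed.

Lemma l2_finsupp f (A : {fset G}) : (forall g, g \notin A -> f g = 0) -> l2 f.
Proof.
move=> fA; apply/l2P; exists (\sum_(g <- A) sqmod (f g)) => B.
rewrite (bigID (mem A)) /= addrC big1 ?add0r => [|g /fA->]; last first.
  by apply/eqP; rewrite sqmod_eq0.
rewrite -big_filter [leRHS](bigID (mem B)) /= -[X in _ <= X + _]big_filter.
have -> : \sum_(g <- [seq g <- B | g \in A]) sqmod (f g) =
          \sum_(g <- [seq g <- A | g \in B]) sqmod (f g).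
  apply/perm_big/uniq_perm; rewrite ?filter_uniq ?fset_uniq // => g.
  by rewrite !mem_filter andbC.
by rewrite lerDl sumr_ge0 // => g _; apply: sqmod_ge0.
Qed.

Lemma has_sum_sqmod f : l2 f -> exists l : R,
  has_sum (fun g => (sqmod (f g))%:C%C) l%:C%C /\
  forall A : {fset G}, \sum_(g <- A) sqmod (f g) <= l.
Proof.
move=> /l2P[c fc].
by have [l [fl _ lA]] := has_sum_nneg (fun g => sqmod_ge0 (f g)) fc; exists l.
Qed.

(** Polarization reduces the convergence of the inner product to the
    nonnegative case. *)
Lemma has_sum_inner f h : l2 f -> l2 h ->
  has_sum (fun g => f g * conjc (h g)) (l2_inner f h).
Proof.
move=> lf lh; suff [l fl] : exists l, has_sum (fun g => f g * conjc (h g)) l.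
  by rewrite /l2_inner (has_sumE fl).
have lc c : l2 (fun g => f g + c * h g) by apply: l2D => //; apply: l2Z.
have [a [fa _]] := has_sum_sqmod (lc 1); have [b [fb _]] := has_sum_sqmod (lc (-1)).
have [c [fc _]] := has_sum_sqmod (lc 'i%C); have [e [fe _]] := has_sum_sqmod (lc (- 'i%C)).
have := has_sumD (has_sumD fa (has_sumZ (-1) fb)) (has_sumZ 'i%C (has_sumD fc (has_sumZ (-1) fe))).
move=> /(has_sumZ 4^-1) s; eexists; move: s.
congr has_sum; apply/funext => g; rewrite sqmod_polarization.
by rewrite !mul1r !mulN1r mulNr.
Qed.

End SquareSummable.

(** * The Hilbert space and the convolution operators *)

Section HilbertSpace.
Variables (R : realType) (G : groupType) (J : finType).
Local Notation C := R[i].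
Local Notation V := (J -> G -> C).
Local Notation delta := (@gm_delta C J G).
Implicit Types (x y z : V) (a b : gmx C J G).

Definition vl2 x : Prop := forall j, l2 (x j).
Definition vin x y : C := \sum_j l2_inner (x j) (y j).
Definition nsq x : R := complex.Re (vin x x).
Definition vlin (c : C) x y : V := fun j g => c * x j g + y j g.

Lemma has_sum_vin x y : vl2 x -> vl2 y ->
  has_sum (fun g => \sum_j x j g * conjc (y j g)) (vin x y).
Proof.
move=> lx ly; rewrite /vin; elim: (index_enum J) => [|j s IHs].
  by rewrite big_nil; under eq_fun do rewrite big_nil; apply: has_sum0.
rewrite big_cons; under eq_fun do rewrite big_cons.
exact: has_sumD (has_sum_inner (lx j) (ly j)) IHs.
Qed.

Lemma vl2_lin c x y : vl2 x -> vl2 y -> vl2 (vlin c x y).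
Proof. by move=> lx ly j; apply: l2D => //; apply: l2Z. Qed.

Lemma vin_conj x y : vl2 x -> vl2 y -> vin y x = conjc (vin x y).
Proof.
move=> lx ly; apply: has_sum_unique (has_sum_vin ly lx) _.
have := has_sum_conj (has_sum_vin lx ly); congr has_sum; apply/funext => g.
rewrite (rmorph_sum (@conjc R)); apply: eq_bigr => j _.
by rewrite (rmorphM (@conjc R)) mulrC /= conjcK.
Qed.

Lemma vinL c x y z : vl2 x -> vl2 y -> vl2 z ->
  vin (vlin c x y) z = c * vin x z + vin y z.
Proof.
move=> lx ly lz; apply: has_sum_unique (has_sum_vin (vl2_lin c lx ly) lz) _.
have := has_sumD (has_sumZ c (has_sum_vin lx lz)) (has_sum_vin ly lz).
congr has_sum; apply/funext => g; rewrite mulr_sumr -big_split /=.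
by apply: eq_bigr => j _; rewrite /vlin mulrDl mulrA.
Qed.

Lemma vinR c x y z : vl2 x -> vl2 y -> vl2 z ->
  vin z (vlin c x y) = conjc c * vin z x + vin z y.
Proof.
move=> lx ly lz; rewrite vin_conj //; last exact: vl2_lin.
rewrite vinL // (rmorphD (@conjc R)) (rmorphM (@conjc R)) /=.
by rewrite -(vin_conj lx lz) -(vin_conj ly lz).
Qed.

Lemma nsqE x : vl2 x -> vin x x = (nsq x)%:C%C.
Proof.
move=> lx; rewrite /nsq; have := vin_conj lx lx; case: (vin x x) => u v /=.
move=> /eqP; rewrite eq_complex /= eqxx /= -addr_eq0 => /eqP vv.
by apply/eqP; rewrite eq_complex /= eqxx /=; apply/eqP; lra.
Qed.

Lemma nsq_le x (A : {fset G}) : vl2 x ->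
  \sum_j \sum_(g <- A) sqmod (x j g) <= nsq x.
Proof.
move=> lx; have [||l [ls _ lA]] := @has_sum_nneg R G
    (fun g => \sum_j sqmod (x j g)) (\sum_j proj1_sig (cid ((l2P (x j)).1 (lx j)))).
- by move=> g; apply: sumr_ge0 => j _; apply: sqmod_ge0.
- move=> B; rewrite exchange_big; apply: ler_sum => j _.
  by case: cid => c /= cB; apply: cB.
have -> : nsq x = l.
  apply: (@complexI R); rewrite -nsqE //; apply: has_sum_unique (has_sum_vin lx lx) _.
  move: ls; congr has_sum; apply/funext => g; rewrite (rmorph_sum (real_complex R)).
  by apply: eq_bigr => j _; rewrite /= sqmod_conj.
by rewrite exchange_big.
Qed.

Lemma nsq_ge0 x : vl2 x -> 0 <= nsq x.
Proof.
by move=> /(nsq_le fset0); rewrite big1 // => j _; rewrite big_seq_fset0.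
Qed.

Lemma nsq_ge_coord x j g : vl2 x -> sqmod (x j g) <= nsq x.
Proof.
move=> lx; apply: le_trans (nsq_le [fset g]%fset lx).
rewrite (bigD1 j) //= big_seq_fset1 lerDl; apply: sumr_ge0 => k _.
by rewrite big_seq_fset1 sqmod_ge0.
Qed.

Lemma nsq_eq0 x : vl2 x -> nsq x <= 0 -> x = fun _ _ => 0.
Proof.
move=> lx x0; apply/funext => j; apply/funext => g; apply/eqP.
rewrite -(@sqmod_eq0 R) eq_le sqmod_ge0 andbT.
exact: le_trans (nsq_ge_coord j g lx) x0.
Qed.

Lemma nsq_bound x (c : R) :
  (forall A : {fset G}, \sum_j \sum_(g <- A) sqmod (x j g) <= c) ->
  vl2 x /\ nsq x <= c.
Proof.
move=> xc; have lx : vl2 x.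
  move=> j; apply/l2P; exists c => A; apply: le_trans (xc A).
  rewrite [leRHS](bigD1 j) //= lerDl; apply: sumr_ge0 => k _.
  by apply: sumr_ge0 => g _; apply: sqmod_ge0.
split=> //; have [||l [ls lc _]] := @has_sum_nneg R G
    (fun g => \sum_j sqmod (x j g)) c.
- by move=> g; apply: sumr_ge0 => j _; apply: sqmod_ge0.
- by move=> B; rewrite exchange_big.
apply: le_trans lc; rewrite le_eqVlt; apply/orP; left; apply/eqP.
apply: (@complexI R); rewrite -nsqE //; apply: has_sum_unique (has_sum_vin lx lx) _.
move: ls; congr has_sum; apply/funext => g; rewrite (rmorph_sum (real_complex R)).
by apply: eq_bigr => j _; rewrite /= sqmod_conj.
Qed.

Lemma nsq_lin c x y : vl2 x -> vl2 y ->
  nsq (vlin c x y) = sqmod c * nsq x + 2 * complex.Re (c * vin x y) + nsq y.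
Proof.
move=> lx ly; have lz := vl2_lin c lx ly; rewrite {1}/nsq vinL // !vinR //.
rewrite (vin_conj lx ly) !nsqE //; case: c {lz} => p q; case: (vin x y) => u v.
by rewrite /sqmod /=; simpc; rewrite /=; ring.
Qed.

Lemma nsqD_le x y : vl2 x -> vl2 y -> nsq (vlin 1 x y) <= 2 * nsq x + 2 * nsq y.
Proof.
move=> lx ly; have [|_] := @nsq_bound (vlin 1 x y) (2 * nsq x + 2 * nsq y); last by [].
move=> A; apply: (@le_trans _ _ (2 * (\sum_j \sum_(g <- A) sqmod (x j g)) +
    2 * (\sum_j \sum_(g <- A) sqmod (y j g)))); last first.
  by apply: lerD; rewrite ler_wpM2l // nsq_le.
rewrite !mulr_sumr -big_split; apply: ler_sum => j _.
rewrite !mulr_sumr -big_split; apply: ler_sum => g _.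
by rewrite /vlin mul1r; apply: sqmodD_le.
Qed.

Lemma vinP0 x y : vl2 x -> vl2 y -> nsq x <= 0 -> vin x y = 0.
Proof.
move=> lx ly /(nsq_eq0 lx) ->; rewrite /vin big1 // => j _.
apply: has_sumE; have := @has_sum0 R G; congr has_sum.
by apply/funext => g; rewrite mul0r.
Qed.

Lemma cauchy_schwarz x y : vl2 x -> vl2 y -> sqmod (vin x y) <= nsq x * nsq y.
Proof.
move=> lx ly; have [x0|x0] := leP (nsq x) 0.
  by rewrite vinP0 // /sqmod /= expr0n addr0 mulr_ge0 ?nsq_ge0.
set w := vin x y; pose c : C := - (conjc w / (nsq x)%:C%C).
have := nsq_ge0 (vl2_lin c lx ly); rewrite nsq_lin // -/w.
have -> : complex.Re (c * w) = - (sqmod w / nsq x).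
  rewrite /c mulNr mulrAC (mulrC _ w) -sqmod_conj -fmorphV -rmorphM -rmorphN.
  by [].
have -> : sqmod c = sqmod w / nsq x ^+ 2.
  rewrite /c sqmodN sqmodM -fmorphV /=; congr (_ * _).
    by case: (w) => u v; rewrite /sqmod /= sqrrN.
  by rewrite /sqmod /= expr0n addr0 exprVn.
have -> : sqmod w / nsq x ^+ 2 * nsq x = sqmod w / nsq x.
  by rewrite expr2 invfM mulrA mulfVK // gt_eqF.
rewrite mulrN => h; rewrite -ler_pdivrMl // mulrC; lra.
Qed.

Lemma vl2_delta j : vl2 (delta j).
Proof.
move=> i; apply: (@l2_finsupp _ _ _ [fset 1%g]%fset) => g.
by rewrite inE /gm_delta => /negPf->; rewrite andbF.
Qed.

Lemma vin_delta x j : vl2 x -> vin x (delta j) = x j 1%g.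
Proof.
move=> lx; apply: has_sum_unique (has_sum_vin lx (vl2_delta j)) _.
move=> e /ltW e0; exists [fset 1%g]%fset => B /fsubsetP/(_ 1%g (fset11 _)) B1.
suff -> : \sum_(g <- B) \sum_i x i g * conjc (delta j i g) = x j 1%g.
  by rewrite subrr ComplexField.Normc.normc0.
have dE g : \sum_i x i g * conjc (delta j i g) = if g == 1%g then x j g else 0.
  rewrite (bigD1 j) //= big1 ?addr0 => [|i /negPf ij]; last first.
    by rewrite /gm_delta ij conjc0 mulr0.
  by rewrite /gm_delta eqxx; case: eqP => _; rewrite (conjc1, conjc0) (mulr1, mulr0).
under eq_bigr do rewrite dE.
rewrite (big_fsetD1 1%g) //= eqxx big_seq big1 ?addr0 // => g.
by rewrite in_fsetD1 => /andP[/negPf-> _].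
Qed.

End HilbertSpace.

(** A crude bound for the squared operator norm. It is computed from the
    coefficients alone, hence shared by all the images of a matrix over
    quotient groups. *)
Definition op_bound (R : realType) (J G : Type) (a : gmx R[i] J G) : R :=
  foldr (fun e c => 2 * sqmod (tcoef e) + 2 * c) 0 a.

Lemma op_bound_ge0 (R : realType) (J G : Type) (a : gmx R[i] J G) :
  0 <= op_bound a.
Proof. by elim: a => //= e a IHa; rewrite addr_ge0 ?mulr_ge0 ?sqmod_ge0. Qed.

Section Operators.
Variables (R : realType) (G : groupType) (J : finType).
Local Notation C := R[i].
Local Notation V := (J -> G -> C).
Implicit Types (x y z : V) (a b : gmx C J G) (e : gterm C J G).

Definition gm_adj a : gmx C J G := gm_star (@conjc R) a.

Definition term_act e x : V := fun i g =>
  if trow e == i then tcoef e * x (tcol e) ((telt e)^-1 * g)%g else 0.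

Lemma gm_act_cons e a x : gm_act (e :: a) x = vlin 1 (term_act e x) (gm_act a x).
Proof.
apply/funext => i; apply/funext => g; rewrite /gm_act big_cons /vlin /term_act mul1r.
by case: ifP; rewrite ?add0r.
Qed.

Lemma gm_act_nil x : gm_act [::] x = fun _ _ => 0.
Proof. by apply/funext => i; apply/funext => g; rewrite /gm_act big_nil. Qed.

Lemma gm_act_lin a c x y : gm_act a (vlin c x y) = vlin c (gm_act a x) (gm_act a y).
Proof.
apply/funext => i; apply/funext => g; rewrite /gm_act /vlin mulr_sumr -big_split.
by apply: eq_bigr => e _; rewrite mulrDr mulrCA.
Qed.

Lemma vl2_0 : vl2 (fun (_ : J) (_ : G) => 0 : C).
Proof. by move=> j; apply: (@l2_finsupp _ _ _ fset0). Qed.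

Lemma vin0l y : vin (fun (_ : J) (_ : G) => 0 : C) y = 0.
Proof.
rewrite /vin big1 // => j _; apply: has_sumE.
have := @has_sum0 R G; congr has_sum.
by apply/funext => g; rewrite mul0r.
Qed.

Lemma vin0r y : vin y (fun (_ : J) (_ : G) => 0 : C) = 0.
Proof.
rewrite /vin big1 // => j _; apply: has_sumE.
have := @has_sum0 R G; congr has_sum.
by apply/funext => g; rewrite rmorph0 mulr0.
Qed.

Lemma nsq_term_act e x : vl2 x ->
  vl2 (term_act e x) /\ nsq (term_act e x) <= sqmod (tcoef e) * nsq x.
Proof.
move=> lx; apply: nsq_bound => A; rewrite (bigD1 (trow e)) //= [X in _ + X]big1 ?addr0.
  under eq_bigr do rewrite /term_act eqxx sqmodM.
  rewrite -mulr_sumr ler_wpM2l ?sqmod_ge0 //.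
  have -> : \sum_(g <- A) sqmod (x (tcol e) ((telt e)^-1 * g)%g) =
    \sum_(g <- [fset ((telt e)^-1 * g)%g | g in A]%fset) sqmod (x (tcol e) g).
    rewrite [RHS](perm_big _ (enum_imfset _ _)) /= ?big_map //.
    by move=> g h _ _ /mulgI.
  set B := [fset _ | g in A]%fset; apply: le_trans (nsq_le B lx).
  rewrite [leRHS](bigD1 (tcol e)) //= lerDl.
  by apply: sumr_ge0 => j _; apply: sumr_ge0 => g _; apply: sqmod_ge0.
move=> j /negPf je; rewrite big1 // => g _.
by rewrite /term_act eq_sym je /sqmod /= expr0n addr0.
Qed.

Lemma vl2_act a x : vl2 x -> vl2 (gm_act a x).
Proof.
move=> lx; elim: a => [|e a IHa]; first by rewrite gm_act_nil; apply: vl2_0.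
by rewrite gm_act_cons; apply: vl2_lin => //; exact: (nsq_term_act e lx).1.
Qed.

Lemma nsq_act a x : vl2 x -> nsq (gm_act a x) <= op_bound a * nsq x.
Proof.
move=> lx; elim: a => [|e a IHa]; first by rewrite gm_act_nil /nsq vin0l mul0r.
have [le nle] := nsq_term_act e lx; rewrite gm_act_cons.
apply: le_trans (nsqD_le le (vl2_act a lx)) _.
rewrite -[op_bound (e :: a)]/(2 * sqmod (tcoef e) + 2 * op_bound a) [leRHS]mulrDl.
by rewrite -(mulrA 2) -(mulrA 2); apply: lerD; rewrite ler_wpM2l.
Qed.

Lemma vin_adj a x y : vl2 x -> vl2 y ->
  vin (gm_act a x) y = vin x (gm_act (gm_adj a) y).
Proof.
move=> lx ly; elim: a => [|e a IHa]; first by rewrite !gm_act_nil vin0l vin0r.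
pose e' : gterm C J G := (conjc (tcoef e), (tcol e, trow e), (telt e)^-1%g).
have -> : gm_adj (e :: a) = e' :: gm_adj a by [].
rewrite !gm_act_cons.
have [lex _] := nsq_term_act e lx; have [ley _] := nsq_term_act e' ly.
rewrite vinL ?vinR //; try exact: vl2_act.
rewrite conjc1 !mul1r IHa; congr (_ + _).
have S := has_sum_reindex (mulKg (telt e)) (mulVKg (telt e)) (has_sum_vin lex ly).
apply: has_sum_unique S _; have := has_sum_vin lx ley.
congr has_sum; apply/funext => g.
rewrite (bigD1 (tcol e)) //= [X in _ + X]big1 => [|j /negPf je]; last first.
  by rewrite /term_act /trow /= -/(tcol e) eq_sym je conjc0 mulr0.
rewrite [RHS](bigD1 (trow e)) //= [X in _ = _ + X]big1 => [|j /negPf je]; last first.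
  by rewrite /term_act eq_sym je mul0r.
rewrite !addr0 /term_act eqxx [trow e']/(tcol e) eqxx /= mulKg.
rewrite (rmorphM (@conjc R)) /= conjcK invgK; ring.
Qed.

End Operators.

(** * The dimension of a kernel as a limit of traces *)

Section TendsToZero.
Variable R : realType.
Implicit Types u v : nat -> R.

(** Convergence to 0 if [u] is nonnegative; in general the limes superior is at
    most 0, so that each half of a limit statement has this form. *)
Definition tends0 u : Prop :=
  forall e : R, 0 < e -> exists N, forall n, (N <= n)%N -> u n <= e.

Lemma tends0_le u v : (forall n, u n <= v n) -> tends0 v -> tends0 u.
Proof.
move=> uv v0 e /v0[N vN]; exists N => n /vN; exact: le_trans (uv n).
Qed.

Lemma tends0D u v : tends0 u -> tends0 v -> tends0 (fun n => u n + v n).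
Proof.
move=> u0 v0 e e0; have e2 : 0 < e / 2 by rewrite divr_gt0.
have [N uN] := u0 _ e2; have [M vM] := v0 _ e2; exists (maxn N M) => n.
by rewrite geq_max => /andP[/uN un /vM vn]; rewrite (splitr e) lerD.
Qed.

Lemma tends0Z u (c : R) : 0 <= c -> tends0 u -> tends0 (fun n => c * u n).
Proof.
move=> c0 u0 e e0; have c1 : 0 < c + 1 by rewrite ltr_wpDl.
have [N uN] := u0 _ (divr_gt0 e0 c1); exists N => n /uN un.
have [un0|un0] := leP 0 (u n); last first.
  by apply: le_trans (ltW e0); rewrite mulr_ge0_le0 // ltW.
apply: (@le_trans _ _ ((c + 1) * u n)); first by rewrite ler_wpM2r // lerDl.
by rewrite -ler_pdivlMl // mulrC.
Qed.

Lemma tends0_sum (I : Type) (s : seq I) (u : I -> nat -> R) :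
  (forall i, tends0 (u i)) -> tends0 (fun n => \sum_(i <- s) u i n).
Proof.
move=> u0; elim: s => [|i s IHs].
  by move=> e /ltW e0; exists 0%N => n _; rewrite big_nil.
apply: tends0_le (tends0D (u0 i) IHs) => n; by rewrite big_cons.
Qed.

Lemma tends0_sqr u : tends0 (fun n => u n ^+ 2) -> tends0 u.
Proof.
move=> u0 e e0; have [N uN] := u0 _ (exprn_gt0 2 e0); exists N => n /uN un.
apply: le_trans (ler_norm _) _; rewrite -(@ler_pXn2r _ 2) ?nnegrE ?(ltW e0) //.
by rewrite real_normK ?num_real.
Qed.

Lemma tends0_const (c : R) : tends0 (fun=> c) -> c <= 0.
Proof.
move=> c0; apply/ler_addgt0Pr => e e0; rewrite add0r.
by have [N cN] := c0 e e0; exact: (cN N).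
Qed.

Lemma tends0_shift u : tends0 u -> tends0 (fun n => u n.+1).
Proof. by move=> u0 e /u0[N uN]; exists N => n Nn; apply/uN/leqW. Qed.

Lemma cauchy_real u :
  (forall e : R, 0 < e -> exists N, forall n m, (N <= n)%N -> (N <= m)%N ->
     `|u n - u m| <= e) ->
  exists l, tends0 (fun n => `|u n - l|).
Proof.
move=> cu; have /cvg_ex[l ul] : cvg (u @ \oo)%classic.
  apply/cauchy_cvgP/cauchy_exP => e e0; have e2 : 0 < e / 2 by rewrite divr_gt0.
  have [N uN] := cu _ e2; exists (u N); exists N => // n /= Nn.
  rewrite /ball /=; apply: le_lt_trans (uN _ _ (leqnn N) Nn) _.
  by rewrite ltr_pdivrMr // ltr_pMr // ltr1n.
exists l => e e0; move/cvgrPdist_le : ul => /(_ e e0)[N _ lN]; exists N => n Nn.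
by rewrite distrC; apply: (lN n).
Qed.

Lemma cauchy_complex (u : nat -> R[i]) :
  (forall e : R, 0 < e -> exists N, forall n m, (N <= n)%N -> (N <= m)%N ->
     sqmod (u n - u m) <= e) ->
  exists l, tends0 (fun n => sqmod (u n - l)).
Proof.
move=> cu.
have sqle (a e : R) : 0 < e -> a ^+ 2 <= e ^+ 2 -> `|a| <= e.
  move=> e0 ae; rewrite -(@ler_pXn2r _ 2) ?nnegrE ?(ltW e0) //.
  by rewrite real_normK ?num_real.
have [e e0|x xP] := @cauchy_real (fun n => complex.Re (u n)).
  have [N uN] := cu _ (exprn_gt0 2 e0); exists N => n m Nn Nm; apply: sqle => //.
  apply: le_trans (uN n m Nn Nm); rewrite /sqmod; case: (u n) (u m) => a b [c d] /=.
  by rewrite lerDl sqr_ge0.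
have [e e0|y yP] := @cauchy_real (fun n => complex.Im (u n)).
  have [N uN] := cu _ (exprn_gt0 2 e0); exists N => n m Nn Nm; apply: sqle => //.
  apply: le_trans (uN n m Nn Nm); rewrite /sqmod; case: (u n) (u m) => a b [c d] /=.
  by rewrite lerDr sqr_ge0.
exists (Complex x y) => e e0; pose d := Num.min 1 (e / 2).
have d0 : 0 < d by rewrite lt_min ltr01 divr_gt0.
have [N xN] := xP d d0; have [M yM] := yP d d0; exists (maxn N M) => n.
rewrite geq_max => /andP[/xN un /yM vn].
have dd : d ^+ 2 <= e / 2.
  apply: (@le_trans _ _ d); last by rewrite ge_min lexx orbT.
  by rewrite expr2 ler_piMr ?(ltW d0) // ge_min lexx.
have sq (a : R) : `|a| <= d -> a ^+ 2 <= e / 2.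
  move=> ad; apply: le_trans dd; rewrite -[a ^+ 2]real_normK ?num_real //.
  by rewrite ler_pXn2r ?nnegrE ?(ltW d0).
rewrite (splitr e) /sqmod; case: (u n) un vn => a b /= /sq ax /sq bx.
exact: lerD.
Qed.

Lemma nonincreasing_cauchy u : (forall n, u n.+1 <= u n) -> (forall n, 0 <= u n) ->
  forall e : R, 0 < e -> exists N, forall n m, (N <= n)%N -> (N <= m)%N ->
    `|u n - u m| <= e.
Proof.
move=> du u0 e e0; have mono n m : (n <= m)%N -> u m <= u n.
  move=> /subnKC <-; elim: (m - n)%N => [|k IHk]; first by rewrite addn0.
  by rewrite addnS (le_trans (du _)).
have hI : has_inf (range u)%classic.
  by split; [exists (u 0%N), 0%N | exists 0 => _ [n _ <-]].
have [_ [N _ <-] uN] := inf_adherent e0 hI; exists N => n m Nn Nm.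
have lo k : inf (range u)%classic <= u k by apply: ge_inf; [exact: hI.2 | exists k].
have := mono _ _ Nn; have := mono _ _ Nm; have := lo n; have := lo m.
by rewrite ler_norml; lra.
Qed.

End TendsToZero.

Section Contraction.
Variables (R : realType) (G : groupType) (J : finType) (b : gmx R[i] J G) (K : R).
Local Notation C := R[i].
Local Notation V := (J -> G -> C).
Implicit Types x y z w : V.
Hypotheses (K0 : 0 < K) (abK : op_bound (gm_adj b) <= K).

(** The operator [1 - B^* B / K], a self-adjoint operator between 0 and 1
    fixing exactly the kernel of [B]; as a formal matrix, so that its traces can
    be compared over different groups. *)
Definition damping : gmx C J G :=
  gm_one ++ gm_scale (- K^-1)%:C%C (gm_mul (gm_adj b) b).

Local Notation T := (gm_act damping).

Lemma dampingE x : T x = vlin (- K^-1)%:C%C (gm_act (gm_adj b) (gm_act b x)) x.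
Proof.
rewrite /damping gm_act_cat gm_act_one gm_act_scale gm_act_mul.
by apply/funext => i; apply/funext => g; rewrite /vlin addrC.
Qed.

Lemma vin_quad x : vl2 x -> vin (gm_act (gm_adj b) (gm_act b x)) x =
  (nsq (gm_act b x))%:C%C.
Proof.
move=> lx; have lb := vl2_act b lx; have lab := vl2_act (gm_adj b) lb.
rewrite vin_conj // -vin_adj // nsqE // conjc_real //.
Qed.

Lemma vin_damping x : vl2 x ->
  vin (T x) x = (nsq x - K^-1 * nsq (gm_act b x))%:C%C.
Proof.
move=> lx; have lb := vl2_act b lx; have lab := vl2_act (gm_adj b) lb.
rewrite dampingE vinL // vin_quad // nsqE //.
by rewrite -(rmorphM (real_complex R)) -(rmorphD (real_complex R)) mulNr addrC.
Qed.

Lemma damping_sym x y : vl2 x -> vl2 y -> vin (T x) y = vin x (T y).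
Proof.
move=> lx ly; have lbx := vl2_act b lx; have lby := vl2_act b ly.
have labx := vl2_act (gm_adj b) lbx; have laby := vl2_act (gm_adj b) lby.
rewrite !dampingE vinL // vinR // conjc_real; congr (_ * _ + _).
by rewrite -vin_adj // [LHS]vin_conj // -vin_adj // -vin_conj.
Qed.

Lemma nsq_damping x : vl2 x -> nsq (T x) <= nsq x - K^-1 * nsq (gm_act b x).
Proof.
move=> lx; have lb := vl2_act b lx; have lab := vl2_act (gm_adj b) lb.
rewrite dampingE nsq_lin // vin_quad // -(rmorphM (real_complex R)) /=.
have h : nsq (gm_act (gm_adj b) (gm_act b x)) <= K * nsq (gm_act b x).
  by apply: le_trans (nsq_act _ lb) _; rewrite ler_wpM2r ?nsq_ge0.
have sK : sqmod (- K^-1)%:C%C = K^-1 * K^-1 by rewrite /sqmod /= expr0n addr0 sqrrN expr2.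
have : sqmod (- K^-1)%:C%C * nsq (gm_act (gm_adj b) (gm_act b x)) <=
       K^-1 * nsq (gm_act b x).
  by rewrite sK -mulrA ler_wpM2l ?invr_ge0 ?(ltW K0) // ler_pdivrMl.
rewrite mulNr; set u := sqmod _ * _; set v := K^-1 * _; move: (nsq x) u v.
by move=> t u v {h sK}; lra.
Qed.

Lemma vl2_iter n x : vl2 x -> vl2 (iter n T x).
Proof. by move=> lx; elim: n => //= n; apply: vl2_act. Qed.

Lemma iter_lin n c x y : iter n T (vlin c x y) = vlin c (iter n T x) (iter n T y).
Proof. by elim: n => //= n ->; apply: gm_act_lin. Qed.

Lemma iter_sym n x y : vl2 x -> vl2 y -> vin (iter n T x) y = vin x (iter n T y).
Proof.
move=> lx ly; elim: n y ly => // n IHn y ly.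
rewrite iterS damping_sym ?(IHn, iterSr) //; first exact: vl2_act.
exact: vl2_iter.
Qed.

Lemma vin_iter n m x : vl2 x -> vin (iter n T x) (iter m T x) = vin (iter (m + n) T x) x.
Proof. by move=> lx; rewrite -iter_sym -?iterD //; exact: vl2_iter. Qed.

Definition moment n x : R := complex.Re (vin (iter n T x) x).

Lemma moment_even n x : vl2 x -> moment (n + n) x = nsq (iter n T x).
Proof. by move=> lx; rewrite /moment /nsq vin_iter. Qed.

Lemma moment_odd n x : vl2 x -> moment (n + n).+1 x =
  nsq (iter n T x) - K^-1 * nsq (gm_act b (iter n T x)).
Proof.
move=> lx; have := vin_damping (vl2_iter n lx).
by rewrite -iterS vin_iter // addnS /moment => ->.
Qed.

Lemma half_split n : n = (n./2 + n./2)%N \/ n = (n./2 + n./2).+1.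
Proof. by have := odd_double_half n; rewrite -addnn; case: odd => /esym; [right | left]. Qed.

Lemma moment_nonincr n x : vl2 x -> moment n.+1 x <= moment n x.
Proof.
move=> lx; have [->|->] := half_split n; set m := n./2.
  rewrite moment_odd // moment_even // gerBl mulr_ge0 ?invr_ge0 ?(ltW K0) // nsq_ge0 //.
  exact/vl2_act/vl2_iter.
rewrite (_ : (m + m).+2 = (m.+1 + m.+1)%N); last by rewrite addSn addnS.
by rewrite moment_even // moment_odd // iterS nsq_damping //; apply: vl2_iter.
Qed.

Lemma moment_ge0 n x : vl2 x -> 0 <= moment n x.
Proof.
move=> lx; have [->|->] := half_split n; set m := n./2.
  by rewrite moment_even // nsq_ge0 //; apply: vl2_iter.
rewrite moment_odd //; apply: le_trans (nsq_damping (vl2_iter m lx)).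
by rewrite nsq_ge0 // -iterS; apply: vl2_iter.
Qed.

Lemma nsq_iter_diff n m x : vl2 x -> nsq (vlin (-1) (iter m T x) (iter n T x)) =
  moment (m + m) x - 2 * moment (n + m) x + moment (n + n) x.
Proof.
move=> lx; rewrite nsq_lin; try exact: vl2_iter.
rewrite vin_iter // !moment_even // /moment mulN1r.
have -> (z : C) : complex.Re (- z) = - complex.Re z by case: z.
have -> : sqmod (-1 : C) = 1 by rewrite /sqmod /= oppr0 expr0n addr0 sqrrN expr1n.
by rewrite mul1r mulrN.
Qed.

Lemma iter_fixed n z : vl2 z -> gm_act b z = (fun _ _ => 0) -> iter n T z = z.
Proof.
move=> lz bz; elim: n => //= n ->; rewrite dampingE bz.
have -> : gm_act (gm_adj b) (fun _ _ => 0) = fun _ _ => 0.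
  by apply/funext => i; apply/funext => g; rewrite /gm_act big1 // => e _; rewrite mulr0.
by apply/funext => i; apply/funext => g; rewrite /vlin mulr0 add0r.
Qed.

(** The powers of the damping operator converge strongly to the orthogonal
    projection onto the kernel. The moments are nonincreasing, so the powers
    applied to [x] form a Cauchy sequence; its limit is fixed by the operator,
    and differs from [x] by a limit of vectors orthogonal to the kernel. *)
Lemma damping_limit x : vl2 x -> exists y,
  [/\ vl2 y, gm_act b y = (fun _ _ => 0),
      tends0 (fun n => nsq (vlin (-1) y (iter n T x))) &
      forall z, vl2 z -> gm_act b z = (fun _ _ => 0) -> vin (vlin (-1) y x) z = 0].
Proof.
move=> lx.
have cauchy (e : R) : 0 < e -> exists N, forall n m, (N <= n)%N -> (N <= m)%N ->
    nsq (vlin (-1) (iter m T x) (iter n T x)) <= e.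
  move=> e0; have e2 : 0 < e / 2 by rewrite divr_gt0.
  have [N aN] := nonincreasing_cauchy (fun n => moment_nonincr n lx)
    (fun n => moment_ge0 n lx) e2.
  exists N => n m Nn Nm; rewrite nsq_iter_diff //.
  have := aN (m + m)%N (n + m)%N (leq_trans Nm (leq_addr _ _)) (leq_trans Nn (leq_addr _ _)).
  have := aN (n + n)%N (n + m)%N (leq_trans Nn (leq_addr _ _)) (leq_trans Nn (leq_addr _ _)).
  by rewrite !ler_norml; lra.
have lim j g : exists l, tends0 (fun n => sqmod (iter n T x j g - l)).
  apply: cauchy_complex => e /cauchy[N cN]; exists N => n m Nn Nm.
  apply: le_trans (cN n m Nn Nm).
  apply: le_trans (nsq_ge_coord j g (vl2_lin _ (vl2_iter m lx) (vl2_iter n lx))).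
  by rewrite /vlin mulN1r addrC.
pose y j g := proj1_sig (cid (lim j g)).
have yP j g : tends0 (fun n => sqmod (iter n T x j g - y j g)) by rewrite /y; case: cid.
(* The pointwise limit [y] is a limit in norm: a finite part of the distance
   to it is approximated by that of a late member of the Cauchy sequence. *)
have fatou (e : R) : 0 < e -> exists N, forall n, (N <= n)%N ->
    vl2 (vlin (-1) y (iter n T x)) /\ nsq (vlin (-1) y (iter n T x)) <= e.
  move=> e0; have e4 : 0 < e / 4 by rewrite divr_gt0.
  have [N cN] := cauchy _ e4; exists N => n Nn; apply: nsq_bound => A.
  have [M yM] : exists M, forall m, (M <= m)%N ->
      \sum_j \sum_(g <- A) sqmod (iter m T x j g - y j g) <= e / 4.
    apply: (@tends0_sum _ _ (index_enum J)
      (fun j m => \sum_(g <- A) sqmod (iter m T x j g - y j g)) _ _ e4) => j.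
    exact: (@tends0_sum _ _ A (fun g m => sqmod (iter m T x j g - y j g))).
  pose m := maxn M N; have := yM m (leq_maxl _ _).
  have := nsq_le A (vl2_lin (-1) (vl2_iter m lx) (vl2_iter n lx)).
  have := cN n m Nn (leq_maxr _ _).
  set s1 := nsq _; set s2 := \sum_j _; set s3 := \sum_j _; move=> h1 h2 h3.
  apply: (@le_trans _ _ (2 * s2 + 2 * s3)); last by lra.
  rewrite !mulr_sumr -big_split; apply: ler_sum => j _.
  rewrite !mulr_sumr -big_split; apply: ler_sum => g _.
  rewrite /vlin !mulN1r; apply: le_trans (sqmodD_le _ _).
  by rewrite le_eqVlt; apply/orP; left; apply/eqP; congr sqmod; ring.
have [N0 fN0] := fatou 1 ltr01; have lyx := (fN0 N0 (leqnn _)).1.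
have ly : vl2 y.
  have := vl2_lin (-1) lyx (vl2_iter N0 lx); congr vl2.
  by apply/funext => j; apply/funext => g; rewrite /vlin !mulN1r opprD opprK addrNK.
have lim0 : tends0 (fun n => nsq (vlin (-1) y (iter n T x))).
  by move=> e /fatou[N fN]; exists N => n /fN[].
exists y; split=> //.
(* The limit is fixed by the operator, which forces [b y = 0] since the quadratic
   form of the operator at [y] is [nsq y - K^-1 * nsq (b y)]. *)
- have lTy : vl2 (T y) by exact: vl2_act.
  have Ty : nsq (vlin (-1) y (T y)) <= 0.
    apply: tends0_const.
    apply: tends0_le (tends0D (tends0Z (ler0n R 2) (tends0_shift lim0))
                              (tends0Z (ler0n R 2) lim0)) => n.
    have ln := vl2_lin (-1) ly (vl2_iter n lx).
    have ln1 := vl2_lin (-1) ly (vl2_iter n.+1 lx).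
    have nN z : vl2 z -> nsq (vlin (-1) z (fun _ _ => 0)) = nsq z.
      move=> lz; rewrite nsq_lin ?vin0r //; last exact: vl2_0.
      rewrite mulr0 mulr0 /nsq vin0l !addr0.
      by rewrite /sqmod /= oppr0 expr0n addr0 sqrrN expr1n mul1r.
    have lT := vl2_act damping ln.
    have := nsqD_le (vl2_lin (-1) lT (@vl2_0 R G J)) ln1.
    rewrite nN // => h; apply: le_trans (le_trans _ h) _.
      rewrite le_eqVlt; apply/orP; left; apply/eqP; congr nsq.
      apply/funext => j; apply/funext => g.
      rewrite gm_act_lin /vlin /= mul1r !mulN1r; ring.
    rewrite addrC lerD2l ler_wpM2l //; apply: le_trans (nsq_damping ln) _.
    by rewrite gerBl mulr_ge0 ?invr_ge0 ?(ltW K0) ?nsq_ge0 //; apply: vl2_act.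
  have TyE : T y = y.
    have := nsq_eq0 (vl2_lin (-1) ly lTy) Ty => E.
    apply/funext => j; apply/funext => g; have := congr1 (fun f => f j g) E.
    by rewrite /vlin mulN1r addrC => /eqP; rewrite subr_eq0 => /eqP.
  apply: nsq_eq0; first exact: vl2_act.
  have := vin_damping ly; rewrite TyE nsqE // => /(@complexI R) h.
  have : K^-1 * nsq (gm_act b y) = 0 by lra.
  by move/eqP; rewrite mulf_eq0 invr_eq0 (gt_eqF K0) /= => /eqP->.
- move=> z lz bz; have ln n := vl2_lin (-1) ly (vl2_iter n lx).
  have E n : vin (vlin (-1) y x) z = vin (vlin (-1) y (iter n T x)) z.
    by rewrite (vinL _ ly lx lz) (vinL _ ly (vl2_iter n lx) lz) iter_sym // iter_fixed.
  apply/eqP; rewrite -(@sqmod_eq0 R) eq_le sqmod_ge0 andbT.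
  apply: tends0_const; apply: tends0_le (tends0Z (nsq_ge0 lz) lim0) => n.
  by rewrite (E n) mulrC; apply: cauchy_schwarz.
Qed.

End Contraction.

Section Dimension.
Variables (R : realType) (G : groupType) (J : finType).
Local Notation C := R[i].
Local Notation V := (J -> G -> C).
Local Notation delta := (@gm_delta C J G).
Implicit Types (b : gmx C J G) (x y z : V) (K : R) (L : V -> Prop).

Definition vker b : V -> Prop := fun x => vl2 x /\ gm_act b x = fun _ _ => 0.

Definition vproj L x : V := xget (fun _ _ => 0)
  [set y | L y /\ forall z, L z -> vin (fun i g => x i g - y i g) z = 0]%classic.

Definition vdim L : C := \sum_j vin (vproj L (delta j)) (delta j).

(** The von Neumann dimension of the kernel, as a real number. *)
Definition rdim b : R := complex.Re (vdim (vker b)).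

Definition damping_tr b K n : R := complex.Re (gm_tr (gm_pow (damping b K) n)).

(** The condition on [K] under which the damping operator of [b] lies between
    0 and 1. *)
Definition damps b K : Prop :=
  0 < K /\ op_bound (gm_adj b) <= K.

Lemma vproj_unique b x y : vl2 x -> vker b y ->
  (forall z, vker b z -> vin (vlin (-1) y x) z = 0) -> vproj (vker b) x = y.
Proof.
move=> lx ky yx.
have sub u : (fun i g => x i g - u i g) = vlin (-1) u x.
  by apply/funext => i; apply/funext => g; rewrite /vlin mulN1r addrC.
rewrite /vproj; case: xgetP => [u _ [ku ux]|/(_ y)]; last first.
  by case; split=> // z; rewrite sub; apply: yx.
have [ly by0] := ky; have [lu bu0] := ku.
have kd : vker b (vlin (-1) u y).
  split; first exact: vl2_lin.
  rewrite gm_act_lin bu0 by0; apply/funext => i; apply/funext => g.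
  by rewrite /vlin mulr0 addr0.
have d0 : vin (vlin (-1) u y) (vlin (-1) u y) = 0.
  have := ux _ kd; have := yx _ kd; rewrite sub.
  rewrite (vinL (-1) ly lx kd.1) (vinL (-1) lu lx kd.1) [vin (vlin _ _ _) _](vinL (-1) lu ly kd.1).
  rewrite !mulN1r => h1 h2; have -> : vin y (vlin (-1) u y) = vin x (vlin (-1) u y).
    by apply/eqP; rewrite eq_sym -subr_eq0 addrC h1.
  by rewrite h2.
have := nsq_eq0 kd.1; rewrite /nsq d0 => /(_ (lexx 0)) E.
apply/funext => i; apply/funext => g; have := congr1 (fun f => f i g) E.
by rewrite /vlin mulN1r addrC => /eqP; rewrite subr_eq0 => /eqP.
Qed.

Lemma vprojP b K x : damps b K -> vl2 x ->
  [/\ vker b (vproj (vker b) x),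
      forall z, vker b z -> vin (vlin (-1) (vproj (vker b) x) x) z = 0 &
      tends0 (fun n => nsq (vlin (-1) (vproj (vker b) x) (iter n (gm_act (damping b K)) x)))].
Proof.
move=> [K0 abK] lx; have [y [ly by0 ylim yx]] := damping_limit K0 abK lx.
have -> : vproj (vker b) x = y.
  by apply: vproj_unique => // z []; apply: yx.
by split=> // z []; apply: yx.
Qed.

Lemma damping_trE b K n : damping_tr b K n = \sum_j moment b K n (delta j).
Proof.
rewrite /damping_tr gm_trE (raddf_sum (@complex.Re R : Rcomplex R -> R)); apply: eq_bigr => j _.
rewrite gm_act_pow /moment vin_delta //; apply: vl2_iter; exact: vl2_delta.
Qed.

Lemma moment_proj b K n x : damps b K -> vl2 x ->
  moment b K n x = nsq (vproj (vker b) x) +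
                   moment b K n (vlin (-1) (vproj (vker b) x) x).
Proof.
move=> dK lx; have [ky yx _] := vprojP dK lx; have [K0 abK] := dK.
set y := vproj _ _ in ky yx *; have [ly by0] := ky; set w := vlin _ _ _ in yx *.
have lw : vl2 w by apply: vl2_lin.
have xE : x = vlin 1 w y.
  by apply/funext => i; apply/funext => g; rewrite /w /vlin mul1r mulN1r addrC addrA addrN add0r.
have ln := vl2_iter b K n lw.
have TxE : iter n (gm_act (damping b K)) x = vlin 1 (iter n (gm_act (damping b K)) w) y.
  by rewrite {1}xE iter_lin (@iter_fixed _ _ _ b K n y).
rewrite /moment TxE [X in vin _ X]xE.
rewrite (vinL 1 ln ly (vl2_lin 1 lw ly)) (vinR 1 lw ly ln) (vinR 1 lw ly ly).
have -> : vin (iter n (gm_act (damping b K)) w) y = 0.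
  by rewrite iter_sym // iter_fixed // yx.
have -> : vin y w = 0 by rewrite (vin_conj lw ly) yx // conjc0.
rewrite conjc1 !mul1r addr0 add0r /nsq.
by case: (vin _ _) => u1 u2; case: (vin _ _) => v1 v2 /=; rewrite addrC.
Qed.

Lemma vdimE b K : damps b K ->
  vdim (vker b) = (\sum_j nsq (vproj (vker b) (delta j)))%:C%C.
Proof.
move=> dK; rewrite /vdim (rmorph_sum (real_complex R)); apply: eq_bigr => j _.
have ld : vl2 (delta j) by apply: vl2_delta.
have [ky yx _] := vprojP dK ld; set y := vproj _ _ in ky yx *.
have := yx _ ky; rewrite (vinL (-1) ky.1 ld ky.1) mulN1r (nsqE ky.1) => h.
rewrite (vin_conj ld ky.1) /=; have -> : vin (delta j) y = (nsq y)%:C%C.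
  by apply/eqP; rewrite -subr_eq0 addrC h.
by rewrite conjc_real.
Qed.

Lemma rdimE b K : damps b K -> vdim (vker b) = (rdim b)%:C%C.
Proof. by move=> dK; rewrite /rdim (vdimE dK). Qed.

(** On the kernel the damping operator is the identity and on its orthogonal
    complement the moments are nonnegative. *)
Lemma rdim_le_damping_tr b K n : damps b K -> rdim b <= damping_tr b K n.
Proof.
move=> dK; rewrite /rdim (vdimE dK) damping_trE /=; apply: ler_sum => j _.
have ld : vl2 (delta j) by apply: vl2_delta.
have [K0 abK] := dK; have [ky _ _] := vprojP dK ld.
rewrite (moment_proj n dK ld) lerDl moment_ge0 //.
by apply: vl2_lin => //; exact: ky.1.
Qed.

Lemma damping_tr_tends b K : damps b K -> tends0 (fun n => damping_tr b K n - rdim b).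
Proof.
move=> dK; have [K0 abK] := dK.
apply: (@tends0_le _ _ (fun n => \sum_j moment b K n (vlin (-1) (vproj (vker b) (delta j)) (delta j)))).
  move=> n; rewrite /rdim (vdimE dK) damping_trE /= -sumrB; apply: ler_sum => j _.
  by rewrite (moment_proj n dK (vl2_delta R G j)) addrAC subrr add0r.
apply: tends0_sum => j; have ld : vl2 (delta j) by apply: vl2_delta.
have [ky yx lim] := vprojP dK ld; set y := vproj _ _ in ky yx lim *.
set w := vlin _ _ _; have lw : vl2 w by apply: vl2_lin => //; exact: ky.1.
apply: tends0_sqr; apply: tends0_le (tends0Z (nsq_ge0 lw) lim) => n.
have wE : iter n (gm_act (damping b K)) w = vlin (-1) y (iter n (gm_act (damping b K)) (delta j)).
  by rewrite /w iter_lin iter_fixed //; [exact: ky.1 | exact: ky.2].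
rewrite -wE; apply: le_trans (_ : sqmod (vin (iter n (gm_act (damping b K)) w) w) <= _).
  by rewrite /sqmod /moment lerDl sqr_ge0.
by rewrite mulrC; apply: cauchy_schwarz => //; apply: vl2_iter.
Qed.

Lemma damps_max b : damps b (1 + op_bound (gm_adj b)).
Proof.
have a0 := op_bound_ge0 (gm_adj b).
by split; lra.
Qed.

Lemma eq_rdim b b' : vker b = vker b' -> rdim b = rdim b'.
Proof. by rewrite /rdim => ->. Qed.

End Dimension.

Section Limits.
Variable R : realType.
Local Notation C := R[i].
Implicit Types (u v : nat -> C) (l : C).

Definition tends u l : Prop := tends0 (fun n => sqmod (u n - l)).

Lemma tends_unique u l l' : tends u l -> tends u l' -> l = l'.
Proof.
move=> ul ul'; apply/eqP; rewrite -subr_eq0 -(@sqmod_eq0 R) eq_le sqmod_ge0 andbT.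
apply: tends0_const.
apply: tends0_le (tends0D (tends0Z (ler0n R 2) ul) (tends0Z (ler0n R 2) ul')) => n.
rewrite -[X in 2 * X + _]sqmodN; apply: le_trans (sqmodD_le _ _).
by rewrite opprB addrA subrK.
Qed.

Lemma tends_sum (I : Type) (s : seq I) (u : I -> nat -> C) (l : I -> C) :
  (forall i, tends (u i) (l i)) ->
  tends (fun n => \sum_(i <- s) u i n) (\sum_(i <- s) l i).
Proof.
move=> ul; elim: s => [|i s IHs].
  by move=> e /ltW e0; exists 0%N => n _; rewrite !big_nil subr0 /sqmod /= expr0n addr0.
apply: tends0_le (tends0D (tends0Z (ler0n R 2) (ul i)) (tends0Z (ler0n R 2) IHs)) => n.
by rewrite !big_cons opprD addrACA; apply: sqmodD_le.
Qed.

End Limits.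

Section Similarity.
Variables (R : realType) (G : groupType) (J : finType).
Local Notation C := R[i].
Local Notation V := (J -> G -> C).
Local Notation delta := (@gm_delta C J G).

Lemma tends_diagonal (u : nat -> J -> V) (v : J -> V) :
  (forall n j, vl2 (u n j)) -> (forall j, vl2 (v j)) ->
  (forall j, tends0 (fun n => nsq (vlin (-1) (v j) (u n j)))) ->
  tends (fun n => \sum_j u n j j 1%g) (\sum_j v j j 1%g).
Proof.
move=> lu lv uv; apply: tends_sum => j; apply: tends0_le (uv j) => n.
apply: le_trans (nsq_ge_coord j 1%g (vl2_lin (-1) (lv j) (lu n j))).
by rewrite /vlin mulN1r addrC.
Qed.

Lemma nsq_iter_le (b : gmx C J G) K n x : damps b K -> vl2 x ->
  nsq (iter n (gm_act (damping b K)) x) <= nsq x.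
Proof.
move=> [K0 abK] lx; elim: n => //= n IHn; apply: le_trans IHn.
have ln := vl2_iter b K n lx; apply: le_trans (nsq_damping K0 abK ln) _.
by rewrite gerBl mulr_ge0 ?invr_ge0 ?(ltW K0) ?nsq_ge0 //; apply: vl2_act.
Qed.

Lemma vdim_diagonal (b : gmx C J G) K : damps b K ->
  vdim (vker b) = \sum_j vproj (vker b) (delta j) j 1%g.
Proof.
move=> dK; apply: eq_bigr => j _; rewrite vin_delta //.
by have [[]] := vprojP dK (vl2_delta R G j).
Qed.

(** An invertible, not necessarily unitary, matrix [S] carrying one kernel onto
    another preserves dimensions. Writing [T] and [T'] for the two damping
    operators, the traces of [S T^n S^-1 T'^n] and of [T'^n S T^n S^-1] agree.
    The first converges to the trace of the projection onto the second kernel;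
    the second has the same limit as the trace of [S T^n S^-1], which is that
    of [T^n]. *)
Lemma similar_rdim (b b' S S' : gmx C J G) :
  (forall x, gm_act S (gm_act S' x) = x) -> (forall x, gm_act S' (gm_act S x) = x) ->
  (forall x, vker b x -> vker b' (gm_act S x)) ->
  (forall x, vker b' x -> vker b (gm_act S' x)) ->
  rdim b = rdim b'.
Proof.
move=> SS' S'S Sb Sb'; set K := 1 + op_bound (gm_adj b); set K' := 1 + op_bound (gm_adj b').
have dK : damps b K := damps_max b; have dK' : damps b' K' := damps_max b'.
set D := damping b K; set D' := damping b' K'.
set T := gm_act D; set T' := gm_act D'.
have ld j : vl2 (delta j) by apply: vl2_delta.
have fixT n y : vker b y -> iter n T y = y by move=> [ly by0]; apply: iter_fixed.
have fixT' n y : vker b' y -> iter n T' y = y by move=> [ly by0]; apply: iter_fixed.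
pose X n := gm_tr (gm_mul (gm_mul (gm_mul S (gm_pow D n)) S') (gm_pow D' n)).
pose p j := vproj (vker b) (gm_act S' (delta j)).
have lS' j : vl2 (gm_act S' (delta j)) by apply: vl2_act.
have kp j : vker b (p j) by have [] := vprojP dK (lS' j).
have XE1 n : X n = \sum_j gm_act S (iter n T (gm_act S' (iter n T' (delta j)))) j 1%g.
  by rewrite /X gm_trE; apply: eq_bigr => j _; rewrite !gm_act_mul !gm_act_pow.
have XE2 n : X n = \sum_j iter n T' (gm_act S (iter n T (gm_act S' (delta j)))) j 1%g.
  by rewrite /X gm_tr_mulC gm_trE; apply: eq_bigr => j _; rewrite !gm_act_mul !gm_act_pow.
have YE n : \sum_j iter n T (delta j) j 1%g =
            \sum_j gm_act S (iter n T (gm_act S' (delta j))) j 1%g.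
  transitivity (gm_tr (gm_mul (gm_mul S (gm_pow D n)) S')).
    rewrite gm_tr_mulC gm_trE; apply: eq_bigr => j _.
    by rewrite !gm_act_mul !gm_act_pow S'S.
  by rewrite gm_trE; apply: eq_bigr => j _; rewrite !gm_act_mul !gm_act_pow.
have lim_b' : tends X (vdim (vker b')).
  rewrite (vdim_diagonal dK'); rewrite (_ : X = fun n =>
     \sum_j gm_act S (iter n T (gm_act S' (iter n T' (delta j)))) j 1%g); last exact/funext.
  apply: (tends_diagonal (u := fun n j => gm_act S (iter n T (gm_act S' (iter n T' (delta j)))))
                         (v := fun j => vproj (vker b') (delta j))).
  - by move=> n j; exact/vl2_act/vl2_iter/vl2_act/vl2_iter/ld.
  - by move=> j; have [[]] := vprojP dK' (ld j).
  move=> j; have [kq _ lim] := vprojP dK' (ld j).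
  set q := vproj _ _ in kq lim *.
  apply: tends0_le (tends0Z (op_bound_ge0 S) (tends0Z (op_bound_ge0 S') lim)) => n.
  have lq := vl2_lin (-1) kq.1 (vl2_iter b' K' n (ld j)).
  have lSq := vl2_act S' lq.
  rewrite -{1}(SS' q) -(fixT n (gm_act S' q)); last exact: Sb'.
  rewrite -gm_act_lin -iter_lin -gm_act_lin.
  apply: le_trans (nsq_act _ (vl2_iter b K n lSq)) _.
  rewrite ler_wpM2l ?op_bound_ge0 //; apply: le_trans (nsq_iter_le n dK lSq) _.
  exact: nsq_act.
have lim_p (j : J) : tends0 (fun n => op_bound S *
    nsq (vlin (-1) (p j) (iter n T (gm_act S' (delta j))))).
  by apply: tends0Z (op_bound_ge0 S) _; have [_ _ lim] := vprojP dK (lS' j).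
pose Z := \sum_j gm_act S (p j) j 1%g.
have lim_Z : tends X Z.
  rewrite (_ : X = fun n =>
    \sum_j iter n T' (gm_act S (iter n T (gm_act S' (delta j)))) j 1%g); last exact/funext.
  apply: (tends_diagonal (u := fun n j => iter n T' (gm_act S (iter n T (gm_act S' (delta j)))))
                         (v := fun j => gm_act S (p j))).
  - by move=> n j; exact/vl2_iter/vl2_act/vl2_iter/lS'.
  - by move=> j; apply: vl2_act; exact: (kp j).1.
  move=> j; apply: tends0_le (lim_p j) => n.
  have lpn := vl2_lin (-1) (kp j).1 (vl2_iter b K n (lS' j)).
  rewrite -(fixT' n (gm_act S (p j))); last exact: Sb.
  rewrite -iter_lin -gm_act_lin; apply: le_trans (nsq_iter_le n dK' (vl2_act S lpn)) _.
  exact: nsq_act.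
pose Y n := \sum_j iter n T (delta j) j 1%g.
have lim_YZ : tends Y Z.
  rewrite (_ : Y = fun n => \sum_j gm_act S (iter n T (gm_act S' (delta j))) j 1%g); last exact/funext.
  apply: (tends_diagonal (u := fun n j => gm_act S (iter n T (gm_act S' (delta j))))
                         (v := fun j => gm_act S (p j))).
  - by move=> n j; exact/vl2_act/vl2_iter/lS'.
  - by move=> j; apply: vl2_act; exact: (kp j).1.
  move=> j; apply: tends0_le (lim_p j) => n; rewrite -gm_act_lin; apply: nsq_act.
  exact: vl2_lin (kp j).1 (vl2_iter b K n (lS' j)).
have lim_b : tends Y (vdim (vker b)).
  rewrite (vdim_diagonal dK); apply: (tends_diagonal (u := fun n j => iter n T (delta j))
                                               (v := fun j => vproj (vker b) (delta j))).
  - by move=> n j; exact/vl2_iter/ld.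
  - by move=> j; have [[]] := vprojP dK (ld j).
  by move=> j; have [] := vprojP dK (ld j).
rewrite /rdim (tends_unique lim_b lim_YZ); congr complex.Re.
exact: tends_unique lim_Z lim_b'.
Qed.

End Similarity.

Definition gm_block (K I J G : Type) (s : seq I) (b : I -> gmx K J G) :
    gmx K (I * J) G :=
  [seq (tcoef e, ((k, trow e), (k, tcol e)), telt e) | k <- s, e <- b k].

Lemma gm_map_block (K : Type) (I J : finType) (G H : groupType) (p : G -> H)
    (s : seq I) (b : I -> gmx K J G) :
  gm_map p (gm_block s b) = gm_block s (fun k => gm_map p (b k)).
Proof.
rewrite /gm_block /gm_map map_allpairs; congr flatten.
by apply: eq_map => l; rewrite -map_comp.
Qed.

Section Blocks.
Variables (R : realType) (G : groupType) (I J : finType).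
Local Notation C := R[i].
Implicit Types b : I -> gmx C J G.

Lemma gm_act_block b (x : I * J -> G -> C) k i g :
  gm_act (gm_block (enum I) b) x (k, i) g = gm_act (b k) (fun j => x (k, j)) i g.
Proof.
rewrite /gm_act /gm_block big_mkcond big_allpairs_dep big_enum /=.
rewrite (bigD1 k) //= [X in _ + X]big1 ?addr0 => [|l /negPf lk]; last first.
  by rewrite big1 // => e _; rewrite /trow /= xpair_eqE lk.
rewrite [RHS]big_mkcond; apply: eq_bigr => e _.
by rewrite /trow /tcol /telt /tcoef /= xpair_eqE eqxx.
Qed.

Lemma gm_adj_block b : gm_adj (gm_block (enum I) b) = gm_block (enum I) (fun k => gm_adj (b k)).
Proof.
rewrite /gm_adj /gm_star /gm_block map_allpairs; congr flatten.
by apply: eq_map => k; rewrite -map_comp; apply: eq_map => e.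
Qed.

Lemma rdim_block b : rdim (gm_block (enum I) b) = \sum_k rdim (b k).
Proof.
set D := gm_block (enum I) b.
pose K := 1 + op_bound (gm_adj D) + \sum_k op_bound (gm_adj (b k)).
have s0 : 0 <= \sum_k op_bound (gm_adj (b k)).
  by apply: sumr_ge0 => k _; apply: op_bound_ge0.
have dD : damps D K by have := op_bound_ge0 (gm_adj D); split; rewrite /K; lra.
have db k : damps (b k) K.
  have := op_bound_ge0 (gm_adj D); split; rewrite /K; first by lra.
  rewrite (bigD1 k) //= -[leLHS]add0r; apply: lerD; first by rewrite addr_ge0 // addr_ge0.
  by rewrite lerDl; apply: sumr_ge0 => l _; apply: op_bound_ge0.
have TD n x k i g : iter n (gm_act (damping D K)) x (k, i) g =
    iter n (gm_act (damping (b k) K)) (fun j => x (k, j)) i g.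
  elim: n i g => //= n IHn i g.
  rewrite !dampingE /vlin gm_adj_block gm_act_block IHn.
  congr (_ * gm_act _ _ i g + _).
  apply/funext => j; apply/funext => h; rewrite gm_act_block.
  by congr (gm_act _ _ j h); apply/funext => l; apply/funext => h'.
have trD n : damping_tr D K n = \sum_k damping_tr (b k) K n.
  rewrite damping_trE; under [RHS]eq_bigr do rewrite damping_trE.
  rewrite pair_big /=; apply: eq_bigr => -[k j] _.
  rewrite /moment !vin_delta ?TD; try by apply: vl2_iter; apply: vl2_delta.
  congr complex.Re; congr (iter _ _ _ _ _); apply/funext => l; apply/funext => g.
  by rewrite /gm_delta xpair_eqE eqxx.
apply/eqP; rewrite eq_le; apply/andP; split; rewrite -subr_le0; apply: tends0_const.
  apply: tends0_le (tends0_sum (index_enum I) (fun k => damping_tr_tends (db k))) => n.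
  by rewrite sumrB -trD lerD2r; apply: rdim_le_damping_tr.
apply: tends0_le (damping_tr_tends dD) => n.
by rewrite trD lerD2r; apply: ler_sum => k _; apply: rdim_le_damping_tr.
Qed.

End Blocks.

(** * Semicontinuity along a separating sequence of quotients *)

Section Terms.
Variables (R : realType) (G : groupType) (d : nat).
Local Notation C := R[i].
Implicit Type B : 'M[group_ring R G]_d.

Definition mx_terms B : gmx C 'I_d G :=
  [seq (B ij.1 ij.2 h, ij, h) | ij <- enum {: 'I_d * 'I_d}, h <- finsupp (B ij.1 ij.2)].

Lemma big_mx_terms B (T : nmodType) (F : gterm C 'I_d G -> T) :
  \sum_(e <- mx_terms B) F e =
  \sum_i \sum_j \sum_(h <- finsupp (B i j)) F (B i j h, (i, j), h).
Proof.
by rewrite /mx_terms big_allpairs_dep big_enum pair_big; apply: eq_bigr => -[].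
Qed.

Lemma gm_act_mx_terms B x : gm_act (mx_terms B) x = mxact B x.
Proof.
apply/funext => i; apply/funext => g.
rewrite /gm_act big_mkcond big_mx_terms (bigD1 i) //= [X in _ + X]big1 ?addr0.
  by apply: eq_bigr => j _; apply: eq_bigr => h _; rewrite /trow /= eqxx.
move=> k /negPf ki; rewrite big1 // => j _; rewrite big1 // => h _.
by rewrite /trow /= ki.
Qed.

Lemma dim_kerE B : dim_ker B = vdim (vker (mx_terms B)).
Proof.
have kE : l2_ker B = vker (mx_terms B).
  by apply/funext => x; rewrite /l2_ker /vker gm_act_mx_terms.
rewrite /dim_ker /trG /vdim kE; apply: eq_bigr => j _.
have -> : @basis_vec R G d j = @gm_delta C _ G j.
  apply/funext => i; apply/funext => g; rewrite /basis_vec /gm_delta.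
  by case: ifP.
by [].
Qed.

End Terms.

Lemma gm_act_group_ring_map (R : realType) (G H : groupType) (p : ghom G H)
    (d : nat) (B : 'M[group_ring R G]_d) x :
  gm_act (mx_terms (map_mx (group_ring_map p) B)) x =
  gm_act (gm_map p (mx_terms B)) x.
Proof.
apply/funext => i; apply/funext => g.
rewrite /gm_act big_mkcond [RHS]big_mkcond big_map !big_mx_terms.
apply: eq_bigr => k _; apply: eq_bigr => j _; rewrite mxE /trow /tcol /telt /tcoef /=.
case: eqP => _; last by rewrite !big1.
set a := B k j; set f := x j.
have -> : \sum_(h <- finsupp (group_ring_map p a)) group_ring_map p a h * f (h^-1 * g)%g =
    \sum_(h <- (p @` finsupp a)%fset) group_ring_map p a h * f (h^-1 * g)%g.
  apply: big_fset_incl => [|h _ hn]; last first.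
    by rewrite (fsfun_dflt hn) mul0r.
  apply/fsubsetP => h; rewrite mem_finsupp fsfunE; case: ifP => //.
  by rewrite eqxx.
rewrite (eq_big_seq (fun h => \sum_(y <- finsupp a | p y == h) a y * f (h^-1 * g)%g)); last first.
  by move=> h hp; rewrite /group_ring_map fsfunE hp mulr_suml.
rewrite (exchange_big_dep xpredT) //= big_seq [RHS]big_seq; apply: eq_bigr => y ya.
have pyi : p y \in (p @` finsupp a)%fset by apply/imfsetP; exists y.
rewrite big_mkcond (big_fsetD1 (p y) pyi) /= eqxx big_seq big1 ?addr0 // => h.
by rewrite in_fsetD1 eq_sym => /andP[/negPf-> _].
Qed.

Lemma dim_ker_map (R : realType) (G H : groupType) (p : ghom G H)
    (d : nat) (B : 'M[group_ring R G]_d) :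
  dim_ker (map_mx (group_ring_map p) B) = vdim (vker (gm_map p (mx_terms B))).
Proof.
rewrite dim_kerE; congr vdim; apply/funext => x.
by rewrite /vker gm_act_group_ring_map.
Qed.

(** Evaluation of a polynomial at the formal powers [a 0, a 1, ...]. *)
Definition poly_sum (K : comNzRingType) (a : nat -> K) (q : {poly K}) : K :=
  \sum_(k < size q) q`_k * a k.

Lemma poly_sum_widen (K : comNzRingType) (a : nat -> K) (q : {poly K}) n :
  (size q <= n)%N -> poly_sum a q = \sum_(k < n) q`_k * a k.
Proof.
move=> qn; rewrite /poly_sum (big_ord_widen n (fun k => q`_k * a k) qn) big_mkcond /=.
apply: eq_bigr => k _; case: ifPn => //; rewrite -leqNgt => qk.
by rewrite nth_default ?mul0r.
Qed.

Lemma poly_sum_lin (K : comNzRingType) (a : nat -> K) c (q r : {poly K}) :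
  poly_sum a (c *: q + r) = c * poly_sum a q + poly_sum a r.
Proof.
pose n := maxn (size (c *: q + r)) (maxn (size q) (size r)).
rewrite !(@poly_sum_widen _ a _ n) /n ?leq_max ?leqnn ?orbT //.
rewrite mulr_sumr -big_split; apply: eq_bigr => k _.
by rewrite coefD coefZ mulrDl mulrA.
Qed.

Lemma poly_sumX (K : comNzRingType) (a : nat -> K) (q : {poly K}) :
  poly_sum a ('X * q) = poly_sum (fun k => a k.+1) q.
Proof.
have szX : (size ('X * q)%R <= (size q).+1)%N.
  by apply: leq_trans (size_mul_leq _ _) _; rewrite size_polyX.
rewrite (poly_sum_widen a szX) big_ord_recl coefXM /= mul0r add0r.
by apply: eq_bigr => k _; rewrite coefXM.
Qed.

Section HermitianTraces.
Variables (R : realType) (G : groupType) (J : finType).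
Local Notation C := R[i].

Lemma gm_trp_sum (U : gmx int J G) (q : {poly R}) :
  gm_trp U q = poly_sum (fun k => (gm_tr (gm_pow U k))%:~R) q.
Proof. by []. Qed.

Lemma gm_trp_log_poly (U : gmx int J G) (K : R) M N :
  gm_trp U (log_poly K M N) = \sum_(1 <= n < M.+1) n%:R^-1 *
    (gm_trp U (contraction K ^+ n) - gm_trp U (contraction K ^+ N)).
Proof.
have psN (a : nat -> R) q r : poly_sum a (q - r) = poly_sum a q - poly_sum a r.
  by rewrite addrC -scaleN1r poly_sum_lin mulN1r addrC.
rewrite /log_poly; elim/big_rec2: _ => [|n x q _ <-].
  by rewrite /gm_trp size_poly0 big_ord0.
by rewrite gm_trp_sum poly_sum_lin psN.
Qed.

Definition herm (V : gmx int J G) : gmx C J G := gm_coefs intr (gm_herm V).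

Lemma herm_adj V x : gm_act (gm_adj (herm V)) x = gm_act (herm V) x.
Proof.
have P : perm_eq (gm_adj (herm V)) (herm V).
  rewrite /herm /gm_herm /gm_adj gm_coefs_cat /gm_star map_cat perm_catC perm_cat //.
    rewrite /gm_coefs -!map_comp (eq_map (g := fun e => ((tcoef e)%:~R, e.1.2, telt e))) //.
    by move=> e; rewrite /= /tcoef /telt /= rmorph_int invgK; case: e => [[c [i j]] g].
  rewrite /gm_coefs -!map_comp (eq_map (g := fun e => ((tcoef e)%:~R, (tcol e, trow e), (telt e)^-1%g))) //.
  by move=> e; rewrite /= /tcoef /= rmorph_int.
by apply/funext => i; apply/funext => g; rewrite /gm_act (perm_big _ P).
Qed.

Lemma damping_herm V (K : R) n x i g :
  iter n (gm_act (damping (herm V) K)) x i g =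
  poly_sum (fun k => iter k (gm_act (herm V)) x i g)
           (map_poly (real_complex R) (contraction K ^+ n)).
Proof.
set U := herm V; elim: n i g => [|n IHn] i g /=.
  rewrite expr0 rmorph1 (@poly_sum_widen _ _ _ 1) ?size_poly1 //.
  by rewrite big_ord1 coef1 mul1r.
have shift a (y := fun i g => poly_sum (fun k => iter (k + a) (gm_act U) x i g)
    (map_poly (real_complex R) (contraction K ^+ n))) :
    gm_act U y = fun i g => poly_sum (fun k => iter (k + a.+1) (gm_act U) x i g)
    (map_poly (real_complex R) (contraction K ^+ n)).
  rewrite /y /poly_sum gm_act_sum; apply/funext => i'; apply/funext => g'.
  by apply: eq_bigr => k _; rewrite gm_actZ addnS.
have -> : iter n (gm_act (damping U K)) x = fun i g =>
    poly_sum (fun k => iter (k + 0) (gm_act U) x i g)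
      (map_poly (real_complex R) (contraction K ^+ n)).
  apply/funext => i'; apply/funext => g'; rewrite IHn.
  by congr poly_sum; apply/funext => k; rewrite addn0.
rewrite dampingE /vlin herm_adj -/U !shift.
have cE : map_poly (real_complex R) (contraction K) = (- K^-1)%:C%C *: 'X^2 + 1.
  apply/polyP => k; rewrite coef_map /contraction coefB coefD !coefZ !coefXn !coef1.
  pose rc : {rmorphism R -> C} := real_complex R.
  rewrite -[LHS]/(rc ((k == 0%N)%:R - K^-1 * (k == 2%N)%:R)) -[(- K^-1)%:C%C]/(rc (- K^-1)).
  by rewrite (rmorphB rc) (rmorphM rc) (rmorphN rc) !(rmorph_nat rc) mulNr addrC.
rewrite exprS rmorphM [X in poly_sum _ (X * _)]cE.
rewrite mulrDl mul1r -scalerAl poly_sum_lin expr2 -mulrA !poly_sumX.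
congr (_ * _ + _); congr poly_sum; apply/funext => k; by rewrite ?addn2 ?addn0.
Qed.

Lemma damping_tr_herm V (K : R) n : damping_tr (herm V) K n = gm_trp (gm_herm V) (contraction K ^+ n).
Proof.
rewrite /damping_tr gm_trE.
transitivity (complex.Re (poly_sum (fun k => (gm_tr (gm_pow (gm_herm V) k))%:~R : C)
    (map_poly (real_complex R) (contraction K ^+ n)))).
  congr complex.Re; under eq_bigr do rewrite gm_act_pow damping_herm.
  rewrite /poly_sum exchange_big; apply: eq_bigr => k _.
  rewrite -mulr_sumr; congr (_ * _).
  rewrite -(gm_tr_coefs intr) gm_coefs_pow gm_trE.
  by apply: eq_bigr => j _; rewrite gm_act_pow.
rewrite /poly_sum size_map_poly /gm_trp (raddf_sum (@complex.Re R : Rcomplex R -> R)).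
apply: eq_bigr => k _.
rewrite coef_map -(rmorph_int (real_complex R)) -(rmorphM (real_complex R)) //.
Qed.

End HermitianTraces.

Lemma gm_map_herm_intr (R : realType) (G H : groupType) (p : ghom G H) (J : finType)
    (V : gmx int J G) : gm_map p (herm R V) = herm R (gm_map p V).
Proof.
rewrite /herm -gm_map_herm /gm_map /gm_coefs -!map_comp.
by apply: eq_map => x.
Qed.

Section MapDamping.
Variables (R : realType) (G H : groupType) (p : ghom G H) (J : finType).
Local Notation C := R[i].
Implicit Type b : gmx C J G.

Lemma gm_map_scale (c : C) b : gm_map p (gm_scale c b) = gm_scale c (gm_map p b).
Proof. by rewrite /gm_map /gm_scale -!map_comp; apply: eq_map. Qed.

Lemma gm_map_damping b (K : R) : gm_map p (damping b K) = damping (gm_map p b) K.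
Proof.
by rewrite /damping gm_map_cat gm_map_one gm_map_scale gm_map_mul [gm_map p (gm_adj b)]gm_map_star.
Qed.

Lemma op_bound_map b : op_bound (gm_map p b) = op_bound b.
Proof. by elim: b => //= e b IHb; rewrite /op_bound /= in IHb *; rewrite IHb. Qed.

Lemma damps_map b (K : R) : damps b K -> damps (gm_map p b) K.
Proof. by move=> [K0 bK]; split=> //; rewrite -[gm_adj _]gm_map_star op_bound_map. Qed.

End MapDamping.

Section Approximation.
Variables (R : realType) (G : groupType) (H : nat -> groupType).
Variable p : forall i, ghom G (H i).
Hypothesis sep : forall s : seq G, exists i0, forall i, (i0 <= i)%N ->
  forall g, g \in s -> p i g = 1%g -> g = 1%g.
Local Notation C := R[i].

Definition rdim_at (J : finType) (b : gmx C J G) i : R := rdim (gm_map (p i) b).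

Lemma damping_tr_eventually (J : finType) (b : gmx C J G) K n :
  exists i0, forall i, (i0 <= i)%N -> damping_tr (gm_map (p i) b) K n = damping_tr b K n.
Proof.
have [i0 si] := sep [seq telt e | e <- gm_pow (damping b K) n].
exists i0 => i /si pi; rewrite /damping_tr -gm_map_damping -gm_map_pow.
rewrite -[in RHS](gm_map_id (gm_pow (damping b K) n)).
congr complex.Re; apply: (@gm_tr_map2 _ _ _ _ _ (p i) idfun) => e eb.
by split=> [/pi->|/= ->]; [by []|exact: map_f|rewrite gmulf1].
Qed.

(** Kazhdan's inequality. Over every group the dimension is a decreasing limit
    of traces, each of which is eventually the same over the quotients as
    over [G]. *)
Lemma rdim_upper (J : finType) (b : gmx C J G) :
  tends0 (fun i => rdim_at b i - rdim b).
Proof.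
move=> e e0; have dK := damps_max b; set K := 1 + _ in dK.
have [n pn] := damping_tr_tends dK e0; have [i0 pi] := damping_tr_eventually b K n.
exists i0 => i /pi pin; apply: le_trans (pn n (leqnn n)); rewrite lerD2r -pin.
exact/rdim_le_damping_tr/damps_map.
Qed.

(** The half of the approximation that depends on the arithmetic of the
    coefficients. *)
Definition rdim_lower (J : finType) (b : gmx C J G) : Prop :=
  tends0 (fun i => rdim b - rdim_at b i).

Lemma harmonic_unbounded (A : R) : exists M, A <= \sum_(1 <= n < M.+1) n%:R^-1.
Proof.
apply: contrapT => /forallNP nA; apply: (@dvg_harmonic R).
apply: nondecreasing_is_cvgn.
  apply/nondecreasing_seqP => n; rewrite /series /= big_nat_recr //= lerDl.
  by rewrite /harmonic invr_ge0.
exists A => _ [n _ <-]; apply/ltW; rewrite ltNge; apply/negP.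
have := nA n; rewrite big_add1 /= => h; apply: contra_not h.
by move/le_trans; apply; rewrite /series /= /harmonic.
Qed.

(** The determinant bound makes the traces over the quotients approach their
    limits [rdim_at] at a rate independent of [i]: the differences, weighted by
    the terms of the divergent harmonic series, have a sum bounded by [c]. If
    [rdim_at] stayed below [rdim] by [e], finitely many of the differences,
    already equal to those over [G], would be at least [e] and exceed [c]. *)
Lemma rdim_lower_herm (J : finType) (V : gmx int J G) :
  (forall i, det_bound R (H i)) -> rdim_lower (herm R V).
Proof.
move=> dH e e0; set U := herm R V.
have mapU i : gm_map (p i) U = herm R (gm_map (p i) V) by apply: gm_map_herm_intr.
(* [k] has to dominate the row norms, for the determinant bound, and the
   squared operator norm, for the damping operator with constant [k ^+ 2]. *)
pose k : R := 1 + op_bound (gm_adj U) + \sum_j gm_row_norm intr (gm_herm V) j.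
have row0 j : 0 <= gm_row_norm (intr : int -> R) (gm_herm V) j.
  by apply: sumr_ge0.
have rows0 : 0 <= \sum_j gm_row_norm (intr : int -> R) (gm_herm V) j by apply: sumr_ge0.
have opb0 := op_bound_ge0 (gm_adj U).
have k1 : 1 <= k by rewrite /k; lra.
have rowk j : gm_row_norm (intr : int -> R) (gm_herm V) j <= k.
  rewrite /k (bigD1 j) //=; have : 0 <= \sum_(i | i != j) gm_row_norm (intr : int -> R) (gm_herm V) i.
    by apply: sumr_ge0.
  by move: (\sum_(i | _) _) => s s0; lra.
pose K := k ^+ 2.
have dK : damps U K.
  have kK : k <= K by rewrite /K expr2 ler_peMl // (le_trans ler01).
  by split; [apply: lt_le_trans kK; lra | apply: le_trans kK; rewrite /k; lra].
pose c := #|J|%:R * ln K : R.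
have bound i M : (\sum_(1 <= n < M.+1) n%:R^-1 * (damping_tr (gm_map (p i) U) K n - rdim_at U i)) <= c.
  have dKi := damps_map (p i) dK.
  have rowki j : gm_row_norm (intr : int -> R) (gm_herm (gm_map (p i) V)) j <= k.
    by rewrite -gm_map_herm gm_row_norm_map.
  rewrite -subr_le0; apply: tends0_const.
  have h0 : 0 <= \sum_(1 <= n < M.+1) n%:R^-1 :> R by apply: sumr_ge0 => n _; rewrite invr_ge0.
  apply: tends0_le (tends0Z h0 (damping_tr_tends dKi)) => N.
  have := dH i J (gm_map (p i) V) k M N k1 rowki; rewrite -/K -/c.
  rewrite gm_trp_log_poly lerBlDr -lerBlDl; apply: le_trans.
  rewrite mulr_suml -sumrB; apply: ler_sum => n _.
  by rewrite -!damping_tr_herm -!mapU -mulrBr /rdim_at opprB addrA subrK.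
have [M hM] := harmonic_unbounded (c / e + 1).
have [i0 hi0] : exists i0, forall i, (i0 <= i)%N -> forall n, (n <= M)%N ->
    damping_tr (gm_map (p i) U) K n = damping_tr U K n.
  elim: M {hM} => [|M [i0 IH]].
    have [i0 h] := damping_tr_eventually U K 0; exists i0 => i /h hi n.
    by rewrite leqn0 => /eqP ->.
  have [i1 h] := damping_tr_eventually U K M.+1; exists (maxn i0 i1) => i.
  rewrite geq_max => /andP[/IH h0 /h h1] n.
  by rewrite leq_eqVlt ltnS => /predU1P[->|/h0].
exists i0 => i /hi0 tri; rewrite leNgt; apply/negP => elt.
have := bound i M; rewrite leNgt => /negP; apply.
have h0 : 0 <= \sum_(1 <= n < M.+1) n%:R^-1 :> R by apply: sumr_ge0 => n _; rewrite invr_ge0.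
apply: (@lt_le_trans _ _ ((\sum_(1 <= n < M.+1) n%:R^-1) * e)).
  apply: (@lt_le_trans _ _ ((c / e + 1) * e)); last by rewrite ler_wpM2r // ltW.
  by rewrite mulrDl mul1r mulfVK ?gt_eqF // ltrDl.
rewrite mulr_suml big_nat [leRHS]big_nat; apply: ler_sum => n /andP[_ nM].
rewrite ler_wpM2l ?invr_ge0 // (tri n nM); apply: le_trans (ltW elt) _.
by rewrite lerD2r; apply: rdim_le_damping_tr.
Qed.

(** The dimensions of all the other blocks satisfy the upper estimate, so a
    lower estimate for the sum leaves one for each block. *)
Lemma rdim_lower_block (I J : finType) (b : I -> gmx C J G) k :
  rdim_lower (gm_block (enum I) b) -> rdim_lower (b k).
Proof.
move=> lowD; have up l : tends0 (fun i => if l == k then 0 else rdim_at (b l) i - rdim (b l)).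
  case: eqP => _; last exact: rdim_upper.
  by move=> e /ltW e0; exists 0%N.
apply: tends0_le (tends0D lowD (tends0_sum (index_enum I) up)) => i.
rewrite [rdim_at (gm_block _ _) i]/rdim_at gm_map_block !rdim_block.
rewrite [X in _ <= X - _ + _](bigD1 k) //= [X in _ <= _ - X + _](bigD1 k) //=.
rewrite [X in _ <= _ + X](bigD1 k) //= eqxx add0r.
have -> : \sum_(l | l != k) (if l == k then 0 else rdim_at (b l) i - rdim (b l)) =
          \sum_(l | l != k) rdim_at (b l) i - \sum_(l | l != k) rdim (b l).
  by rewrite -sumrB; apply: eq_bigr => l /negPf->.
rewrite /rdim_at; move: (\sum_(l | l != k) rdim (b l)) (\sum_(l | l != k) rdim _) => x y.
by move: (rdim (b k)) (rdim (gm_map _ _)) => u v; lra.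
Qed.

End Approximation.

(** * Algebraic coefficients *)

Lemma vker_scale (R : realType) (G : groupType) (J : finType) (c : R[i])
    (b : gmx R[i] J G) : c != 0 -> vker (gm_scale c b) = vker b.
Proof.
move=> c0; apply/funext => x; rewrite /vker gm_act_scale; apply/propext.
split=> -[lx bx]; split=> //; last first.
  by rewrite bx; apply/funext => i; apply/funext => g; rewrite mulr0.
apply/funext => i; apply/funext => g; have := congr1 (fun f => f i g) bx.
by move=> /= /eqP; rewrite mulf_eq0 (negPf c0) => /eqP.
Qed.

Lemma clear_denominators (R : realType) (G : groupType) (J : finType) (b : gmx R[i] J G) :
  (forall e, e \in b -> exists q : rat, tcoef e = ratr q) ->
  exists D : nat, (0 < D)%N /\
    exists V : gmx int J G, gm_scale D%:R b = gm_coefs intr V.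
Proof.
elim: b => [|e b IHb] bq; first by exists 1%N; split=> //; exists [::].
have [D [D0 [V DV]]] := IHb (fun f fb => bq f (mem_behead (s := e :: b) fb)).
have [q eq] := bq e (mem_head _ _); pose m := `|denq q|%N.
have m0 : (0 < m)%N by rewrite absz_gt0 denq_neq0.
exists (D * m)%N; split; first by rewrite muln_gt0 D0.
exists ((D%:Z * numq q, (trow e, tcol e), telt e) ::
  [seq (m%:Z * tcoef f, (trow f, tcol f), telt f) | f <- V]).
rewrite /gm_scale /gm_coefs /= -map_comp; congr (_ :: _).
  have -> : (D * m)%:R * tcoef e = (D%:Z * numq q)%:~R :> R[i].
    rewrite natrM eq intrM -mulrA; congr (_ * _); rewrite /ratr mulrC -mulrA.
    have -> : (m%:R : R[i]) = (denq q)%:~R by rewrite pmulrn /m absz_denq.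
    by rewrite mulVf ?mulr1 // intr_eq0 denq_neq0.
  by [].
have : [seq (m%:R * tcoef f, (trow f, tcol f), telt f) | f <- gm_scale D%:R b] =
       [seq (m%:R * tcoef f, (trow f, tcol f), telt f) | f <- gm_coefs (intr : int -> R[i]) V].
  by rewrite DV.
rewrite /gm_scale /gm_coefs -!map_comp => E.
transitivity [seq (m%:R * (D%:R * tcoef f), (trow f, tcol f), telt f) | f <- b].
  by apply: eq_map => f; rewrite natrM mulrA (mulrC m%:R).
apply: etrans E _; apply: eq_map => f /=.
by rewrite /tcoef /= rmorphM /=; case: f => [[? []]].
Qed.

(** Doubling the index set turns an arbitrary matrix into half of a self-adjoint
    one. *)
Definition offdiag K J (G : groupType) (V : gmx K J G) : gmx K (bool * J) G :=
  [seq (tcoef e, ((true, trow e), (false, tcol e)), telt e) | e <- V].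

(** The self-adjoint matrix with off-diagonal blocks [B] and [B^*] has the same
    kernel as the block diagonal matrix with blocks [B^*] and [B]. *)
Lemma rdim_offdiag (R : realType) (G : groupType) (J : finType) (V : gmx int J G) :
  let b := gm_coefs intr V : gmx R[i] J G in
  rdim (herm R (offdiag V)) = rdim (gm_block (enum {: bool}) (fun k => if k then gm_adj b else b)).
Proof.
move=> b; apply: eq_rdim; apply/funext => x; rewrite /vker; apply/propext.
have actT i g : gm_act (herm R (offdiag V)) x (true, i) g = gm_act b (fun j => x (false, j)) i g.
  rewrite /gm_act /herm /gm_herm /offdiag gm_coefs_cat big_cat /=.
  rewrite [X in _ + X]big1_seq ?addr0 => [|e /andP[+ eV]]; last first.
    by move: eV; rewrite /gm_coefs /gm_star -!map_comp => /mapP[f _ ->]; rewrite /trow /= xpair_eqE.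
  rewrite /b /gm_coefs !big_map; exact: eq_big.
have actF i g : gm_act (herm R (offdiag V)) x (false, i) g =
    gm_act (gm_adj b) (fun j => x (true, j)) i g.
  rewrite /gm_act /herm /gm_herm /offdiag gm_coefs_cat big_cat /=.
  rewrite [X in X + _]big1_seq ?add0r => [|e /andP[+ eV]]; last first.
    by move: eV; rewrite /gm_coefs -!map_comp => /mapP[f _ ->]; rewrite /trow /= xpair_eqE.
  rewrite /b /gm_coefs /gm_adj /gm_star !big_map.
  apply: eq_big => [//|e _].
  by rewrite /tcoef /tcol /telt /trow /= rmorph_int.
split=> -[lx bx]; split=> //; apply/funext => -[k i]; apply/funext => g.
  rewrite gm_act_block; case: k.
    by have := congr1 (fun f => f (false, i) g) bx; rewrite actF.
  by have := congr1 (fun f => f (true, i) g) bx; rewrite actT.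
case: k.
  by have := congr1 (fun f => f (false, i) g) bx; rewrite actT gm_act_block.
by have := congr1 (fun f => f (true, i) g) bx; rewrite actF gm_act_block.
Qed.

Section Conjugates.
Variable R : realType.
Local Notation C := R[i].

(** The ring generated over the rationals by the entries of [s], as an iterated
    ring of polynomial values, so that the entries can be eliminated one by
    one. *)
Fixpoint coef_span (s : seq C) (z : C) : Prop :=
  if s is a :: s' then exists q : {poly C}, (forall k, coef_span s' q`_k) /\ z = q.[a]
  else exists q : rat, z = ratr q.

Lemma coef_spanD s y z : coef_span s y -> coef_span s z -> coef_span s (y + z).
Proof.
elim: s y z => [|a s IH] y z /=.
  by move=> [q ->] [r ->]; exists (q + r); rewrite rmorphD.
move=> [q [qs ->]] [r [rs ->]]; exists (q + r); rewrite hornerD; split=> // k.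
by rewrite coefD; apply: IH.
Qed.

Lemma coef_spanZ s q z : coef_span s z -> coef_span s (z * ratr q).
Proof.
elim: s z => [|a s IH] z /=; first by move=> [r ->]; exists (r * q); rewrite rmorphM.
move=> [r [rs ->]]; exists (r * (ratr q)%:P); rewrite hornerM hornerC; split=> // k.
by rewrite coefMC; apply: IH.
Qed.

Lemma coef_span_rat s q : coef_span s (ratr q).
Proof.
elim: s q => [|a s IH] q /=; first by exists q.
exists (ratr q)%:P; rewrite hornerC; split=> // k; rewrite coefC.
by case: eqP => _; [exact: IH | have := IH 0; rewrite rmorph0].
Qed.

Lemma coef_span_sum s (I : Type) (r : seq I) (F : I -> C) :
  (forall i, coef_span s (F i)) -> coef_span s (\sum_(i <- r) F i).
Proof.
move=> Fs; elim: r => [|i r IH].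
  by rewrite big_nil; have := coef_span_rat s 0; rewrite rmorph0.
by rewrite big_cons; apply: coef_spanD.
Qed.

Lemma mem_coef_span (s : seq C) z : z \in s -> coef_span s z.
Proof.
elim: s => [//|a s IH]; rewrite inE => /predU1P[->|zs] /=.
  exists 'X; rewrite hornerX; split=> // k; rewrite coefX.
  by have := coef_span_rat s (k == 1%N)%:R; rewrite rmorph_nat.
exists z%:P; rewrite hornerC; split=> // k; rewrite coefC.
by case: eqP => _; [exact: IH | have := coef_span_rat s 0; rewrite rmorph0].
Qed.

(** Separability provides distinct roots, hence an invertible Vandermonde
    matrix. The repeated factors of [f] are collected in [gcdp f f^`()]; if [a]
    is a root of it, the degree goes down. *)
Lemma separable_annihilator (a : C) : algebraic_number a ->
  exists f : {poly rat}, [/\ separable_poly f, f \is monic & root (map_poly ratr f) a].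
Proof.
case=> f f0 fa.
suff [h [sh h0 ha]] : exists h : {poly rat}, [/\ separable_poly h, h != 0 & root (map_poly ratr h) a].
  exists ((lead_coef h)^-1 *: h); have lh0 : (lead_coef h)^-1 != 0 by rewrite invr_eq0 lead_coef_eq0.
  split; last by rewrite map_polyZ rootZ // fmorph_eq0.
    by rewrite (eqp_separable (eqp_scale h lh0)).
  by rewrite monicE lead_coefZ mulVf ?lead_coef_eq0.
have [n] := ubnP (size f); elim: n => // n IH in f f0 fa * => fn.
set g := gcdp f f^`(); have g0 : g != 0 by rewrite gcdp_eq0 negb_and f0.
have [ga|ga] := boolP (root (map_poly ratr g) a).
  suff gf : (size g < size f)%N by apply: IH g0 ga _; apply: leq_trans gf _.
  have f'0 : f^`() != 0.
    apply/eqP => f'0; have /eqP sf : size f == 1%N.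
      rewrite eqn_leq size_poly_gt0 f0 andbT leqNgt; apply/negP => sf.
      have := congr1 (fun q : {poly rat} => q`_(size f).-2) f'0.
      rewrite coef_deriv coef0 => /eqP; rewrite mulrn_eq0 /= prednK -?subn1 ?subn_gt0 //.
      by rewrite subn1 -lead_coefE lead_coef_eq0 (negPf f0).
    by have := root_size_gt1 _ fa; rewrite size_map_poly sf map_poly_eq0 => /(_ f0).
  by apply: leq_ltn_trans _ (lt_size_deriv f0); apply: dvdp_leq => //; apply: dvdp_gcdr.
exists (f %/ g); split; first exact: make_separable.
  by rewrite divp_eq0 !negb_or f0 g0 -leqNgt dvdp_leq // dvdp_gcdl.
have : root (map_poly ratr (f %/ g * g)) a by rewrite divpK ?dvdp_gcdl.
by rewrite rmorphM rootM (negPf ga) orbF.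
Qed.

(** The diagonal matrix of the roots [r k] of a rational polynomial annihilating
    [a] is conjugate, by the Vandermonde matrix of the roots, to the companion
    matrix of the polynomial, whose powers have rational entries. *)
Lemma diagonal_rational (a : C) : algebraic_number a ->
  exists (m : nat) (V V' : 'M[C]_m) (r : 'I_m -> C),
    [/\ V *m V' = 1%:M, V' *m V = 1%:M, exists k, r k = a &
      forall n i j, exists q : rat,
        (V *m diag_mx (\row_k r k ^+ n) *m V') i j = ratr q].
Proof.
move=> /separable_annihilator[f [sf mf fa]]; pose h := map_poly (ratr : rat -> C) f.
have mh : h \is monic by rewrite monic_map.
have [s hs] := closed_field_poly_normal h; rewrite (monicP mh) scale1r in hs.
have us : uniq s by rewrite -separable_prod_XsubC -hs separable_map.
have as_ : a \in s by rewrite -root_prod_XsubC -hs.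
pose m := size s; pose r (k : 'I_m) := s`_k.
have sh : size h = m.+1 by rewrite hs size_prod_XsubC.
have hr k : h.[r k] = 0.
  by apply/eqP; rewrite -[_ == 0]/(root h (r k)) hs root_prod_XsubC mem_nth.
pose V : 'M[C]_m := Vandermonde m (\row_k r k).
have uV : V \in unitmx.
  rewrite unitmxE det_Vandermonde unitfE; apply/prodf_neq0 => i _.
  apply/prodf_neq0 => j ij; rewrite !mxE subr_eq0 nth_uniq //.
  by rewrite gtn_eqF.
exists m, V, (invmx V), r; split; [exact: mulmxV | exact: mulVmx | |].
  by exists (Ordinal (etrans (index_mem a s) as_)); rewrite /r /= nth_index.
pose A : 'M[rat]_m := \matrix_(i, j) if i.+1 == m then - f`_j else (i.+1 == j :> nat)%:R.
have AV : map_mx ratr A *m V = V *m diag_mx (\row_k r k).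
  apply/matrixP => i k; rewrite mul_mx_diag !mxE -exprSr.
  under eq_bigr => j _ do rewrite !mxE.
  case: eqP => [im|im].
    have := hr k; rewrite horner_coef sh big_ord_recr /=.
    have -> : h`_m = 1 by have := monicP mh; rewrite lead_coefE sh.
    rewrite mul1r addrC => /eqP; rewrite addr_eq0 im => /eqP ->.
    by rewrite -sumrN; apply: eq_bigr => j _; rewrite rmorphN mulNr coef_map.
  have im' : (i.+1 < m)%N by rewrite ltn_neqAle ltn_ord andbT; apply/eqP.
  rewrite (bigD1 (Ordinal im')) //= eqxx rmorph1 mul1r big1 ?addr0 // => j.
  by rewrite -val_eqE /= eq_sym => /negPf ->; rewrite rmorph0 mul0r.
elim=> [|n IHn] i j.
  have -> : diag_mx (\row_k r k ^+ 0) = 1%:M.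
    by apply/matrixP => k l; rewrite !mxE expr0.
  by rewrite mulmx1 mulmxV // mxE; exists (i == j)%:R; rewrite rmorph_nat.
have -> : diag_mx (\row_k r k ^+ n.+1) = diag_mx (\row_k r k) *m diag_mx (\row_k r k ^+ n).
  rewrite mulmx_diag; congr diag_mx; apply/rowP => k; rewrite !mxE.
  by rewrite exprS.
rewrite mulmxA -AV -!mulmxA mxE.
have [B BE] := choice (fun k => IHn k j).
exists (\sum_k A i k * B k); rewrite rmorph_sum; apply: eq_bigr => k _.
by rewrite rmorphM /= -BE mxE mulmxA.
Qed.

Section Specialization.
Variables (m : nat) (V V' : 'M[C]_m) (r : 'I_m -> C).
Hypotheses (VV' : V *m V' = 1%:M) (V'V : V' *m V = 1%:M).

Definition gm_scalar (J : finType) (L : groupType) (W : 'M[C]_m) : gmx C ('I_m * J) L :=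
  [seq (W ac.1 ac.2, ((ac.1, j), (ac.2, j)), 1%g) | ac <- enum {: 'I_m * 'I_m}, j <- enum J].

Lemma gm_act_scalar (J : finType) (L : groupType) W (x : 'I_m * J -> L -> C) a j g :
  gm_act (gm_scalar J L W) x (a, j) g = \sum_k W a k * x (k, j) g.
Proof.
rewrite /gm_act big_mkcond /gm_scalar big_allpairs_dep big_enum /=.
rewrite -(pair_bigA _ (fun i k => \sum_(l <- enum J)
  (if (i, l) == (a, j) then W i k * x (k, l) (1^-1 * g)%g else 0))) /=.
rewrite (bigD1 a) //= [X in _ + X]big1 ?addr0 => [|i /negPf ia]; last first.
  by rewrite big1 // => k _; rewrite big1 // => l _; rewrite xpair_eqE ia.
apply: eq_bigr => k _; rewrite big_enum (bigD1 j) //= eqxx big1 ?addr0 => [|l /negPf lj].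
  by rewrite invg1 mul1g.
by rewrite xpair_eqE lj andbF.
Qed.

Lemma gm_scalarK (J : finType) (L : groupType) W W' (x : 'I_m * J -> L -> C) :
  W *m W' = 1%:M -> gm_act (gm_scalar J L W) (gm_act (gm_scalar J L W') x) = x.
Proof.
move=> WW'; apply/funext => -[a j]; apply/funext => g; rewrite gm_act_scalar.
under eq_bigr => k _ do rewrite gm_act_scalar mulr_sumr.
rewrite exchange_big /=.
transitivity (\sum_k (W *m W') a k * x (k, j) g).
  by apply: eq_bigr => k _; rewrite mxE mulr_suml; apply: eq_bigr => l _; rewrite mulrA.
rewrite WW' (bigD1 a) //= !mxE eqxx mul1r big1 ?addr0 // => k /negPf ka.
by rewrite !mxE eq_sym ka mul0r.
Qed.

Definition gm_special (J : finType) (L : groupType) (b : gmx {poly C} J L) : gmx C ('I_m * J) L :=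
  gm_block (enum 'I_m) (fun k => gm_coefs (horner^~ (r k)) b).

(** The conjugate of [gm_special b] by [V], with the entries spelled out to
    exhibit them as combinations of coefficients of the entries of [b] by the
    numbers [(V *m diag_mx (\row_k r k ^+ n) *m V') i j]. *)
Definition gm_companion (J : finType) (L : groupType) (b : gmx {poly C} J L) :
    gmx C ('I_m * J) L :=
  [seq ((V *m diag_mx (\row_k (tcoef e).[r k]) *m V') ac.1 ac.2,
       ((ac.1, trow e), (ac.2, tcol e)), telt e) | e <- b, ac <- enum {: 'I_m * 'I_m}].

Lemma gm_companion_conj (J : finType) (L : groupType) (b : gmx {poly C} J L) x :
  gm_act (gm_companion b) (gm_act (gm_scalar J L V) x) =
  gm_act (gm_scalar J L V) (gm_act (gm_special b) x).
Proof.
apply/funext => -[a i]; apply/funext => g; rewrite gm_act_scalar.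
transitivity (\sum_(e <- b | trow e == i) \sum_k
    V a k * ((tcoef e).[r k] * x (k, tcol e) ((telt e)^-1 * g)%g)); last first.
  rewrite exchange_big; apply: eq_bigr => k _.
  by rewrite gm_act_block /gm_act /gm_coefs big_map mulr_sumr.
rewrite {1}/gm_act big_mkcond /gm_companion big_allpairs_dep /= [RHS]big_mkcond.
apply: eq_bigr => e _; rewrite big_enum.
set W := V *m _ *m V'.
rewrite -(pair_bigA _ (fun a' c => if (a', trow e) == (a, i) then
   W a' c * gm_act (gm_scalar J L V) x (c, tcol e) ((telt e)^-1 * g)%g else 0)) /=.
rewrite (bigD1 a) //= [X in _ + X]big1 ?addr0 => [|a' /negPf a'a]; last first.
  by rewrite big1 // => c _; rewrite xpair_eqE a'a.
under eq_bigr => c _ do rewrite xpair_eqE eqxx andTb.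
case: (trow e =P i) => [_|_]; last by rewrite big1.
under eq_bigr => c _ do rewrite gm_act_scalar mulr_sumr.
rewrite exchange_big /=; apply: eq_bigr => k _.
have -> : V a k * ((tcoef e).[r k] * x (k, tcol e) ((telt e)^-1 * g)%g) =
    (W *m V) a k * x (k, tcol e) ((telt e)^-1 * g)%g.
  by rewrite /W -mulmxA V'V mulmx1 mul_mx_diag !mxE mulrA.
by rewrite mxE mulr_suml; apply: eq_bigr => c _; rewrite mulrA.
Qed.

Lemma rdim_companion (J : finType) (L : groupType) (b : gmx {poly C} J L) :
  rdim (gm_special b) = rdim (gm_companion b).
Proof.
apply: (@similar_rdim _ _ _ _ _ (gm_scalar J L V) (gm_scalar J L V')).
- by move=> x; apply: gm_scalarK.
- by move=> x; apply: gm_scalarK.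
- move=> x [lx bx]; split; first exact: vl2_act.
  by rewrite gm_companion_conj bx; apply/funext => -[a j]; apply/funext => g;
    rewrite gm_act_scalar big1 // => k _; rewrite mulr0.
move=> x [lx bx]; split; first exact: vl2_act.
rewrite -[LHS](@gm_scalarK _ _ V' V) // -gm_companion_conj gm_scalarK // bx.
by apply/funext => -[a j]; apply/funext => g; rewrite gm_act_scalar big1 // => k _; rewrite mulr0.
Qed.

End Specialization.

End Conjugates.

Section AlgebraicCoefficients.
Variables (R : realType) (G : groupType) (H : nat -> groupType).
Variable p : forall i, ghom G (H i).
Hypothesis sep : forall s : seq G, exists i0, forall i, (i0 <= i)%N ->
  forall g, g \in s -> p i g = 1%g -> g = 1%g.
Hypothesis bound : forall i, det_bound R (H i).
Local Notation C := R[i].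

Lemma rdim_lower_eq (I J : finType) (b : gmx C I G) (b' : gmx C J G) :
  rdim b = rdim b' -> (forall i, rdim_at p b i = rdim_at p b' i) ->
  rdim_lower p b' -> rdim_lower p b.
Proof.
by move=> bb bbi low; rewrite /rdim_lower bb; apply: tends0_le low => i; rewrite bbi.
Qed.

(** Scaling makes the entries integers, [offdiag] makes the matrix self-adjoint;
    neither affects lower estimates for the kernel. *)
Lemma rdim_lower_rat (J : finType) (b : gmx C J G) :
  (forall e, e \in b -> exists q : rat, tcoef e = ratr q) -> rdim_lower p b.
Proof.
move=> bq; have [D [D0 [V DV]]] := clear_denominators bq.
have D0' : D%:R != 0 :> C by rewrite pnatr_eq0 -lt0n.
pose c : gmx C J G := gm_coefs intr V.
have : rdim_lower p (gm_block (enum {: bool}) (fun k => if k then gm_adj c else c)).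
  apply: (@rdim_lower_eq _ _ _ (herm R (offdiag V))); last exact: rdim_lower_herm.
    by rewrite rdim_offdiag.
  move=> i; rewrite /rdim_at gm_map_herm_intr gm_map_block.
  have -> : gm_map (p i) (offdiag V) = offdiag (gm_map (p i) V).
    by rewrite /gm_map /offdiag -!map_comp; apply: eq_map.
  rewrite rdim_offdiag; congr (rdim (gm_block _ _)); apply/funext; case.
    by rewrite /gm_adj gm_map_star; congr gm_star; rewrite /c /gm_coefs /gm_map -!map_comp.
  by rewrite /c /gm_coefs /gm_map -!map_comp.
move=> /(rdim_lower_block sep false); apply: rdim_lower_eq; last move=> i.
  by apply: eq_rdim; rewrite -(vker_scale b D0') DV.
rewrite /rdim_at; apply: eq_rdim; rewrite -(vker_scale _ D0') -gm_map_scale DV.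
by [].
Qed.

(** Adjoining one algebraic number [a] at a time: a matrix with entries [q.[a]]
    is one diagonal block of the matrix of its conjugates [q.[r k]], which is
    similar to a larger matrix free of [a]. *)
Lemma rdim_lower_span (s : seq C) : (forall a, a \in s -> algebraic_number a) ->
  forall (J : finType) (b : gmx C J G),
    (forall e, e \in b -> coef_span s (tcoef e)) -> rdim_lower p b.
Proof.
elim: s => [|a s IHs] alg J b bs; first exact: rdim_lower_rat.
have {}IHs := IHs (fun z zs => alg z (mem_behead (s := a :: s) zs)).
have [m [V [V' [r [VV' V'V [k0 rk0] rat]]]]] := diagonal_rational (alg a (mem_head _ _)).
pose Q (e : gterm C J G) (q : {poly C}) := e \in b ->
  (forall k, coef_span s q`_k) /\ tcoef e = q.[a].
have [q qE] : {q & forall e, Q e (q e)}.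
  apply: choice => e; have [eb|eb] := boolP (e \in b).
    by have [q qE] := bs e eb; exists q.
  by exists 0 => eb'; rewrite eb' in eb.
pose bq : gmx {poly C} J G := [seq (q e, (trow e, tcol e), telt e) | e <- b].
have bE : b = gm_coefs (horner^~ (r k0)) bq.
  rewrite /gm_coefs /bq -map_comp -[LHS]map_id; apply/eq_in_map => e eb /=.
  by rewrite rk0 -(qE e eb).2; case: e {eb} => [[? []]].
have low : rdim_lower p (gm_companion V V' r bq).
  apply: IHs => e /allpairsP[[f [i j]] /= [/mapP[f0 f0b ->] _ ->]]; rewrite {1}/tcoef /=.
  have -> : (V *m diag_mx (\row_k (q f0).[r k]) *m V') i j = \sum_(n < size (q f0))
      (q f0)`_n * (V *m diag_mx (\row_k r k ^+ n) *m V') i j.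
    under [RHS]eq_bigr => n _ do rewrite mxE mulr_sumr.
    rewrite exchange_big mxE; apply: eq_bigr => k _.
    rewrite mul_mx_diag !mxE horner_coef mulr_sumr mulr_suml; apply: eq_bigr => n _.
    by rewrite mul_mx_diag !mxE; ring.
  apply: coef_span_sum => n; have [t ->] := rat n i j.
  by apply: coef_spanZ; exact: (qE f0 f0b).1.
have {}low : rdim_lower p (gm_special r bq).
  apply: rdim_lower_eq low => [|i]; first exact: rdim_companion.
  rewrite /rdim_at /gm_special gm_map_block.
  have -> : (fun k => gm_map (p i) (gm_coefs (horner^~ (r k)) bq)) =
      (fun k => gm_coefs (horner^~ (r k)) (gm_map (p i) bq)).
    by apply/funext => k; rewrite /gm_map /gm_coefs -!map_comp.
  rewrite -/(gm_special r _) (rdim_companion r VV' V'V); congr rdim.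
  rewrite /gm_companion /gm_map [LHS]allpairs_mapl map_allpairs.
  by [].
by rewrite bE; apply: rdim_lower_block low.
Qed.

Lemma rdim_lower_algebraic (J : finType) (b : gmx C J G) :
  (forall e, e \in b -> algebraic_number (tcoef e)) -> rdim_lower p b.
Proof.
move=> alg; apply: (@rdim_lower_span [seq tcoef e | e <- b]) => [a|e eb].
  by case/mapP => e eb ->; apply: alg.
exact/mem_coef_span/map_f.
Qed.

End AlgebraicCoefficients.

(** * Approximation *)

(** By monotonicity the finitely many indices excluding each nontrivial element
    of [s] can be replaced by their maximum. *)
Lemma quotients_separate (G : groupType) (N : nat -> normal_subgroup G) :
  (forall i, {subset N i.+1 <= N i}) ->
  (forall g : G, (forall i, g \in (N i : groupClosed G)) -> g = 1%g) ->
  forall s : seq G, exists i0, forall i, (i0 <= i)%N ->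
    forall g, g \in s -> quot_proj (N i) g = 1%g -> g = 1%g.
Proof.
move=> decr cap; elim=> [|g s [i0 si]]; first by exists 0%N.
have mono i k : {subset N (i + k)%N <= N i}.
  by elim: k => [|k IH] h; rewrite ?addn0 // addnS => /decr/IH.
suff [i1 gi] : exists i1, g \in (N i1 : groupClosed G) -> g = 1%g.
  exists (maxn i0 i1) => i; rewrite geq_max => /andP[i0i i1i] h.
  rewrite inE => /predU1P[->|hs]; last exact: si.
  by move/ker_quot_proj; rewrite -(subnKC i1i) => /mono.
have [g1|g1] := pselect (g = 1%g); first by exists 0%N.
have /existsNP[i gi] : ~ forall i, g \in (N i : groupClosed G) by move/cap.
by exists i.
Qed.

Local Open Scope classical_set_scope.
Local Open Scope ring_scope.

Theorem theorem1p6 (R : realType) (G : groupType)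
  (N : nat -> normal_subgroup G)
  (N_decr : forall i, {subset N i.+1 <= N i})
  (N_cap : forall g : G, (forall i, g \in (N i : groupClosed G)) -> g = 1%g)
  (N_D : forall i, class_D (quotient_group (N i)))
  (d : nat) (B : 'M[group_ring R G]_d)
  (B_alg : forall j k g, algebraic_number (B j k g)) :
  (fun i => dim_ker (map_mx (group_ring_map (quot_proj (N i))) B) : R[i]^o)
    @ \oo --> (dim_ker B : R[i]^o).
Proof.
pose p i : ghom G (quotient_group (N i)) := quot_proj (N i).
have sep := quotients_separate N_decr N_cap : forall s : seq G, exists i0, forall i,
  (i0 <= i)%N -> forall g, g \in s -> p i g = 1%g -> g = 1%g.
pose b := mx_terms B.
have up := rdim_upper sep b.
have dets i : det_bound R (quotient_group (N i)) by apply: class_D_det_bound.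
have low : rdim_lower p b.
  apply: (rdim_lower_algebraic sep dets) => e.
  by case/allpairsPdep => ij [h [_ _ ->]]; apply: B_alg.
have dimE (L : groupType) (c : gmx R[i] 'I_d L) : vdim (vker c) = (rdim c)%:C%C.
  exact: rdimE (damps_max c).
apply/(@cvgrPdist_le _ R[i]^o) => e e0.
(* A positive complex number is real. *)
have [r r0 er] : exists2 r, 0 < r & e = r%:C%C.
  exists (complex.Re e); first by move: e0; rewrite ltcE => /andP[_].
  by rewrite RRe_real // gtr0_real.
have [n1 up1] := up r r0; have [n2 low2] := low r r0.
exists (maxn n1 n2) => // i /=; rewrite geq_max => /andP[/up1 upi /low2 lowi].
rewrite dim_kerE dim_ker_map !dimE er -rmorphB normc_def /= expr0n addr0 sqrtr_sqr lecR.
rewrite ler_norml lowi andbT lerNl; apply: le_trans upi.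
by rewrite opprB.
Qed.
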